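(* Let $\nu\in\mathbb R$ and let $\Psi:\mathbb R\to[0,+\infty]$ be a proper lower semi-continuous convex function with $\Psi^*(0)=0$ (i.e. $\inf\Psi=0$). Assume that $\Psi^*$ is finite on $[-s_0,0]$ for some $s_0>0$. Let $\rho_0,\rho_1\in\mathcal M_+(\mathbb T^d)$. Then $$\mathrm{Ruot}_{\nu,\Psi}(\rho_0,\rho_1)=\sup_\phi\Big\{\langle\phi(1),\rho_1\rangle-\langle\phi(0),\rho_0\rangle\ :\ \partial_t\phi+\tfrac12|\nabla\phi|^2+\tfrac\nu2\Delta\phi+\Psi^*(\phi)\le0\text{ on }[0,1]\times\mathbb T^d\Big\},$$ where the supremum is over all $C^2$ functions $\phi:[0,1]\times\mathbb T^d\to\mathbb R$. In addition, if there exists a competitor for the regularized unbalanced optimal transport problem between $\rho_0$ and $\rho_1$, then the infimum defining $\mathrm{Ruot}_{\nu,\Psi}(\rho_0,\rho_1)$ is attained.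
   Context: $\mathbb T^d$ is the flat torus; $\mathcal M,\mathcal M_+$ denote finite signed/nonnegative Borel measures; $\langle\phi,\alpha\rangle=\int\phi\,d\alpha$; $\phi(t)=\phi(t,\cdot)$. $\Psi^*(s)=\sup_{r\in\mathbb R}\{rs-\Psi(r)\}$. A triple $(\rho,m,\zeta)\in\mathcal M([0,1]\times\mathbb T^d)\times\mathcal M([0,1]\times\mathbb T^d)^d\times\mathcal M([0,1]\times\mathbb T^d)$ satisfies the continuity equation $\partial_t\rho+\mathrm{div}\,m=\frac\nu2\Delta\rho+\zeta$ with boundary conditions $\rho_0,\rho_1$ if for all smooth $\phi:[0,1]\times\mathbb T^d\to\mathbb R$, $$\langle\partial_t\phi+\tfrac\nu2\Delta\phi,\rho\rangle+\langle\nabla\phi,m\rangle+\langle\phi,\zeta\rangle=\langle\phi(1),\rho_1\rangle-\langle\phi(0),\rho_0\rangle.$$ The energy is $E_\Psi(\rho,m,\zeta)=\sup\{\langle a,\rho\rangle+\langle b,m\rangle+\langle c,\zeta\rangle\}\in[0,+\infty]$, the supremum being over continuous $a,c:[0,1]\times\mathbb T^d\to\mathbb R$ and $b:[0,1]\times\mathbb T^d\to\mathbb R^d$ with $a+\frac{|b|^2}2+\Psi^*(c)\le0$ everywhere. $\mathrm{Ruot}_{\nu,\Psi}(\rho_0,\rho_1)$ is the infimum of $E_\Psi(\rho,m,\zeta)$ over all triples satisfying the continuity equation with boundary conditions $\rho_0,\rho_1$ ($+\infty$ if there are none). A competitor is such a triple with $E_\Psi(\rho,m,\zeta)<+\infty$.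 *)

(* Defs.v *)
From HB Require Import structures.
From mathcomp Require Import all_boot all_order all_algebra.
From mathcomp Require Import all_classical all_reals all_analysis.

Set Implicit Arguments.
Unset Strict Implicit.
Unset Printing Implicit Defensive.
Import Order.TTheory GRing.Theory Num.Theory.
Import numFieldNormedType.Exports.
Local Open Scope classical_set_scope.
Local Open Scope ring_scope.

Section torus.
Local Open Scope quotient_scope.
Context (R : realType) (d : nat).

Definition lattice_rel : rel 'rV[R]_d :=
  fun x y => [forall i, (x 0 i - y 0 i) \is a Num.int].

Lemma lattice_rel_refl : reflexive lattice_rel.
Proof. by move=> x; apply/forallP => i; rewrite subrr rpred0. Qed.

Lemma lattice_rel_sym : symmetric lattice_rel.
Proof.
by move=> x y; apply/forallP/forallP => xy i; rewrite -opprB rpredN; exact: xy.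
Qed.

Lemma lattice_rel_trans : transitive lattice_rel.
Proof.
move=> y x z /forallP xy /forallP yz; apply/forallP => i.
by rewrite -(subrKA (y 0 i)) rpredD.
Qed.

Definition lattice_equiv :=
  EquivRel lattice_rel lattice_rel_refl lattice_rel_sym lattice_rel_trans.

(* R^d / Z^d with the quotient topology; [repr] picks a representative in R^d *)
Definition torus : Type := quotient_topology {eq_quot lattice_equiv}.

HB.instance Definition _ :=
  Topological.copy torus (quotient_topology {eq_quot lattice_equiv}).
HB.instance Definition _ :=
  Quotient.copy torus (quotient_topology {eq_quot lattice_equiv}).
HB.instance Definition _ := isPointed.Build torus (\pi_torus 0).

End torus.

Definition unit_interval (R : realType) : Type :=
  set_type (`[0, 1]%classic : set R).

HB.instance Definition _ (R : realType) :=
  Topological.copy (unit_interval R) (set_type (`[0, 1]%classic : set R)).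

Lemma unit_interval0 (R : realType) : (0 : R) \in (`[0, 1]%classic : set R).
Proof. by rewrite mem_setE /= in_itv /= lexx ler01. Qed.

HB.instance Definition _ (R : realType) :=
  isPointed.Build (unit_interval R) (SigSub (unit_interval0 R)).

Definition cylinder (R : realType) (d : nat) : Type :=
  (unit_interval R * torus R d)%type.

HB.instance Definition _ R d :=
  Topological.copy (cylinder R d) (unit_interval R * torus R d)%type.
HB.instance Definition _ R d :=
  Pointed.copy (cylinder R d) (unit_interval R * torus R d)%type.

Definition borel (X : ptopologicalType) := g_sigma_algebraType (@open X).

(* Integral of a real function against a finite signed measure, through its
   Jordan decomposition; the value does not depend on the Hahn decomposition
   chosen (Hahn_decomposition_uniq). *)
Section charge_integral.
Context {disp : measure_display} {T : measurableType disp} {R : realType}.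
Variable alpha : {charge set T -> \bar R}.

Definition hahn_pos : set T := sval (cid (Hahn_decomposition alpha)).

Definition hahn_neg : set T :=
  sval (cid (svalP (cid (Hahn_decomposition alpha)))).

Lemma hahn_posneg : hahn_decomposition alpha hahn_pos hahn_neg.
Proof. exact: svalP (cid (svalP (cid (Hahn_decomposition alpha)))). Qed.

Definition charge_integral (f : T -> R) : R :=
  \int[jordan_pos hahn_posneg]_x f x - \int[jordan_neg hahn_posneg]_x f x.

End charge_integral.

Section differential_calculus.
Context {R : realType}.

(* C^k in the Frechet sense on a finite-dimensional space: f is differentiable
   and all its directional derivatives are C^(k-1). *)
Fixpoint Ck {V : normedModType R} (k : nat) (f : V -> R) : Prop :=
  if k is k'.+1 then
    (forall x, differentiable f x) /\ forall v, Ck k' (fun x => 'D_v f x)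
  else continuous f.

Context {d : nat}.
Implicit Type phi : R * 'rV[R]_d -> R.

(* A C^k function on the manifold with boundary [0,1] x T^d is the restriction
   of a C^k function on R x T^d, and the latter is a C^k function on R x R^d
   that is Z^d-periodic in space. *)
Definition Ck_torus (k : nat) phi :=
  Ck k phi /\ forall t x y, lattice_rel x y -> phi (t, x) = phi (t, y).

Definition smooth_torus phi := forall k, Ck_torus k phi.

Definition dt phi (z : R * 'rV[R]_d) : R := 'D_((1, 0) : R * 'rV[R]_d) phi z.

Definition dx (i : 'I_d) phi (z : R * 'rV[R]_d) : R :=
  'D_((0, delta_mx 0 i) : R * 'rV[R]_d) phi z.

Definition grad phi (z : R * 'rV[R]_d) : 'rV[R]_d := \row_i dx i phi z.

Definition laplacian phi (z : R * 'rV[R]_d) : R := \sum_i dx i (dx i phi) z.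

(* the library norm on row vectors is the sup norm *)
Definition sqnorm (b : 'rV[R]_d) : R := \sum_i b 0 i ^+ 2.

Definition cyl_lift (p : cylinder R d) : R * 'rV[R]_d :=
  (set_val p.1, repr p.2).

End differential_calculus.

Definition legendre {R : realType} (Psi : R -> \bar R) (s : R) : \bar R :=
  ereal_sup [set ((r * s)%:E - Psi r)%E | r in [set: R]].

Definition econvex {R : realType} (Psi : R -> \bar R) :=
  forall (x y t : R), 0 <= t <= 1 ->
    (Psi (t * x + (1 - t) * y)%R <= t%:E * Psi x + (1 - t)%R%:E * Psi y)%E.

Section regularized_unbalanced_transport.
Context {R : realType} {d : nat}.

Local Notation cyl_charge :=
  ({charge set (borel (cylinder R d)) -> \bar R})%R.
Local Notation torus_measure :=
  ({finite_measure set (borel (torus R d)) -> \bar R})%R.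

Definition boundary_term (rho0 rho1 : torus_measure)
    (phi : R * 'rV[R]_d -> R) : R :=
  \int[rho1]_x phi (1, repr (x : torus R d)) -
  \int[rho0]_x phi (0, repr (x : torus R d)).

Definition continuity_equation (nu : R) (rho0 rho1 : torus_measure)
    (rho : cyl_charge) (m : 'I_d -> cyl_charge) (zeta : cyl_charge) : Prop :=
  forall phi : R * 'rV[R]_d -> R, smooth_torus phi ->
    charge_integral rho
        (fun p => dt phi (cyl_lift p) + nu / 2 * laplacian phi (cyl_lift p)) +
      \sum_i charge_integral (m i) (fun p => grad phi (cyl_lift p) 0 i) +
      charge_integral zeta (fun p => phi (cyl_lift p)) =
    boundary_term rho0 rho1 phi.

Definition energy_admissible (Psi : R -> \bar R) (a : cylinder R d -> R)
    (b : cylinder R d -> 'rV[R]_d) (c : cylinder R d -> R) : Prop :=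
  [/\ continuous a, continuous b, continuous c &
    forall p, ((a p + sqnorm (b p) / 2)%:E + legendre Psi (c p) <= 0)%E].

Definition energy (Psi : R -> \bar R)
    (rho : cyl_charge) (m : 'I_d -> cyl_charge) (zeta : cyl_charge) : \bar R :=
  ereal_sup [set v | exists a b c, energy_admissible Psi a b c /\
    v = (charge_integral rho a +
         \sum_i charge_integral (m i) (fun p => b p 0 i) +
         charge_integral zeta c)%:E].

Definition Ruot (nu : R) (Psi : R -> \bar R) (rho0 rho1 : torus_measure) :
    \bar R :=
  ereal_inf [set v | exists rho m zeta,
    continuity_equation nu rho0 rho1 rho m zeta /\ v = energy Psi rho m zeta].

Definition competitor (nu : R) (Psi : R -> \bar R) (rho0 rho1 : torus_measure)
    (rho : cyl_charge) (m : 'I_d -> cyl_charge) (zeta : cyl_charge) : Prop :=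
  continuity_equation nu rho0 rho1 rho m zeta /\
  (energy Psi rho m zeta < +oo)%E.

Definition subsolution (nu : R) (Psi : R -> \bar R)
    (phi : R * 'rV[R]_d -> R) : Prop :=
  forall p : cylinder R d, let z := cyl_lift p in
    ((dt phi z + sqnorm (grad phi z) / 2 + nu / 2 * laplacian phi z)%:E +
     legendre Psi (phi z) <= 0)%E.

End regularized_unbalanced_transport.

(* Main.v *)
Require Import Defs.
From HB Require Import structures.
From mathcomp Require Import all_boot all_order all_algebra.
From mathcomp Require Import all_classical all_reals all_analysis.
From mathcomp Require Import ring lra.

(** Write [L phi] for the triple of continuous functions made of
    [dt phi + nu / 2 * laplacian phi], [grad phi] and [phi], and [B phi] for the
    boundary term. A triple of measures solves the continuity equation when its
    pairing with [L phi] is [B phi] for every smooth [phi]; its energy is the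
    supremum of its pairings with the admissible triples, which form a convex set
    [K]; and [phi] is a subsolution when [L phi] belongs to [K]. The theorem is
    thus a linear programming duality between measures and continuous functions.

    Weak duality: for a subsolution [phi], [B phi] is the pairing with [L phi],
    hence at most the energy ([weak_duality]). Here [phi] is only of class C^2, and
    the continuity equation extends to such functions because the smooth ones are
    dense among them ([continuity_equation_C2], [smooth_torus_dense]).

    Strong duality ([strong_duality]): let [D] be a finite upper bound of [B] on
    subsolutions. The pairs [(lam *: k + L phi, r)] with [0 <= lam], [k] in [K] and
    [lam * D + B phi <= r] form a convex cone. If [lam *: k + L phi = 0] with
    [0 < lam], then [- phi / lam] is a subsolution, so [- B phi <= lam * D] and
    [0 <= r]. The cone form of the Hahn-Banach theorem ([cone_separation]) provides
    a linear functional on continuous triples which equals [B phi] at [L phi] and is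
    at most [D] on [K]. For this the cone has to meet every fibre, and to represent
    the functional by measures it has to be bounded; both follow from a function
    [phi] such that [L phi] is interior to [K] ([slater]), which exists because the
    Legendre transform of [Psi] is finite at a negative point. By the Riesz
    representation theorem ([riesz_signed], [triple_riesz]) the functional is a
    triple of measures; it solves the continuity equation with energy at most [D].
    When [D] is the dual value, this triple is a minimiser; and the dual value is
    finite as soon as there is a competitor, by weak duality.

    Cone separation serves twice more. It splits a bounded functional into positive
    parts, which are represented by measures built from the functional through an
    outer measure ([riesz_positive]). It also yields a translation-invariant mean on
    the bounded functions of time and space ([invariant_mean_exists]); convolving
    with the powers of a cosine kernel with respect to this mean turns periodic
    functions into trigonometric polynomials, whence the density of smooth
    functions. *)

Set Implicit Arguments.
Unset Strict Implicit.
Unset Printing Implicit Defensive.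
Import Order.TTheory GRing.Theory Num.Theory.
Import numFieldNormedType.Exports.
Local Open Scope classical_set_scope.
Local Open Scope ring_scope.

(** * Separation of convex cones *)

(** Hahn-Banach for cones. [Q] is the epigraph of a sublinear functional in a
    weak sense: its fibre over [0] is nonnegative and its fibres over [S] are
    nonempty. In a maximal cone [A] containing [Q], let [p v] be the infimum of
    the fibre over [v]. Adjoining the ray through [(- v, - p v)] keeps the fibre
    over [0] nonnegative, so this ray lies in [A] by maximality; hence
    [p (- v) = - p v], and the sublinear functional [p] is linear on [S]. *)
Lemma cone_separation (R : realType) (V : lmodType R) (S : set V)
    (Q : set (V * R)) :
  (forall u v, S u -> S v -> S (u + v)) ->
  (forall t u, S u -> S (t *: u)) ->
  (forall u v c e, Q (u, c) -> Q (v, e) -> Q (u + v, c + e)) ->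
  (forall t u c, 0 <= t -> Q (u, c) -> Q (t *: u, t * c)) ->
  (forall c, Q (0, c) -> 0 <= c) ->
  (forall v, S v -> exists c, Q (v, c)) ->
  exists l : V -> R,
    [/\ forall u v, S u -> S v -> l (u + v) = l u + l v,
        forall t u, S u -> l (t *: u) = t * l u &
        forall v c, S v -> Q (v, c) -> l v <= c].
Proof.
move=> SD SZ QD QZ Q0 QS.
have [S0|/set0P[s0 Ss0]] := eqVneq S set0.
  by exists (fun=> 0); split => [u v|t u|v c]; rewrite S0.
have [c0 Qs0] := QS _ Ss0.
(* The inclusion of [Q] is asked of nonempty sets only, because Zorn's lemma also
   considers the union of the empty chain. *)
pose P (A : set (V * R)) :=
  [/\ forall u v c e, A (u, c) -> A (v, e) -> A (u + v, c + e),
      forall t u c, 0 <= t -> A (u, c) -> A (t *: u, t * c),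
      forall c, A (0, c) -> 0 <= c & A !=set0 -> Q `<=` A].
have [F FP Ftot|A [[AD AZ A0 AQ] Amax]] := @Zorn_bigcup _ P.
  split.
  - move=> u v c e [X FX Xu] [Y FY Yv].
    have [XY|YX] := Ftot _ _ FX FY.
      by exists Y => //; have [YD _ _ _] := FP _ FY; apply: YD => //; exact: XY.
    by exists X => //; have [XD _ _ _] := FP _ FX; apply: XD => //; exact: YX.
  - move=> t u c t0 [X FX Xu]; exists X => //.
    by have [_ XZ _ _] := FP _ FX; exact: XZ.
  - by move=> c [X FX X0]; have [_ _ + _] := FP _ FX; exact.
  - move=> [z [X FX Xz]] q Qq; exists X => //.
    by have [_ _ _] := FP _ FX; apply => //; exists z.
have An0 : A !=set0.
  apply/set0P/eqP => Ae; apply: (Amax Q); last (by split => // _; exact: subset_refl).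
  by rewrite Ae; split; [exact: sub0set|move=> /(_ _ Qs0)].
have {}AQ := AQ An0.
have A00 : A (0, 0).
  have [[u c] Au] := An0.
  by have := AZ 0 _ _ (lexx 0) Au; rewrite scale0r mul0r.
pose p v := inf [set c | A (v, c)].
have SN u : S u -> S (- u) by move=> Su; rewrite -scaleN1r; exact: SZ.
have pinf v : S v -> has_inf [set c | A (v, c)].
  move=> Sv; have [c Qc] := QS _ Sv; have [e Qe] := QS _ (SN _ Sv).
  split; first by exists c; exact: AQ.
  exists (- e) => x /= Ax; rewrite -subr_ge0 opprK; apply: A0.
  by rewrite -(subrr v); apply: AD => //; exact: AQ.
have ple v c : S v -> A (v, c) -> p v <= c.
  by move=> Sv Av; apply: ge_inf => //; exact: (pinf _ Sv).2.
have key v : S v -> A (- v, - p v).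
  move=> Sv; pose A' : set (V * R) :=
    [set z | exists t w c, [/\ 0 <= t, A (w, c) & z = (w - t *: v, c - t * p v)]].
  have AA' : A `<=` A'.
    by move=> [w c] Aw; exists 0, w, c; split => //; rewrite scale0r mul0r !subr0.
  have : A' `<=` A.
    apply: contrapT => nA'A; apply: (Amax A'); first by split.
    split; last by move=> _; exact: subset_trans AA'.
    - move=> ? ? ? ? [t [w [c [t0 Aw [-> ->]]]]] [t' [w' [c' [t'0 Aw' [-> ->]]]]].
      exists (t + t'), (w + w'), (c + c'); split; [exact: addr_ge0|exact: AD|].
      by rewrite scalerDl mulrDl !opprD; congr pair; rewrite addrACA.
    - move=> s ? ? s0' [t [w [c [t0 Aw [-> ->]]]]].
      exists (s * t), (s *: w), (s * c); split; [exact: mulr_ge0|exact: AZ|].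
      by rewrite scalerBr scalerA mulrBr mulrA.
    - move=> ? [t [w [c [t0 Aw [/eqP + ->]]]]].
      rewrite eq_sym subr_eq0 => /eqP wE.
      move: t0; rewrite le_eqVlt => /predU1P[t0|t0].
        by move: Aw; rewrite wE -t0 scale0r mul0r subr0; exact: A0.
      have /ple : A (v, t^-1 * c).
        have := AZ t^-1 _ _ _ Aw; rewrite wE scalerA mulVf ?gt_eqF// scale1r.
        by apply; rewrite invr_ge0 ltW.
      by move=> /(_ Sv); rewrite ler_pdivlMl// subr_ge0.
  by apply; exists 1, 0, 0; split => //; rewrite !sub0r scale1r mul1r.
have pN v : S v -> p (- v) = - p v.
  move=> Sv; apply/eqP; rewrite eq_le ple//=; [|exact: SN|exact: key].
  apply: (@lb_le_inf _ [set c | A (- v, c)]); first exact: (pinf _ (SN _ Sv)).1.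
  move=> c /= Ac; rewrite lerNl.
  apply: (@lb_le_inf _ [set e | A (v, e)]).
    by have [e Qe] := QS _ Sv; exists e; exact: AQ.
  move=> e /= Ae; rewrite -subr_ge0 opprK; apply: A0.
  by rewrite -(subrr v); apply: AD.
have pge u v : S u -> S v -> p u + p v <= p (u + v).
  move=> Su Sv; rewrite -lerN2 -pN; last exact: SD.
  apply: ple; first by apply: SN; exact: SD.
  by rewrite !opprD; apply: AD; exact: key.
have pZge t u : 0 <= t -> S u -> t * p u <= p (t *: u).
  move=> t0 Su; rewrite -lerN2 -pN; last exact: SZ.
  rewrite -mulrN; apply: ple; first by apply: SN; exact: SZ.
  by rewrite -scalerN; apply: AZ => //; exact: key.
have pZ t u : 0 <= t -> S u -> p (t *: u) = t * p u.
  move=> t0 Su; apply/eqP; rewrite eq_le pZge// andbT.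
  by rewrite -lerN2 -(pN (t *: u) (SZ _ _ Su)) -mulrN -(pN u Su) -scalerN; apply: pZge => //; exact: SN.
exists p; split => [u v Su Sv|t u Su|v c Sv Qv].
- apply/eqP; rewrite eq_le pge// andbT -lerN2 -(pN (u + v) (SD _ _ Su Sv)) !opprD.
  by rewrite -(pN u Su) -(pN v Sv); apply: pge; exact: SN.
- have [t0|t0] := leP 0 t; first exact: pZ.
  have Nt : 0 <= - t by rewrite oppr_ge0 ltW.
  by rewrite -[t]opprK scaleNr -scalerN (pZ _ _ Nt (SN _ Su)) (pN u Su) mulrN !mulNr.
- by apply: ple => //; exact: AQ.
Qed.

(** * Riesz representation of positive functionals on a compact space *)

Section continuous_real_functions.
Context {R : realType} {X : topologicalType}.
Implicit Types f g : X -> R.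

Lemma continuous_add f g : continuous f -> continuous g -> continuous (f + g).
Proof. by move=> cf cg x; apply: cvgD; [exact: cf|exact: cg]. Qed.

Lemma continuous_scale a f : continuous f -> continuous (a *: f).
Proof. by move=> cf x; apply: cvgZl_tmp; exact: cf. Qed.

Lemma continuous_mul f g : continuous f -> continuous g -> continuous (f * g).
Proof. by move=> cf cg x; apply: cvgM; [exact: cf|exact: cg]. Qed.

Lemma continuous_const (a : R) : continuous (fun _ : X => a).
Proof. by move=> x; exact: cvg_cst. Qed.

Lemma continuous_minr f g : continuous f -> continuous g -> continuous (f \min g).
Proof. by move=> cf cg x; exact: (continuous_min (cf x) (cg x)). Qed.

Lemma continuous_maxr f g : continuous f -> continuous g -> continuous (f \max g).
Proof. by move=> cf cg x; exact: (continuous_max (cf x) (cg x)). Qed.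

Lemma continuous_sum (f : nat -> X -> R) n :
  (forall i, continuous (f i)) -> continuous (\sum_(i < n) f i).
Proof.
move=> cf; elim/big_ind : _ => [|g h|i _]; [exact: continuous_const| |exact: cf].
exact: continuous_add.
Qed.

End continuous_real_functions.

Section integral_of_continuous_functions.
Context {R : realType} {X : ptopologicalType}.
Implicit Types f g : X -> R.

Lemma continuous_measurable_borel f :
  continuous f -> measurable_fun [set: borel X] (f : borel X -> R).
Proof.
move=> /continuousP cf; apply: (measurability _ (measurable_realfun.RGenOpens.measurableE R)).
move=> _ [_ [a [b ->] <-]]; rewrite setTI; apply: sub_sigma_algebra.
exact/cf/interval_open.
Qed.

Hypothesis compX : compact [set: X].

Lemma continuous_bounded f : continuous f ->
  exists2 B, 0 < B & forall x, `|f x| <= B.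
Proof.
move=> cf; have cnf : continuous (fun x => `|f x|).
  by move=> x; apply: cvg_norm; exact: cf.
have [] := @compact_EVT_max _ _ (fun x => `|f x|) setT _ compX.
- by exists point.
- by apply: continuous_subspaceT.
- move=> c _ fc; exists (`|f c| + 1); first by rewrite ltr_wpDl.
  by move=> x; rewrite (le_trans (fc x _)) ?inE// lerDl.
Qed.

Variable mu : {finite_measure set (borel X) -> \bar R}.

Lemma continuous_integrable f : continuous f ->
  mu.-integrable [set: borel X] (EFin \o f).
Proof.
move=> cf; apply: measurable_bounded_integrable => //.
- by rewrite ltey_eq fin_num_measure.
- exact: continuous_measurable_borel.
- have [B B0 fB] := continuous_bounded cf.
  by exists B; split; [exact: gtr0_real|move=> y By x _; exact: le_trans (fB x) (ltW By)].
Qed.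

Lemma Rintegral_add f g : continuous f -> continuous g ->
  \int[mu]_x (f + g) x = \int[mu]_x f x + \int[mu]_x g x.
Proof. by move=> cf cg; apply: RintegralD => //; exact: continuous_integrable. Qed.

Lemma Rintegral_scale a f : continuous f ->
  \int[mu]_x (a *: f) x = a * \int[mu]_x f x.
Proof. by move=> cf; apply: RintegralZl => //; exact: continuous_integrable. Qed.

Lemma le_Rintegral_continuous f g : continuous f -> continuous g ->
  (forall x, f x <= g x) -> \int[mu]_x f x <= \int[mu]_x g x.
Proof. by move=> cf cg fg; apply: le_Rintegral => //; exact: continuous_integrable. Qed.

End integral_of_continuous_functions.

Section daniell.
Context {R : realType} {X : ptopologicalType}.
Variable P : (X -> R) -> R.
Hypothesis compX : compact [set: X].
Hypothesis PD : forall f g : X -> R, continuous f -> continuous g ->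
  P (f + g) = P f + P g.
Hypothesis PZ : forall a (f : X -> R), continuous f -> P (a *: f) = a * P f.
Hypothesis Pge0 : forall f : X -> R, continuous f -> (forall x, 0 <= f x) -> 0 <= P f.
Hypothesis cozero : forall U : set X, open U -> exists g : X -> R,
  [/\ continuous g, forall x, 0 <= g x & forall x, U x <-> 0 < g x].

Lemma daniell0 : P 0 = 0.
Proof. by rewrite -(scale0r 0) PZ ?mul0r//; exact: continuous_const. Qed.

Lemma daniell_le (f g : X -> R) : continuous f -> continuous g ->
  (forall x, f x <= g x) -> P f <= P g.
Proof.
move=> cf cg fg; have cNf : continuous (- f).
  by rewrite -scaleN1r; exact: continuous_scale.
rewrite -subr_ge0 -mulN1r -PZ// scaleN1r -PD//; apply: Pge0.
  exact: continuous_add.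
by move=> x; rewrite -[_ x]/(g x - f x) subr_ge0.
Qed.

Lemma daniell_sum (f : nat -> X -> R) n : (forall i, continuous (f i)) ->
  P (\sum_(i < n) f i) = \sum_(i < n) P (f i).
Proof.
move=> cf; elim: n => [|n IH]; first by rewrite !big_ord0 daniell0.
by rewrite !big_ord_recr/= PD ?IH//; exact: continuous_sum.
Qed.

(** Increasing sequences are used, and not single functions, so that the least
    cost [c] of a cover of [A] is countably subadditive. *)
Definition increasing_cover (A : set X) (g : nat -> X -> R) (c : R) :=
  [/\ forall n, continuous (g n), forall n x, 0 <= g n x,
      forall x, {homo g ^~ x : m n / (m <= n)%N >-> m <= n},
      forall x, A x -> exists n, 1 <= g n x & forall n, P (g n) <= c].

Definition daniell_costs A := [set c | exists g, increasing_cover A g c].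

Lemma daniell_costs_ge0 A c : daniell_costs A c -> 0 <= c.
Proof.
by move=> [g [gc g0 _ _ gP]]; apply: le_trans (gP 0%N); exact: Pge0.
Qed.

Lemma daniell_costs_cover1 A (f : X -> R) c : continuous f -> (forall x, 0 <= f x) ->
  (forall x, A x -> 1 <= f x) -> P f <= c -> daniell_costs A c.
Proof. by move=> cf f0 Af Pf; exists (fun=> f); split => // [x m n _|x Ax]//; exists 0%N; exact: Af. Qed.

Lemma daniell_costs_neq0 A : daniell_costs A !=set0.
Proof.
exists (P (fun=> 1)); apply: (@daniell_costs_cover1 _ (fun=> 1)) => //.
exact: continuous_const.
Qed.

Lemma daniell_costs_has_inf A : has_inf (daniell_costs A).
Proof.
split; first exact: daniell_costs_neq0.
by exists 0 => c /=; exact: daniell_costs_ge0.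
Qed.

Definition daniell_outer (A : set X) : \bar R := (inf (daniell_costs A))%:E.

Lemma daniell_outer_le A c : daniell_costs A c -> (daniell_outer A <= c%:E)%E.
Proof. by move=> Ac; rewrite lee_fin ge_inf//; exact: (daniell_costs_has_inf A).2. Qed.

Lemma daniell_outer_adherent A e : 0 < e ->
  exists2 c, daniell_costs A c & c < inf (daniell_costs A) + e.
Proof. by move=> e0; exact/inf_adherent/daniell_costs_has_inf. Qed.

Lemma daniell_outer_ge0 A : (0 <= daniell_outer A)%E.
Proof.
rewrite lee_fin; apply: lb_le_inf; first exact: daniell_costs_neq0.
by move=> c; exact: daniell_costs_ge0.
Qed.

Lemma daniell_outer0 : daniell_outer set0 = 0%E.
Proof.
apply/eqP; rewrite eq_le daniell_outer_ge0 andbT; apply: daniell_outer_le.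
apply: (@daniell_costs_cover1 _ 0) => //; last by rewrite daniell0.
exact: continuous_const.
Qed.

Lemma le_daniell_outer : {homo daniell_outer : A B / A `<=` B >-> (A <= B)%E}.
Proof.
move=> A B AB; rewrite lee_fin; apply: lb_le_inf.
  exact: daniell_costs_neq0.
move=> c [g [gc g0 gi gB gP]]; apply: ge_inf.
  exact: (daniell_costs_has_inf A).2.
by exists g; split => // x Ax; apply: gB; exact: AB.
Qed.

(** Countably many covers are merged along the diagonal: the [k]-th function of
    the new cover is the sum of the [k]-th functions of the first [k] covers. *)
Lemma daniell_outer_sigma_subadditive : sigma_subadditive daniell_outer.
Proof.
move=> A; apply/lee_addgt0Pr => e e0.
apply: le_trans; last first.
  apply: epsilon_trick; [by move=> n; exact: daniell_outer_ge0|exact: ltW].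
pose d n := e / (2 ^ n.+1)%:R.
have d0 n : 0 < d n by rewrite divr_gt0// ltr0n expn_gt0.
have /choice[g gP] : forall n, exists g,
    increasing_cover (A n) g (inf (daniell_costs (A n)) + d n).
  move=> n; have [c [g gc] cle] := daniell_outer_adherent (A n) (d0 n).
  exists g; case: gc => [? ? ? ? Pg]; split => // k.
  by rewrite (le_trans (Pg k))// ltW.
set s := (X in (_ <= X)%E); have sge n :
    ((\sum_(i < n) (inf (daniell_costs (A i)) + d i))%:E <= s)%E.
  rewrite /s -sumEFin; apply: le_trans; last first.
    apply: (@nneseries_lim_ge R _ predT 0%N n) => i _ _.
    by rewrite adde_ge0 ?daniell_outer_ge0// lee_fin ltW// d0.
  by rewrite big_mkord.
have [->|sfin] := eqVneq s +oo%E; first by rewrite leey.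
have s0 : (0 <= s)%E by have := sge 0%N; rewrite big_ord0.
have sE : s = (fine s)%:E.
  by rewrite fineK// ge0_fin_numE// lt_neqAle sfin leey.
rewrite sE; apply: daniell_outer_le.
exists (fun k => \sum_(n < k) g n k); split.
- by move=> k; apply: (@continuous_sum _ _ (fun n => g n k)) => i; case: (gP i).
- by move=> k x; rewrite fct_sumE sumr_ge0// => i _; case: (gP i).
- move=> x m n mn; rewrite !fct_sumE.
  rewrite -(subnKC mn) big_split_ord/=.
  rewrite (le_trans _ (_ : \sum_(i < m) g i (m + (n - m))%N x <= _))//.
    by apply: ler_sum => i _; case: (gP i) => _ _ + _ _; apply; exact: leq_addr.
  by rewrite lerDl sumr_ge0// => i _; case: (gP (m + i)%N).
- move=> x [n _ Anx]; have [gc g0 gi gA _] := gP n.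
  have [k gk] := gA _ Anx.
  exists (maxn k n.+1); rewrite fct_sumE.
  have nk : (n < maxn k n.+1)%N by exact: leq_maxr.
  rewrite (bigD1 (Ordinal nk))//= (le_trans gk)//.
  rewrite (le_trans (gi x _ _ (leq_maxl k n.+1)))// lerDl sumr_ge0// => i _.
  by case: (gP i).
- move=> k; rewrite -lee_fin -sE; apply: le_trans (sge k).
  rewrite lee_fin (@daniell_sum (fun n => g n k)); last by move=> i; case: (gP i).
  by apply: ler_sum => i _; case: (gP i).
Qed.

HB.instance Definition _ := isOuterMeasure.Build R X daniell_outer
  daniell_outer0 daniell_outer_ge0 le_daniell_outer
  daniell_outer_sigma_subadditive.

(** Let [k n] increase to the indicator of [U]. A cover [g] of [A] splits into
    [g n * k n], which covers [A `&` U], and [g (N + n) * (1 - k N)], which covers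
    the rest. The two costs add up to that of [g], up to [e / 2], when [N] almost
    realises the supremum of [P (g n * k n)]. *)
Lemma open_caratheodory U : open U -> caratheodory_measurable daniell_outer U.
Proof.
move=> oU; apply: le_caratheodory_measurable => A /=.
have [h [ch h0 hU]] := cozero oU.
pose k n := fun x => Num.min 1 (n%:R * h x).
have ck n : continuous (k n).
  apply: (@continuous_minr _ _ (fun=> 1)); first exact: continuous_const.
  by apply: (@continuous_mul _ _ (fun=> n%:R)) => //; exact: continuous_const.
have k0 n x : 0 <= k n x by rewrite /k le_min ler01 mulr_ge0// ler0n.
have k1 n x : k n x <= 1 by rewrite /k ge_min lexx.
have ki x : {homo k ^~ x : m n / (m <= n)%N >-> m <= n}.
  move=> m n mn; rewrite /k le_min ge_min lexx/= ge_min ler_wpM2r ?orbT//.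
  by rewrite ler_nat.
apply/lee_addgt0Pr => e e0.
have e20 : 0 < e / 2 by rewrite divr_gt0.
have [c [g [gc g0 gi gA gP]] cle] := daniell_outer_adherent A e20.
have cgk n m : continuous (g n * k m) by exact: continuous_mul.
pose a := sup (range (fun n => P (g n * k n))).
have asup : has_sup (range (fun n => P (g n * k n))).
  split; first by exists (P (g 0%N * k 0%N)); exists 0%N.
  exists c => _ [n _ <-]; apply: le_trans (gP n); apply: daniell_le => // x.
  by rewrite -[_ x]/(g n x * k n x) ler_piMr.
have [_ [N _ <-] aN] := sup_adherent e20 asup.
have AU : (daniell_outer (A `&` U) <= a%:E)%E.
  apply: daniell_outer_le; exists (fun n => g n * k n); split => //.
  - by move=> n x; exact: mulr_ge0.
  - by move=> x m n mn; rewrite -!/((g _ x) * (k _ x)) ler_pM ?gi ?ki.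
  - move=> x [/gA[n gn] /hU hx].
    pose m := maxn n (Num.bound (h x)^-1).
    exists m; rewrite -[_ x]/(g m x * k m x).
    have -> : k m x = 1.
      apply/min_idPl; rewrite -ler_pdivrMr// mul1r ltW//.
      rewrite (lt_le_trans (archi_boundP _)) ?invr_ge0 ?ler_nat ?leq_maxr// ltW//.
    by rewrite mulr1 (le_trans gn)// gi// leq_maxl.
  - by move=> n; apply: ub_le_sup; [exact: asup.2|exists n].
have AV : (daniell_outer (A `&` ~` U) <= (c - P (g N * k N))%:E)%E.
  apply: daniell_outer_le; exists (fun n => g (N + n)%N * (1 - k N)).
  have c1k : continuous (1 - k N).
    apply: continuous_add; first exact: continuous_const.
    by rewrite -scaleN1r; exact: continuous_scale.
  have k1N x : 0 <= (1 - k N) x by rewrite -[_ x]/(1 - k N x) subr_ge0.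
  split => //.
  - by move=> n; exact: continuous_mul.
  - by move=> n x; exact: mulr_ge0.
  - move=> x m n mn; apply: ler_pM => //; apply: gi; by rewrite leq_add2l.
  - move=> x [/gA[n gn] /= nUx]; exists n; rewrite -[_ x]/(g (N + n)%N x * (1 - k N x)).
    have -> : k N x = 0.
      have -> : k N x = Num.min 1 (N%:R * h x) by [].
      have -> : h x = 0.
        by apply/eqP; rewrite eq_le h0 andbT leNgt; apply/negP => /hU.
      by rewrite mulr0; apply/min_idPr.
    by rewrite subr0 mulr1 (le_trans gn)// gi// leq_addl.
  - move=> n; have -> : g (N + n)%N * (1 - k N) = g (N + n)%N + (-1) *: (g (N + n)%N * k N).
      by rewrite mulrBr mulr1 scaleN1r.
    rewrite PD ?PZ//; last exact: continuous_scale.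
    rewrite mulN1r lerB// daniell_le// => x.
    by rewrite -!/((g _ x) * (k _ x)) ler_wpM2r// gi// leq_addr.
apply: (le_trans (leeD AU AV)); rewrite -EFinD lee_fin.
rewrite -/a in aN; lra.
Qed.

Lemma borel_caratheodory (A : set (borel X)) :
  measurable A -> caratheodory_measurable daniell_outer A.
Proof.
suff : <<s @open X >> `<=` caratheodory_measurable daniell_outer by exact.
apply: smallest_sub; last by move=> U; exact: open_caratheodory.
split => [|B|F]; first exact: caratheodory_measurable_set0.
- by rewrite setTD; exact: caratheodory_measurable_setC.
- exact: caratheodory_measurable_bigcup.
Qed.

Definition daniell_measure (A : set (borel X)) : \bar R := daniell_outer A.

Lemma daniell_measure_sigma_additive : semi_sigma_additive daniell_measure.
Proof.
move=> F mF tF mUF.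
have := @caratheodory_measure_sigma_additive R X daniell_outer F.
by apply => //; [move=> i|]; exact: borel_caratheodory.
Qed.

HB.instance Definition _ := isMeasure.Build _ (borel X) R daniell_measure
  daniell_outer0 daniell_outer_ge0 daniell_measure_sigma_additive.

Lemma daniell_measure_fin_num : fin_num_fun daniell_measure.
Proof. by []. Qed.

HB.instance Definition _ :=
  Measure_isFinite.Build _ (borel X) R daniell_measure daniell_measure_fin_num.

(** By compactness (as in Dini's theorem) a function [g n] of an increasing cover
    of the whole space exceeds [1 - d] everywhere. *)
Lemma daniell_measureT : daniell_measure setT = (P (fun=> 1))%:E.
Proof.
have c1 : continuous (fun _ : X => 1 : R) by exact: continuous_const.
apply/eqP; rewrite eq_le; apply/andP; split.
  by apply: daniell_outer_le; apply: (@daniell_costs_cover1 _ (fun=> 1)).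
rewrite lee_fin; apply: lb_le_inf; first exact: daniell_costs_neq0.
move=> c [g [gc g0 gi gT gP]]; apply/ler_addgt0Pr => e e0.
pose d := e / (P (fun=> 1) + 1).
have P1 : 0 <= P (fun=> 1) by exact: Pge0.
have d0 : 0 < d by rewrite divr_gt0// ltr_wpDl.
have : \forall n \near \oo, [set: X] `<=` [set x | 1 - d < g n x].
  have /compact_near_coveringP := compX; apply => x _.
  have [N gN] := gT x I; near=> y n => /=.
  rewrite (@lt_le_trans _ _ (g N y))//; last by apply: gi; near: n; exists N.
  near: y; apply: (cvgr_gt (g N x)); first exact: gc.
  by rewrite ltrBlDr (le_lt_trans gN)// ltrDl.
move=> [N _ /(_ N (leqnn N)) gN].
apply: (@le_trans _ _ (P (g N + d *: (fun=> 1)))).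
  apply: daniell_le => //.
    by apply: continuous_add => //; exact: continuous_scale.
  move=> x; rewrite -[leRHS]/(g N x + d * 1) mulr1 -lerBlDr ltW//.
  exact: gN.
rewrite PD ?PZ//; last exact: continuous_scale.
rewrite lerD// /d mulrAC ler_pdivrMr ?ltr_wpDl// ler_pM2l// lerDl ler01.
Unshelve. all: by end_near.
Qed.

Lemma sum_unit_layers (y : R) (n : nat) : 0 <= y ->
  \sum_(j < n) Num.min 1 (Num.max 0 (y - j%:R)) = Num.min y n%:R.
Proof.
move=> y0; elim: n => [|n IH]; first by rewrite big_ord0; exact/esym/min_idPr.
rewrite big_ord_recr/= IH -natr1.
by rewrite !minEle !maxEle; repeat case: ifPn; rewrite -?ltNge; lra.
Qed.

(** [N * f] is the sum of its layers [h j], the part of its values between [j] and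
    [j + 1]. The set where [h j = 1] has measure at most [P (h j)] and carries
    [h j.+1], so that integrating [h j.+1] gives at most [P (h j)]. The shift of
    index costs one layer, hence [P 1 / N] after division by [N]. *)
Lemma daniell_Rintegral_le (f : X -> R) : continuous f -> (forall x, 0 <= f x) ->
  \int[daniell_measure]_x f x <= P f.
Proof.
move=> cf f0; apply/ler_addgt0Pr => e e0.
have P1 : 0 <= P (fun=> 1) by apply: Pge0 => //; exact: continuous_const.
have [B B0 fB] := continuous_bounded compX cf.
pose N := (Num.bound (P (fun=> 1) / e)).+1.
have Ne : P (fun=> 1) <= N%:R * e.
  by rewrite -ler_pdivrMr// (le_trans (ltW (archi_boundP _))) ?ler_nat// divr_ge0// ltW.
pose m := Num.bound (N%:R * B).
have fm x : N%:R * f x <= m%:R.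
  rewrite (le_trans _ (ltW (archi_boundP _)))//; last by rewrite mulr_ge0// ltW.
  by rewrite ler_wpM2l// (le_trans (ler_norm _)).
pose h (j : nat) : X -> R := fun x => Num.min 1 (Num.max 0 (N%:R * f x - j%:R)).
have ch j : continuous (h j).
  apply: (@continuous_minr _ _ (fun=> 1)); first exact: continuous_const.
  apply: (@continuous_maxr _ _ (fun=> 0)); first exact: continuous_const.
  apply: (@continuous_add _ _ (N%:R *: f) (fun=> - j%:R)).
    exact: continuous_scale.
  exact: continuous_const.
have h0 j x : 0 <= h j x by rewrite /h le_min ler01/= le_max lexx.
have h1 j x : h j x <= 1 by rewrite /h ge_min lexx.
have sumh x : \sum_(j < m.+1) h j x = N%:R * f x.
  rewrite sum_unit_layers ?mulr_ge0//; apply/min_idPl.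
  by rewrite (le_trans (fm x))// ler_nat.
have hint j : \int[daniell_measure]_x h j.+1 x <= P (h j).
  pose A : set (borel X) := [set x | 1 <= h j x].
  have mA : measurable A.
    rewrite -[A]setTI (_ : A = (h j : borel X -> R) @^-1` `[1, +oo[%classic).
      by apply: continuous_measurable_borel => //.
    by apply/seteqP; split => x /=; rewrite in_itv/= andbT.
  have hA x : h j.+1 x <= \1_A x.
    rewrite indicE; have [/set_mem Ax|/negP nAx] := boolP (x \in A) => //.
    rewrite /h ge_min ge_max lexx/= subr_le0; apply/orP; right.
    rewrite leNgt; apply/negP => jf; apply: nAx; rewrite inE /A/= /h.
    rewrite le_min lexx/= le_max; apply/orP; right.
    by rewrite lerBrDr nat1r ltW.
  apply: (@le_trans _ _ (fine (daniell_measure A))).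
    rewrite -[X in _ <= fine (_ X)]setIT -integral_indic// -/(Rintegral _ _ _).
    apply: le_Rintegral => //; first exact: continuous_integrable.
    exact: integrable_indic.
  rewrite -lee_fin fineK ?daniell_measure_fin_num//.
  by apply: daniell_outer_le; exact: (@daniell_costs_cover1 _ (h j)).
suff : N%:R * \int[daniell_measure]_x f x <= N%:R * (P f + e).
  by rewrite ler_pM2l// ltr0n.
rewrite -Rintegral_scale// mulrDr -PZ//.
have NfE : N%:R *: f = \sum_(j < m.+1) h j.
  by apply/funext => x; rewrite fct_sumE sumh.
have NfE' : N%:R *: f = h 0%N + \sum_(i < m) h i.+1.
  by rewrite NfE big_ord_recl; congr (_ + _); apply: eq_bigr.
rewrite {1}NfE' Rintegral_add//; last exact: (@continuous_sum _ _ (fun j => h j.+1)).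
have -> : \int[daniell_measure]_x (\sum_(i < m) h i.+1) x =
    \sum_(i < m) \int[daniell_measure]_x h i.+1 x.
  elim: {fm sumh NfE NfE'} m => [|n IH].
    rewrite !big_ord0 -(scale0r (0 : X -> R)) Rintegral_scale ?mul0r//.
    exact: continuous_const.
  rewrite !big_ord_recr/= -IH Rintegral_add//.
  exact: (@continuous_sum _ _ (fun j => h j.+1)).
have h0P : \int[daniell_measure]_x h 0%N x <= P (fun=> 1).
  have -> : P (fun=> 1) = \int[daniell_measure]_x 1.
    by rewrite Rintegral_cst// mul1r; exact: esym (congr1 fine daniell_measureT).
  by apply: le_Rintegral_continuous => //; exact: continuous_const.
rewrite addrC lerD//; last by rewrite (le_trans h0P).
rewrite NfE daniell_sum// [leRHS]big_ord_recr/=.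
apply: (@le_trans _ _ (\sum_(i < m) P (h i))).
  by apply: ler_sum => i _; exact: hint.
by rewrite lerDl; exact: Pge0.
Qed.

(** Equality follows from the upper bounds for [B + f] and [B - f], since the
    total mass is known. *)
Lemma daniell_Rintegral (f : X -> R) : continuous f -> \int[daniell_measure]_x f x = P f.
Proof.
move=> cf; have [B B0 fB] := continuous_bounded compX cf.
have cB : continuous (fun _ : X => B) by exact: continuous_const.
have intB : \int[daniell_measure]_x B = P (fun=> B).
  rewrite Rintegral_cst// (congr1 fine daniell_measureT : fine _ = _).
  rewrite -PZ; last exact: continuous_const.
  by congr P; apply/funext => x; rewrite -[LHS]/(B * 1) mulr1.
have cNf : continuous (-1 *: f) by exact: continuous_scale.
have := @daniell_Rintegral_le ((fun=> B) + -1 *: f).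
have := @daniell_Rintegral_le ((fun=> B) + f).
rewrite !Rintegral_add// !PD// Rintegral_scale// PZ// intB !mulN1r !lerD2l.
rewrite lerN2 => le1 le2; apply/eqP; rewrite eq_le le1 ?le2//.
- exact: continuous_add.
- move=> x; rewrite -[X in 0 <= X]/(B + -1 * f x) mulN1r subr_ge0.
  exact: le_trans (ler_norm _) (fB x).
- exact: continuous_add.
- move=> x; rewrite -[X in 0 <= X]/(B + f x).
  by have := fB x; rewrite ler_norml => /andP[]; lra.
Qed.

Lemma riesz_positive : exists mu : {finite_measure set (borel X) -> \bar R},
  forall f : X -> R, continuous f -> \int[mu]_x f x = P f.
Proof. by exists daniell_measure; exact: daniell_Rintegral. Qed.

End daniell.

(** * Riesz representation of bounded functionals by signed measures *)

Section charge_integral_on_compact.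
Context {R : realType} {X : ptopologicalType}.
Hypothesis compX : compact [set: X].
Implicit Types (f g : X -> R) (alpha : {charge set (borel X) -> \bar R}).

Lemma charge_integralD alpha f g : continuous f -> continuous g ->
  charge_integral alpha (f + g) = charge_integral alpha f + charge_integral alpha g.
Proof.
move=> cf cg; rewrite /charge_integral !Rintegral_add//.
by rewrite opprD addrACA.
Qed.

Lemma charge_integralZ alpha a f : continuous f ->
  charge_integral alpha (a *: f) = a * charge_integral alpha f.
Proof.
by move=> cf; rewrite /charge_integral !Rintegral_scale// mulrBr.
Qed.

Lemma normr_Rintegral_le (mu : {finite_measure set (borel X) -> \bar R}) f B :
  continuous f -> (forall x, `|f x| <= B) ->
  `|\int[mu]_x f x| <= B * fine (mu setT).
Proof.
move=> cf fB.
have cB a : continuous (fun _ : X => a : R) by exact: continuous_const.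
rewrite -Rintegral_cst// ler_norml; apply/andP; split.
  rewrite -mulN1r -Rintegral_scale//.
  apply: le_Rintegral_continuous => // [|x]; first exact: continuous_scale.
  by rewrite -[leLHS]/(-1 * B) mulN1r; have := fB x; rewrite ler_norml => /andP[].
by apply: le_Rintegral_continuous => // x; rewrite (le_trans (ler_norm _)).
Qed.

Lemma charge_integral_bounded alpha : exists2 C, 0 < C &
  forall f B, continuous f -> (forall x, `|f x| <= B) ->
  `|charge_integral alpha f| <= B * C.
Proof.
pose p := jordan_pos (hahn_posneg alpha); pose n := jordan_neg (hahn_posneg alpha).
have pT0 : 0 <= fine (p setT) by exact: fine_ge0.
have nT0 : 0 <= fine (n setT) by exact: fine_ge0.
exists (fine (p setT) + fine (n setT) + 1); first by rewrite ltr_wpDl// addr_ge0.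
move=> f B cf fB; have B0 : 0 <= B by rewrite (le_trans _ (fB point)).
rewrite (le_trans (ler_normB _ _))// !mulrDr mulr1 ler_wpDr// lerD//.
all: exact: normr_Rintegral_le.
Qed.

(** The Jordan decomposition [p - n] of [mu1 - mu2] need not be [(mu1, mu2)], but
    [mu1 + n] and [p + mu2] are the same measure. *)
Lemma charge_integral_diff (mu1 mu2 : {finite_measure set (borel X) -> \bar R}) :
  exists alpha, forall f, continuous f ->
    charge_integral alpha f = \int[mu1]_x f x - \int[mu2]_x f x.
Proof.
pose alpha : {charge set (borel X) -> \bar R} :=
  cadd (charge_of_finite_measure mu1) (copp (charge_of_finite_measure mu2)).
exists alpha => f cf.
set p := jordan_pos (hahn_posneg alpha); set n := jordan_neg (hahn_posneg alpha).
have int (mu : {finite_measure set (borel X) -> \bar R}) :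
    mu.-integrable [set: borel X] (EFin \o f) by exact: continuous_integrable.
have E : (\int[measure_add mu1 n]_x (f x)%:E = \int[measure_add p mu2]_x (f x)%:E)%E.
  apply: eq_measure_integral => A mA _.
  rewrite [LHS]measure_addE [RHS]measure_addE.
  suff : (mu1 A + n A = p A + mu2 A)%E by [].
  have : (mu1 A - mu2 A = p A + (-1)%:E * n A)%E.
    exact: (jordan_decomp (hahn_posneg alpha) mA).
  have fin1 : mu1 A \is a fin_num by exact: fin_num_measure.
  have fin2 : mu2 A \is a fin_num by exact: fin_num_measure.
  have finp : p A \is a fin_num by exact: fin_num_measure.
  have finn : n A \is a fin_num by exact: fin_num_measure.
  rewrite -(fineK fin1) -(fineK fin2) -(fineK finp) -(fineK finn).
  rewrite -EFinM -EFinB -!EFinD => -[h].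
  by congr (_%:E); lra.
move: E; rewrite (integral_measure_add _ (int mu1) (int n))//.
rewrite (integral_measure_add _ (int p) (int mu2))//.
move=> /(congr1 fine) E.
have fineDint (mu mu' : {finite_measure set (borel X) -> \bar R}) :
    fine (\int[mu]_x (f x)%:E + \int[mu']_x (f x)%:E)%E =
    \int[mu]_x f x + \int[mu']_x f x.
  by rewrite fineD//; [exact: integrable_fin_num (int mu)|exact: integrable_fin_num (int mu')].
have {}E : \int[mu1]_x f x + \int[n]_x f x = \int[p]_x f x + \int[mu2]_x f x.
  by rewrite -!fineDint.
rewrite /charge_integral -/p -/n; apply/eqP.
by rewrite subr_eq addrAC eq_sym subr_eq; exact/eqP.
Qed.

Hypothesis cozero : forall U : set X, open U -> exists g : X -> R,
  [/\ continuous g, forall x, 0 <= g x & forall x, U x <-> 0 < g x].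

(** On pairs of continuous functions, consider the cone of those [((g1, g2), c)]
    with [g1 <= f + s], [g2 <= - f + s] and [l f + C * s <= c]. A functional [L]
    below it is nonnegative in each argument and satisfies [L (f, - f) = l f], so
    that [l] is the difference of the positive functionals [L (_, 0)] and
    [L (0, _)]. *)
Lemma riesz_signed (l : (X -> R) -> R) (C : R) :
  (forall f g, continuous f -> continuous g -> l (f + g) = l f + l g) ->
  (forall a f, continuous f -> l (a *: f) = a * l f) ->
  (forall f, continuous f -> (forall x, `|f x| <= 1) -> l f <= C) ->
  exists alpha, forall f, continuous f -> charge_integral alpha f = l f.
Proof.
move=> lD lZ lC.
have c0 : continuous (0 : X -> R) by exact: continuous_const.
have l0 : l 0 = 0 by rewrite -(scale0r (0 : X -> R)) lZ// mul0r.
have C0 : 0 <= C by rewrite -l0; apply: lC => // x; rewrite normr0 ler01.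
have lCs f s : continuous f -> 0 <= s -> (forall x, `|f x| <= s) -> l f <= C * s.
  move=> cf; rewrite le_eqVlt => /predU1P[<- f0|s0 fs].
    have -> : f = 0.
      by apply/funext => x; apply/eqP; rewrite -normr_le0; exact: f0.
    by rewrite mulr0 l0.
  rewrite mulrC -ler_pdivrMl// -lZ//; apply: lC; first exact: continuous_scale.
  move=> x; rewrite -[_ x]/(s^-1 * f x) normrM gtr0_norm ?invr_gt0//.
  by rewrite ler_pdivrMl// mulr1.
pose S : set ((X -> R) * (X -> R)) := [set g | continuous g.1 /\ continuous g.2].
pose Q : set ((X -> R) * (X -> R) * R) := [set z | exists f s,
  [/\ continuous f, 0 <= s, forall x, z.1.1 x <= f x + s,
   forall x, z.1.2 x <= - f x + s & l f + C * s <= z.2]].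
have [||[u u'] [v v'] c e|t [u u'] c t0|c|[u u'] [/= cu cu']|L [LD LZ LQ]] :=
    @cone_separation R _ S Q.
- by move=> u v [? ?] [? ?]; split; exact: continuous_add.
- by move=> t u [? ?]; split; exact: continuous_scale.
- move=> [f [s [cf s0 /= uf u'f lf]]] [g [r [cg r0 /= vg v'g lg]]].
  exists (f + g), (s + r); split => /=; first exact: continuous_add.
  + exact: addr_ge0.
  + by move=> x; rewrite -!/(_ x + _ x) addrACA lerD.
  + by move=> x; rewrite -!/(_ x + _ x) opprD addrACA lerD.
  + by rewrite lD// mulrDr addrACA lerD.
- move=> [f [s [cf s0 /= uf u'f lf]]].
  exists (t *: f), (t * s); split => /=; first exact: continuous_scale.
  + exact: mulr_ge0.
  + by move=> x; rewrite -!/(t * _ x) -mulrDr ler_wpM2l.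
  + by move=> x; rewrite -!/(t * _ x) -mulrN -mulrDr ler_wpM2l.
  + by rewrite lZ// mulrCA -mulrDr ler_wpM2l.
- move=> [f [s [cf s0 /= f1 f2 lf]]]; apply: le_trans lf.
  rewrite -lerBlDl sub0r -mulN1r -lZ//; apply: lCs => //.
    exact: continuous_scale.
  move=> x; rewrite -[_ x]/(-1 * f x) mulN1r normrN ler_norml.
  by have := f1 x; have := f2 x; rewrite -[(0 : X -> R) x]/(0 : R) => ? ?; apply/andP; split; lra.
- have [B B0 uB] := continuous_bounded compX cu.
  have [B' B'0 u'B] := continuous_bounded compX cu'.
  exists (C * (B + B')); exists 0, (B + B'); split => //=.
  + by rewrite addr_ge0 ?ltW.
  + by move=> x; rewrite add0r (le_trans (ler_norm _))// (le_trans (uB x))// lerDl ltW.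
  + by move=> x; rewrite oppr0 add0r (le_trans (ler_norm _))// (le_trans (u'B x))// lerDr ltW.
  + by rewrite l0 add0r.
have pos1 f : continuous f -> (forall x, 0 <= f x) -> 0 <= L (f, 0).
  move=> cf f0; rewrite -oppr_le0 -mulN1r -LZ//.
  apply: LQ; first by split => //; exact: continuous_scale.
  exists 0, 0; split => // [x|x|]; last by rewrite l0 mulr0 addr0.
    by rewrite -[leLHS]/(-1 * f x) -[leRHS]/(0 + 0 : R) addr0 mulN1r oppr_le0.
  by rewrite -[leLHS]/(-1 * 0 : R) -[leRHS]/(- 0 + 0 : R) oppr0 addr0 mulr0.
have pos2 f : continuous f -> (forall x, 0 <= f x) -> 0 <= L (0, f).
  move=> cf f0; rewrite -oppr_le0 -mulN1r -LZ//.
  apply: LQ; first by split => //; exact: continuous_scale.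
  exists 0, 0; split => // [x|x|]; last by rewrite l0 mulr0 addr0.
    by rewrite -[leLHS]/(-1 * 0 : R) -[leRHS]/(0 + 0 : R) addr0 mulr0.
  by rewrite -[leLHS]/(-1 * f x) -[leRHS]/(- 0 + 0 : R) oppr0 addr0 mulN1r oppr_le0.
have LN f : continuous f -> L (f, -1 *: f) = l f.
  move=> cf.
  have le g : continuous g -> L (g, -1 *: g) <= l g.
    move=> cg; apply: LQ; first by split => //; exact: continuous_scale.
    exists g, 0; split => //= [x|x|]; rewrite ?addr0 ?mulr0 ?addr0//.
    by rewrite -[_ x]/(-1 * g x) mulN1r.
  apply/eqP; rewrite eq_le le//=; have := le _ (@continuous_scale _ _ (-1) _ cf).
  have -> : (-1 *: f, -1 *: (-1 *: f)) = -1 *: (f, -1 *: f) by [].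
  rewrite LZ ?lZ//; first by rewrite !mulN1r lerN2.
  by split => //; exact: continuous_scale.
have [|||mu1 mu1E] := @riesz_positive R X (fun f => L (f, 0)) compX _ _ _ cozero.
- by move=> f g cf cg; rewrite -LD//; congr L; congr pair; rewrite addr0.
- by move=> a f cf; rewrite -LZ//; congr L; congr pair; rewrite scaler0.
- exact: pos1.
have [|||mu2 mu2E] := @riesz_positive R X (fun f => L (0, f)) compX _ _ _ cozero.
- by move=> f g cf cg; rewrite -LD//; congr L; congr pair; rewrite addr0.
- by move=> a f cf; rewrite -LZ//; congr L; congr pair; rewrite scaler0.
- exact: pos2.
have [alpha alphaE] := charge_integral_diff mu1 mu2.
exists alpha => f cf; rewrite alphaE// mu1E// mu2E// -LN//.
have -> : (f, -1 *: f) = (f, 0) + -1 *: (0, f).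
  by rewrite -[RHS]/(f + -1 *: (0 : X -> R), (0 : X -> R) + -1 *: f) scaler0 addr0 add0r.
rewrite LD//; last by split => //=; exact: continuous_scale.
by rewrite LZ// mulN1r.
Qed.
End charge_integral_on_compact.

(** * Topology of the torus and of the cylinder *)

Section circle.
Context {R : realType}.
Implicit Types u v : R.

Definition cos2pi u : R := cos (2 * pi * u).
Definition sin2pi u : R := sin (2 * pi * u).

Lemma continuous_cos2pi : continuous cos2pi.
Proof.
move=> u; apply: (@continuous_comp _ _ _ (fun u => 2 * pi * u)).
  by apply: mulrl_continuous.
exact: continuous_cos.
Qed.

Lemma continuous_sin2pi : continuous sin2pi.
Proof.
move=> u; apply: (@continuous_comp _ _ _ (fun u => 2 * pi * u)).
  by apply: mulrl_continuous.
exact: continuous_sin.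
Qed.

Lemma cos2piD u v : cos2pi (u + v) = cos2pi u * cos2pi v - sin2pi u * sin2pi v.
Proof. by rewrite /cos2pi /sin2pi mulrDr cosD. Qed.

Lemma cos2pi_le1 u : cos2pi u <= 1.
Proof. exact: cos_le1. Qed.

Lemma cos2piB u v : cos2pi (u - v) = cos2pi u * cos2pi v + sin2pi u * sin2pi v.
Proof. by rewrite /cos2pi /sin2pi mulrBr cosB. Qed.

Lemma trig2pi_nat u (n : nat) :
  cos2pi (u + n%:R) = cos2pi u /\ sin2pi (u + n%:R) = sin2pi u.
Proof.
have e : 2 * pi * (u + n%:R) = 2 * pi * u + (pi *+ 2) *+ n.
  by rewrite mulrDr mulr_natr mulr_natl.
by rewrite /cos2pi /sin2pi e (periodicn (@cosD2pi R)) (periodicn (@sinD2pi R)).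
Qed.

Lemma trig2pi_int u v : v \is a Num.int ->
  cos2pi (u + v) = cos2pi u /\ sin2pi (u + v) = sin2pi u.
Proof.
move=> /intrP[[n|n] ->].
  by have := trig2pi_nat u n.
have [c s] := trig2pi_nat (u + (Negz n)%:~R) n.+1.
move: c s; rewrite NegzE -addrA mulrNz.
by rewrite -[_%:~R]/(n.+1%:R) addNr addr0 => <- <-.
Qed.

(** This is why the powers of the kernel built below concentrate at the periods. *)
Lemma cos2pi_near1 (e : R) : 0 < e -> exists2 h, 0 < h &
  forall u, 1 - h < cos2pi u -> exists2 v, v \is a Num.int & `|u - v| < e.
Proof.
move=> e0; pose d := Num.min e 2^-1.
have d0 : 0 < d by rewrite lt_min e0 invr_gt0 ltr0n.
have d2 : d <= 2^-1 by rewrite ge_min lexx orbT.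
have pi0 : 0 < pi :> R by exact: pi_gt0.
have pid0 : 0 < 2 * pi * d by rewrite !mulr_gt0.
have pid1 : 2 * pi * d <= pi by nra.
exists (1 - cos2pi d).
  rewrite subr_gt0 -[ltRHS]cos0 /cos2pi ltr_cos// in_itv/= ?lexx ?(ltW pi0)//.
  by rewrite (ltW pid0).
move=> u; rewrite opprB addrC subrK => cu.
pose k : R := (Num.floor (u + 2^-1))%:~R.
have kint : k \is a Num.int by exact: intr_int.
have k1 : k <= u + 2^-1 by exact: floor_le_tmp.
have k2 : u + 2^-1 < k + 1 by rewrite -intrD1 floorD1_gt.
exists k => //.
rewrite (@lt_le_trans _ _ d)//; last by rewrite ge_min lexx.
rewrite ltNge; apply/negP => du; move: cu; apply/negP; rewrite -leNgt.
have -> : cos2pi u = cos (2 * pi * `|u - k|).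
  have kNint : - k \is a Num.int by rewrite rpredN.
  have [<- _] := trig2pi_int u kNint.
  have p20 : 0 <= 2 * pi :> R by rewrite mulr_ge0// ltW.
  by rewrite -(ger0_norm p20) -normrM cos_norm.
have uk : `|u - k| <= 2^-1 by rewrite ler_norml; lra.
rewrite leNgt ltr_cos ?in_itv/=.
- rewrite -leNgt ler_pM2l//; lra.
- by apply/andP; split; [rewrite mulr_ge0//; lra|nra].
- by rewrite (ltW pid0).
Qed.

Lemma trig2pi_eq u v : cos2pi u = cos2pi v -> sin2pi u = sin2pi v ->
  u - v \is a Num.int.
Proof.
move=> cuv suv.
have c1 : cos2pi (u - v) = 1.
  by rewrite cos2piB cuv suv -!expr2 /cos2pi /sin2pi cos2Dsin2.
pose k : R := (Num.floor (u - v + 2^-1))%:~R.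
have k1 : k <= u - v + 2^-1 by exact: floor_le_tmp.
have k2 : u - v + 2^-1 < k + 1 by rewrite -intrD1 floorD1_gt.
suff -> : u - v = k by exact: intr_int.
apply/eqP; apply/negPn/negP => uvk.
have e0 : 0 < Num.min `|u - v - k| 4^-1 by rewrite lt_min normr_gt0 subr_eq0 uvk/=.
have [h h0 /(_ (u - v))] := cos2pi_near1 e0.
rewrite c1 => /(_ _)[|w /intrP[n ->]]; first by lra.
rewrite lt_min => /andP[nk n4].
have : (n : int) = Num.floor (u - v + 2^-1).
  by apply/esym/floor_def; move: n4; rewrite ltr_norml intrD1; lra.
by move=> nE; move: nk; rewrite nE ltxx.
Qed.

End circle.

Section separated_compact.
Context {R : realType} {X : ptopologicalType} {I : finType}.
Hypothesis compX : compact [set: X].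
Variable h : I -> X -> R.
Hypothesis ch : forall i, continuous (h i).
Hypothesis hsep : forall x y, (forall i, h i x = h i y) -> x = y.

Definition separating_dist x y := \sum_i `|h i x - h i y|.
Local Notation dist := separating_dist.

Lemma separating_dist_ge0 x y : 0 <= dist x y.
Proof. exact: sumr_ge0. Qed.

Lemma separating_dist_triangle x y z : dist x z <= dist x y + dist y z.
Proof.
by rewrite /separating_dist -big_split/= ler_sum// => i _; exact: ler_distD.
Qed.

Lemma continuous_separating_dist x : continuous (dist x).
Proof.
have -> : dist x = \sum_i (fun y => `|h i x - h i y|).
  by apply/funext => y; rewrite fct_sumE.
elim/big_ind : _ => [|f g|i _]; [exact: continuous_const|exact: continuous_add|].
move=> y; apply: cvg_norm; apply: cvgB; [exact: cvg_cst|exact: ch].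
Qed.

(** The functions [h i] define a metric; the distance to the complement of [U],
    attained by compactness, is positive exactly on [U]. *)
Lemma separated_compact_cozero (U : set X) : open U -> exists g : X -> R,
  [/\ continuous g, forall x, 0 <= g x & forall x, U x <-> 0 < g x].
Proof.
move=> oU; have [C0|/set0P[c0 Cc0]] := eqVneq (~` U) set0.
  exists (fun=> 1); split => [||x]; first exact: continuous_const.
    by move=> x; rewrite ler01.
  split => // _; apply: contrapT => nUx.
  by have : (~` U) x by []; rewrite C0.
have compC : compact (~` U).
  by apply: subclosed_compact compX _ => //; exact: open_closedC.
pose g x := inf [set dist x y | y in ~` U].
have ginf x : has_inf [set dist x y | y in ~` U].
  by split; [exists (dist x c0); exists c0|exists 0 => _ [y _ <-]; exact: separating_dist_ge0].
have gle x y : (~` U) y -> g x <= dist x y.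
  by move=> Cy; apply: ge_inf; [exact: (ginf x).2|exists y].
have glip x x' : g x <= dist x x' + g x'.
  rewrite -lerBlDl; apply: lb_le_inf; first exact: (ginf x').1.
  move=> _ [y Cy <-]; rewrite lerBlDl.
  exact: le_trans (gle x y Cy) (separating_dist_triangle _ _ _).
have distC x x' : dist x x' = dist x' x.
  by apply: eq_bigr => i _; rewrite distrC.
have dist0 x : dist x x = 0 by rewrite /separating_dist big1// => i _; rewrite subrr normr0.
have g0 x : 0 <= g x.
  by apply: lb_le_inf; [exact: (ginf x).1|move=> _ [y _ <-]; exact: separating_dist_ge0].
exists g; split => //.
- move=> x; apply/cvgrPdist_le => e e0; near=> x'.
  have dx : dist x x' < e.
    near: x'; apply: (cvgr_lt (dist x x)); first exact: continuous_separating_dist.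
    by rewrite dist0.
  by rewrite ler_norml; have := glip x x'; have := glip x' x; rewrite distC; lra.
- move=> x; split => [Ux|gx].
    have [|c Cc cmin] := @compact_EVT_min _ _ (dist x) _ (ex_intro _ c0 Cc0) compC.
      by apply: continuous_subspaceT; exact: continuous_separating_dist.
    rewrite inE in Cc.
    have : 0 < dist x c.
      rewrite lt_neqAle separating_dist_ge0 andbT eq_sym; apply/negP => /eqP /psumr_eq0P dxc.
      apply: Cc; rewrite -(_ : x = c)//; apply: hsep => i.
      by apply/eqP; rewrite -subr_eq0 -normr_eq0 dxc.
    move=> /lt_le_trans; apply; apply: lb_le_inf; first exact: (ginf x).1.
    by move=> _ [y Cy <-]; apply: cmin; rewrite inE.
  apply: contrapT => nUx; have := gle x x nUx.
  by rewrite dist0 leNgt gx.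
Unshelve. all: by end_near.
Qed.

End separated_compact.

Section cylinder.
Context {R : realType} {d : nat}.
Local Open Scope quotient_scope.
Local Notation T := (torus R d).
Local Notation E := (R * 'rV[R]_d)%type.

Definition periodic_space (Z : Type) (g : E -> Z) :=
  forall t x y, lattice_rel x y -> g (t, x) = g (t, y).

Lemma pi_lattice (x y : 'rV[R]_d) : \pi_T x = \pi_T y -> lattice_rel x y.
Proof. by move=> /eqmodP. Qed.

Lemma repr_pi_lattice (x : 'rV[R]_d) : lattice_rel (repr (\pi_T x)) x.
Proof. by apply: pi_lattice; rewrite reprK. Qed.

Lemma lattice_pi (x y : 'rV[R]_d) : lattice_rel x y -> \pi_T x = \pi_T y.
Proof. by move=> xy; apply/eqmodP. Qed.

Lemma lattice_relE (x y : 'rV[R]_d) :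
  lattice_rel x y <-> forall i, x 0 i - y 0 i \is a Num.int.
Proof. by split => [/forallP|] // xy; apply/forallP. Qed.

(** The saturation of [W] is the union of its translates by the lattice. *)
Lemma pi_open (W : set 'rV[R]_d) : open W -> open (\pi_T @` W).
Proof.
move=> oW; rewrite /open/= /quotient_open.
have -> : \pi_T @^-1` (\pi_T @` W) =
    \bigcup_(v in [set v | lattice_rel v 0]) (fun y => y + v) @^-1` W.
  apply/seteqP; split => [y [w Ww /pi_lattice wy]|y [v /lattice_relE v0 Ww]].
    exists (w - y) => /=; last by rewrite addrC subrK.
    apply/lattice_relE => i; rewrite !mxE subr0.
    exact: (iffLR (lattice_relE _ _) wy).
  exists (y + v) => //; apply: lattice_pi; apply/lattice_relE => i.
  by rewrite mxE addrAC subrr add0r; have := v0 i; rewrite mxE subr0.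
apply: bigcup_open => v _.
have /continuousP : continuous (fun y : 'rV[R]_d => y + v).
  move=> y; apply: (@cvgD _ _ _ (nbhs y) _ id (fun=> v) y v).
    exact: cvg_id.
  exact: cvg_cst.
exact.
Qed.

(** The choice of representatives [repr] is not continuous, but the projection to
    the torus is open, so a neighbourhood of one representative covers a
    neighbourhood of its class. *)
Lemma continuous_descend (Z : topologicalType) (g : E -> Z) :
  continuous g -> periodic_space g ->
  continuous (fun p : cylinder R d => g (cyl_lift p)).
Proof.
move=> cg pg [t q] V /= /(cg (set_val t, repr q)) [[A B] [/= At Bq] ABV].
exists (set_val @^-1` A, \pi_T @` (interior B)); first split => /=.
- exact: initial_continuous.
- apply: open_nbhs_nbhs; split; first exact/pi_open/open_interior.
  by exists (repr q) => //; exact: reprK.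
- move=> [s _] [/= As [y By <-]]; rewrite /cyl_lift/=.
  rewrite (pg _ _ y (repr_pi_lattice y)); apply: (ABV (set_val s, y)).
  by split => //=; exact: interior_subset.
Qed.

Definition clamp (t : R) : unit_interval R.
Proof.
refine (SigSub (_ : Num.min 1 (Num.max 0 t) \in (`[0, 1]%classic : set R))).
by rewrite inE /= in_itv/= le_min ler01 le_max lexx/= ge_min lexx.
Defined.

Lemma unit_interval_itv (s : unit_interval R) : 0 <= set_val s <= 1.
Proof. by have := set_valP s; rewrite /= in_itv. Qed.

Lemma clamp_val (s : unit_interval R) : clamp (set_val s) = s.
Proof.
have /andP[s0 s1] := unit_interval_itv s.
apply/val_inj; transitivity (set_val s); last by rewrite set_valE.
by rewrite /= (max_idPr s0) (min_idPr s1).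
Qed.

Lemma continuous_clamp : continuous clamp.
Proof.
apply: continuous_comp_initial => /=.
apply: (@continuous_minr _ _ (fun=> 1)); first exact: continuous_const.
apply: (@continuous_maxr _ _ (fun=> 0) id); first exact: continuous_const.
by move=> x; exact: cvg_id.
Qed.

Definition period_box (P : R) : set E :=
  `[0, P]%classic `*`
  [set x : 'rV[R]_d | forall i, (`[0, 1]%classic : set R) (x ord0 i)].

Lemma compact_period_box P : compact (period_box P).
Proof.
apply: compact_setX; first exact: segment_compact.
exact: (@rV_compact R d (fun=> `[0, 1]%classic) (fun i => @segment_compact R 0 1)).
Qed.

Definition fracpart (x : 'rV[R]_d) : 'rV[R]_d :=
  \row_i (x 0 i - (Num.floor (x 0 i))%:~R).

Lemma fracpart_lattice x : lattice_rel (fracpart x) x.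
Proof.
apply/lattice_relE => i; rewrite mxE addrAC subrr add0r rpredN.
exact: intr_int.
Qed.

Lemma fracpart_itv x i : 0 <= fracpart x 0 i <= 1.
Proof.
rewrite mxE; apply/andP; split; first by rewrite subr_ge0 floor_le_tmp.
by rewrite lerBlDr addrC -intrD1 ltW// floorD1_gt.
Qed.

Lemma compact_cylinder : compact [set: cylinder R d].
Proof.
pose q (z : E) : cylinder R d := (clamp z.1, \pi_T z.2).
have -> : [set: cylinder R d] = q @` period_box 1.
  apply/seteqP; split => // -[s x] _.
  exists (set_val s, fracpart (repr x)).
    split => /=; first by rewrite in_itv/= unit_interval_itv.
    by move=> i; rewrite in_itv/= fracpart_itv.
  by rewrite /q/= clamp_val (lattice_pi (fracpart_lattice _)) reprK.
apply: continuous_compact; last exact: compact_period_box.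
apply: continuous_subspaceT => z.
apply: (@cvg_pair _ _ _ _ (nbhs (clamp z.1)) (nbhs (\pi_T z.2 : T))).
  by apply: (@continuous_comp _ _ _ fst clamp); [exact: cvg_fst|exact: continuous_clamp].
by apply: (@continuous_comp _ _ _ snd \pi_T); [exact: cvg_snd|exact: pi_continuous].
Qed.

Definition cylinder_coord (k : option (bool * 'I_d)) (p : cylinder R d) : R :=
  if k is Some (b, i)
  then (if b then cos2pi else sin2pi) ((cyl_lift p).2 0 i)
  else (cyl_lift p).1.

Lemma continuous_cylinder_coord k : continuous (cylinder_coord k).
Proof.
case: k => [[b i]|].
  apply: (@continuous_descend _ (fun z => (if b then cos2pi else sin2pi) (z.2 0 i))).
    move=> z; apply: (@continuous_comp _ _ _ (fun z : E => z.2 0 i)).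
      apply: (@continuous_comp _ _ _ snd (fun x : 'rV[R]_d => x 0 i)); [exact: cvg_snd|exact: coord_continuous].
    by case: b; [exact: continuous_cos2pi|exact: continuous_sin2pi].
  move=> t x y /lattice_relE/(_ i) /(trig2pi_int (y 0 i)) [] /=.
  by rewrite addrC subrK; case: b.
apply: (@continuous_descend _ (fun z => z.1)) => // z; exact: cvg_fst.
Qed.

(** Time and the cosines and sines of the space coordinates separate points. *)
Lemma cylinder_cozero (U : set (cylinder R d)) : open U ->
  exists g : cylinder R d -> R,
  [/\ continuous g, forall x, 0 <= g x & forall x, U x <-> 0 < g x].
Proof.
apply: (separated_compact_cozero compact_cylinder continuous_cylinder_coord).
move=> [s x] [t y] /= e; congr pair; first exact/val_inj/(e None).
rewrite -[x]reprK -[y]reprK; apply: lattice_pi; apply/lattice_relE => i.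
by apply: trig2pi_eq; [exact: (e (Some (true, i)))|exact: (e (Some (false, i)))].
Qed.

Lemma continuous_torus_descend (Z : topologicalType) (g : 'rV[R]_d -> Z) :
  continuous g -> (forall x y, lattice_rel x y -> g x = g y) ->
  continuous (fun x : T => g (repr x)).
Proof.
move=> cg pg; apply: (@repr_comp_continuous _ _ _ g) => // x y /eqP xy.
by apply/eqP/pg/pi_lattice.
Qed.

Lemma compact_torus : compact [set: T].
Proof.
have -> : [set: T] = snd @` [set: cylinder R d].
  by apply/seteqP; split => // x _; exists (point, x).
apply: continuous_compact; last exact: compact_cylinder.
by apply: continuous_subspaceT => z; exact: cvg_snd.
Qed.

End cylinder.

(** * Functions of class C^k *)

Section Ck_algebra.
Context {R : realType} {V : normedModType R}.
Implicit Types f g : V -> R.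

Lemma CkS_differentiable k f x : Ck k.+1 f -> differentiable f x.
Proof. by case=> + _; exact. Qed.

Lemma CkS_derivable k f x v : Ck k.+1 f -> derivable f x v.
Proof. by move=> cf; exact/diff_derivable/(CkS_differentiable _ cf). Qed.

Lemma CkS_derive k f v : Ck k.+1 f -> Ck k (fun x => 'D_v f x).
Proof. by case=> _; exact. Qed.

Lemma Ck_continuous k f : Ck k f -> continuous f.
Proof.
by case: k => [//|k] cf x; exact/differentiable_continuous/(CkS_differentiable _ cf).
Qed.

Lemma CkW k f : Ck k.+1 f -> Ck k f.
Proof.
elim: k f => [|k IH] f cf; first exact: Ck_continuous cf.
split=> [x|v]; first exact: CkS_differentiable cf.
by apply: IH; exact: CkS_derive cf.
Qed.

Lemma Ck_cst k (a : R) : Ck k (fun _ : V => a).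
Proof.
elim: k a => [|k IH] a; first exact: continuous_const.
split=> [x|v]; first exact: differentiable_cst.
have -> : (fun x => 'D_v (fun _ : V => a) x) = (fun=> 0) by apply/funext => x; exact: derive_cst.
exact: IH.
Qed.

Lemma Ck_add k f g : Ck k f -> Ck k g -> Ck k (fun x => f x + g x).
Proof.
elim: k f g => [|k IH] f g cf cg; first exact: continuous_add.
split=> [x|v].
  by apply: differentiableD; [exact: CkS_differentiable cf|exact: CkS_differentiable cg].
rewrite (_ : (fun x => 'D_v _ x) = (fun x => 'D_v f x + 'D_v g x)).
  by apply: IH; [exact: CkS_derive cf|exact: CkS_derive cg].
by apply/funext => x; apply: deriveD; [exact: CkS_derivable cf|exact: CkS_derivable cg].
Qed.

Lemma Ck_mul k f g : Ck k f -> Ck k g -> Ck k (fun x => f x * g x).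
Proof.
elim: k f g => [|k IH] f g cf cg; first exact: continuous_mul.
split=> [x|v].
  by apply: differentiableM; [exact: CkS_differentiable cf|exact: CkS_differentiable cg].
rewrite (_ : (fun x => 'D_v _ x) = (fun x => f x * 'D_v g x + g x * 'D_v f x)).
  apply: Ck_add; apply: IH; try exact: CkW.
    exact: CkS_derive cg.
  exact: CkS_derive cf.
apply/funext => x; rewrite [LHS](@deriveM _ _ f g) //.
  exact: CkS_derivable cf.
exact: CkS_derivable cg.
Qed.

Lemma Ck_scale k a f : Ck k f -> Ck k (fun x => a * f x).
Proof. by apply: Ck_mul; exact: Ck_cst. Qed.

Lemma Ck_sum (I : Type) (s : seq I) k (F : I -> V -> R) :
  (forall i, Ck k (F i)) -> Ck k (fun x => \sum_(i <- s) F i x).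
Proof.
move=> cF; elim: s => [|i s IH].
  rewrite (_ : (fun x => \sum_(i <- [::]) F i x) = fun=> 0); first exact: Ck_cst.
  by apply/funext => x; rewrite big_nil.
rewrite (_ : (fun x => \sum_(j <- _ :: _) F j x) = fun x => F i x + \sum_(j <- s) F j x).
  exact: Ck_add.
by apply/funext => x; rewrite big_cons.
Qed.

Lemma derive_comp_real (h h' : R -> R) f x v :
  is_derive (f x) 1 h (h' (f x)) -> differentiable f x ->
  differentiable (h \o f) x /\ 'D_v (h \o f) x = h' (f x) * 'D_v f x.
Proof.
move=> dh df.
have dh1 : differentiable h (f x) by apply/derivable1_diffP; case: dh.
split; first exact: differentiable_comp.
rewrite deriveE; last exact: differentiable_comp.
rewrite diff_comp//= diff1E// derive1E (@derive_val _ _ _ _ _ _ _ dh).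
by rewrite deriveE//= mulrC.
Qed.

Section linear_phase.
Variables (L : V -> R) (c : V -> R).
Hypothesis dL : forall x, differentiable L x.
Hypothesis DL : forall x v, 'D_v L x = c v.

Lemma Ck_cos_sin k : Ck k (cos \o L) /\ Ck k (sin \o L).
Proof.
have dcos x v := @derive_comp_real cos (fun y => - sin y) L x v (is_derive_cos (L x)) (dL x).
have dsin x v := @derive_comp_real sin cos L x v (is_derive_sin (L x)) (dL x).
elim: k => [|k [IHc IHs]].
  by split => x; apply: differentiable_continuous; [exact: (dcos x 0).1|exact: (dsin x 0).1].
split; split => [x|v].
- exact: (dcos x 0).1.
- rewrite (_ : (fun x => 'D_v _ x) = fun x => - c v * (sin \o L) x); first exact: Ck_scale.
  by apply/funext => x; rewrite (dcos x v).2 DL mulrC /=; ring.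
- exact: (dsin x 0).1.
- rewrite (_ : (fun x => 'D_v _ x) = fun x => c v * (cos \o L) x); first exact: Ck_scale.
  by apply/funext => x; rewrite (dsin x v).2 DL mulrC.
Qed.

Lemma Ck_exp k : Ck k (expR \o L).
Proof.
have dexp x v := @derive_comp_real expR expR L x v (is_derive_expR (L x)) (dL x).
elim: k => [|k IH].
  by move=> x; apply: differentiable_continuous; exact: (dexp x 0).1.
split=> [x|v]; first exact: (dexp x 0).1.
rewrite (_ : (fun x => 'D_v _ x) = fun x => c v * (expR \o L) x); first exact: Ck_scale.
by apply/funext => x; rewrite (dexp x v).2 DL mulrC.
Qed.

End linear_phase.
End Ck_algebra.

(** * Periodic functions of class C^k *)

Section torus_functions.
Context {R : realType} {d : nat}.
Local Notation E := (R * 'rV[R]_d)%type.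
Implicit Types (f g : E -> R) (z : E).

Lemma derive_periodic f (v : E) :
  periodic_space f -> periodic_space (fun z => 'D_v f z).
Proof.
move=> pf t x y xy.
have pfv h : f (h *: v + (t, x)) = f (h *: v + (t, y)).
  case: v => s w; rewrite -[h *: (s, w) + (t, x)]/(h * s + t, h *: w + x).
  rewrite -[h *: (s, w) + (t, y)]/(h * s + t, h *: w + y); apply: pf.
  apply/lattice_relE => i; rewrite !mxE opprD addrACA subrr add0r.
  exact: (iffLR (lattice_relE _ _) xy).
rewrite /derive; set F := (X in lim (X @ _)); set G := (X in _ = lim (X @ _)).
suff -> : F = G by [].
by apply/funext => h; rewrite /F /G /= pfv (pf t x y xy).
Qed.

Lemma Ck_torus_derive k f v : Ck_torus k.+1 f -> Ck_torus k (fun z => 'D_v f z).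
Proof. by move=> [cf pf]; split; [exact: CkS_derive cf|exact: derive_periodic]. Qed.

Lemma Ck_torusW k f : Ck_torus k.+1 f -> Ck_torus k f.
Proof. by move=> [cf pf]; split; [exact: CkW|]. Qed.

Lemma Ck_torus_continuous k f : Ck_torus k f -> continuous f.
Proof. by move=> [cf _]; exact: Ck_continuous cf. Qed.

Lemma Ck_torus_add k f g : Ck_torus k f -> Ck_torus k g ->
  Ck_torus k (fun z => f z + g z).
Proof.
move=> [cf pf] [cg pg]; split; first exact: Ck_add.
by move=> t x y xy; rewrite (pf t x y xy) (pg t x y xy).
Qed.

Lemma Ck_torus_scale k a f : Ck_torus k f -> Ck_torus k (fun z => a * f z).
Proof.
move=> [cf pf]; split; first exact: Ck_scale.
by move=> t x y xy; rewrite (pf t x y xy).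
Qed.

Lemma smooth_torus_add f g : smooth_torus f -> smooth_torus g ->
  smooth_torus (fun z => f z + g z).
Proof. by move=> sf sg k; exact: Ck_torus_add. Qed.

Lemma smooth_torus_scale a f : smooth_torus f -> smooth_torus (fun z => a * f z).
Proof. by move=> sf k; exact: Ck_torus_scale. Qed.

Lemma smooth_torus_mul f g : smooth_torus f -> smooth_torus g ->
  smooth_torus (fun z => f z * g z).
Proof.
move=> sf sg k; have [cf pf] := sf k; have [cg pg] := sg k.
split; first exact: Ck_mul.
by move=> t x y xy; rewrite (pf t x y xy) (pg t x y xy).
Qed.

Lemma smooth_torus_cst a : smooth_torus (fun _ : E => a).
Proof. by move=> k; split => //; exact: Ck_cst. Qed.

Lemma smooth_torus_sum (I : Type) (s : seq I) (F : I -> E -> R) :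
  (forall i, smooth_torus (F i)) -> smooth_torus (fun z => \sum_(i <- s) F i z).
Proof.
move=> sF k; split; first by apply: Ck_sum => i; case: (sF i k).
by move=> t x y xy; apply: eq_bigr => i _; case: (sF i k) => _; exact.
Qed.

Lemma derive_affine_phase (L : E -> R) (c : E -> R) :
  (forall z, differentiable L z) -> (forall v z (h : R), L (h *: v + z) - L z = h * c v) ->
  forall z v, 'D_v L z = c v.
Proof.
move=> dL Lc z v; rewrite /derive; apply: cvg_lim => //.
apply: cvg_near_cst; near=> h; rewrite /= Lc.
by rewrite -[_ *: _]/(_ * _) mulrA mulVf ?mul1r//; near: h; exact: nbhs_dnbhs_neq.
Unshelve. all: by end_near.
Qed.

Lemma differentiable_time (c : R) z : differentiable (fun z : E => c * z.1) z.
Proof.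
apply: (@differentiableZ _ _ _ fst).
by apply: linear_differentiable => x; exact: cvg_fst.
Qed.

Lemma differentiable_space (c : R) i z : differentiable (fun z : E => c * z.2 0 i) z.
Proof.
apply: (@differentiableZ _ _ _ (fun z : E => z.2 0 i)).
apply: (@differentiable_comp _ _ _ _ snd (fun x : 'rV[R]_d => x 0 i)).
  by apply: linear_differentiable => x; exact: cvg_snd.
exact: differentiable_coord.
Qed.

Lemma derive_time (c : R) z v : 'D_v (fun z : E => c * z.1) z = c * v.1.
Proof.
apply: (@derive_affine_phase _ (fun v => c * v.1) (differentiable_time c)).
by move=> w y h; rewrite /= mulrDr addrK -[_ *: _]/(_ * _) mulrCA.
Qed.

Lemma derive_space (c : R) i z v : 'D_v (fun z : E => c * z.2 0 i) z = c * v.2 0 i.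
Proof.
apply: (@derive_affine_phase _ (fun v => c * v.2 0 i) (differentiable_space c i)).
by move=> w y h; rewrite /= !mxE mulrDr addrK mulrCA.
Qed.

Lemma smooth_torus_time (g : R -> R) (c : R) :
  (forall k, Ck k (g \o (fun z : E => c * z.1))) -> smooth_torus (fun z => g (c * z.1)).
Proof. by move=> cg k; split; [exact: cg|]. Qed.

Lemma smooth_torus_cos_time c : smooth_torus (fun z => cos (c * z.1)).
Proof.
apply: smooth_torus_time => k.
exact: (Ck_cos_sin (differentiable_time c) (derive_time c) k).1.
Qed.

Lemma smooth_torus_sin_time c : smooth_torus (fun z => sin (c * z.1)).
Proof.
apply: smooth_torus_time => k.
exact: (Ck_cos_sin (differentiable_time c) (derive_time c) k).2.
Qed.

Lemma smooth_torus_exp_time c : smooth_torus (fun z => expR (c * z.1)).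
Proof.
apply: smooth_torus_time => k.
exact: (Ck_exp (differentiable_time c) (derive_time c) k).
Qed.

Lemma smooth_torus_cos2pi i : smooth_torus (fun z => cos2pi (z.2 0 i)).
Proof.
move=> k; split.
  exact: (Ck_cos_sin (differentiable_space (2 * pi) i) (derive_space (2 * pi) i) k).1.
move=> t x y /lattice_relE/(_ i) /(trig2pi_int (y 0 i)) [] /=.
by rewrite addrC subrK.
Qed.

Lemma smooth_torus_sin2pi i : smooth_torus (fun z => sin2pi (z.2 0 i)).
Proof.
move=> k; split.
  exact: (Ck_cos_sin (differentiable_space (2 * pi) i) (derive_space (2 * pi) i) k).2.
move=> t x y /lattice_relE/(_ i) /(trig2pi_int (y 0 i)) [] /=.
by rewrite addrC subrK.
Qed.

Lemma deriveD_Ck k f g z v : Ck k.+1 f -> Ck k.+1 g ->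
  'D_v (fun z => f z + g z) z = 'D_v f z + 'D_v g z.
Proof. by move=> cf cg; apply: deriveD; apply: CkS_derivable; eassumption. Qed.

Lemma deriveZ_Ck k a f z v : Ck k.+1 f ->
  'D_v (fun z => a * f z) z = a * 'D_v f z.
Proof. by move=> cf; apply: deriveZ; exact: CkS_derivable cf. Qed.

Lemma laplacianD f g z : Ck 2 f -> Ck 2 g ->
  laplacian (fun z => f z + g z) z = laplacian f z + laplacian g z.
Proof.
move=> cf cg; rewrite /laplacian -big_split/=; apply: eq_bigr => i _.
rewrite /dx (_ : (fun z => 'D__ _ z) = fun z => dx i f z + dx i g z).
  by apply: (@deriveD_Ck 0); exact: CkS_derive.
by apply/funext => y; exact: (@deriveD_Ck 1).
Qed.

Lemma laplacianZ a f z : Ck 2 f -> laplacian (fun z => a * f z) z = a * laplacian f z.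
Proof.
move=> cf; rewrite /laplacian mulr_sumr; apply: eq_bigr => i _.
rewrite /dx (_ : (fun z => 'D__ _ z) = fun z => a * dx i f z).
  by apply: (@deriveZ_Ck 0); exact: CkS_derive.
by apply/funext => y; exact: (@deriveZ_Ck 1).
Qed.

End torus_functions.

(** * Invariant means *)

Definition bounded_real {T : Type} {R : realType} (f : T -> R) :=
  exists B, forall x, `|f x| <= B.

Section bounded_functions.
Context {R : realType} {T : Type}.
Implicit Types f g : T -> R.

Lemma bounded_real_add f g : bounded_real f -> bounded_real g -> bounded_real (f + g).
Proof.
move=> [B fB] [B' gB]; exists (B + B') => x.
by rewrite -[(f + g) x]/(f x + g x) (le_trans (ler_normD _ _))// lerD.
Qed.

Lemma bounded_real_scale a f : bounded_real f -> bounded_real (a *: f).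
Proof.
move=> [B fB]; exists (`|a| * B) => x.
by rewrite -[(a *: f) x]/(a * f x) normrM ler_wpM2l.
Qed.

Lemma bounded_real_mul f g : bounded_real f -> bounded_real g ->
  bounded_real (fun x => f x * g x).
Proof. by move=> [B fB] [B' gB]; exists (B * B') => x; rewrite normrM ler_pM. Qed.

Lemma bounded_real_cst (a : R) : bounded_real (fun _ : T => a).
Proof. by exists `|a|. Qed.

Lemma bounded_real_comp (S : Type) (h : S -> T) f :
  bounded_real f -> bounded_real (fun x => f (h x)).
Proof. by move=> [B fB]; exists B => x. Qed.

End bounded_functions.

Section invariant_mean.
Context {R : realType} {G : zmodType}.

Definition invariant_mean (M : (G -> R) -> R) :=
  [/\ forall f g, bounded_real f -> bounded_real g -> M (f + g) = M f + M g,
      forall a f, bounded_real f -> M (a *: f) = a * M f,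
      forall f c, bounded_real f -> (forall x, f x <= c) -> M f <= c &
      forall f y, bounded_real f -> M (fun x => f (x + y)) = M f].

(** A mean dominated by the averages over finite lists of translates. Two such
    bounds are added by averaging over all pairwise sums of the lists. Invariance
    holds because the average of [f (x + y) - f x] along [x, x + y, x + 2 y, ...]
    telescopes. On the group of times and positions, such a mean plays the role of
    integration over a period. *)
Lemma invariant_mean_exists : exists M, invariant_mean M.
Proof.
pose S : set (G -> R) := [set f | bounded_real f].
pose Q : set ((G -> R) * R) := [set fc | exists2 s : seq G, (0 < size s)%N &
  forall x, \sum_(y <- s) fc.1 (x + y) <= fc.2 * (size s)%:R].
have [||||||M [MD MZ MQ]] := @cone_separation R _ S Q.
- exact: bounded_real_add.
- exact: bounded_real_scale.
- move=> f g c c' [s s0 /= fs] [s' s'0 /= gs'].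
  exists [seq y + z | y <- s, z <- s'] => /=; first by rewrite size_allpairs muln_gt0 s0.
  move=> x; rewrite big_allpairs_dep/= size_allpairs natrM.
  have -> : \sum_(y <- s) \sum_(z <- s') (f + g) (x + (y + z)) =
      \sum_(z <- s') \sum_(y <- s) f (x + z + y) +
      \sum_(y <- s) \sum_(z <- s') g (x + y + z).
    rewrite [in RHS]exchange_big/= -big_split/=; apply: eq_bigr => y _.
    rewrite -big_split/=; apply: eq_bigr => z _.
    by rewrite addrAC addrA -[LHS]/(f (x + y + z) + g (x + y + z)).
  rewrite mulrDl lerD//.
    rewrite mulrA; apply: (@le_trans _ _ (\sum_(z <- s') (c * (size s)%:R))).
      by apply: ler_sum => z _; exact: fs.
    by rewrite big_const_seq count_predT iter_addr_0 -[leLHS]mulr_natr.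
  rewrite mulrCA mulrC; apply: (@le_trans _ _ (\sum_(y <- s) (c' * (size s')%:R))).
    by apply: ler_sum => y _; exact: gs'.
  by rewrite big_const_seq count_predT iter_addr_0 -[leLHS]mulr_natr.
- move=> t f c t0 [s s0 /= fs]; exists s => //= x.
  by rewrite -mulr_sumr -mulrA ler_wpM2l.
- move=> c [s s0 /= /(_ 0)]; rewrite big1// => c0.
  by move: c0; rewrite pmulr_lge0// ltr0n.
- move=> f [B fB]; exists B; exists [:: 0] => //= x.
  by rewrite big_seq1 addr0 mulr1 (le_trans (ler_norm _)).
have Mle f c : bounded_real f -> (forall x, f x <= c) -> M f <= c.
  move=> bf fc; apply: MQ => //; exists [:: 0] => //= x.
  by rewrite big_seq1 addr0 mulr1.
have shift_le f y : bounded_real f -> M (fun x => f (x + y)) <= M f.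
  move=> bf; have [B fB] := bf; rewrite -subr_le0; apply/ler_addgt0Pr => e e0.
  have bfy : bounded_real (fun x => f (x + y)) by exists B.
  have bNf : bounded_real (-1 *: f) by exact: bounded_real_scale.
  rewrite add0r -mulN1r -MZ// -MD//; apply: MQ; first exact: bounded_real_add.
  have B0 : 0 <= B by rewrite (le_trans _ (fB 0)).
  have [n n0 ne] : exists2 n, (0 < n)%N & B + B <= e * n%:R.
    exists (Num.bound ((B + B) / e)).+1 => //.
    rewrite mulrC -ler_pdivrMr// (le_trans (ltW (archi_boundP _))) ?ler_nat//.
    by rewrite divr_ge0 ?addr_ge0// ltW.
  exists [seq y *+ j | j <- iota 0 n]; first by rewrite size_map size_iota.
  move=> x /=; rewrite size_map size_iota big_map.
  rewrite (le_trans _ ne)//.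
  have -> : \sum_(j <- iota 0 n)
      ((fun x => f (x + y)) + -1 *: f) (x + y *+ j) = f (x + y *+ n) - f x.
    have -> : iota 0 n = index_iota 0 n by rewrite /index_iota subn0.
    rewrite (eq_bigr (fun j => f (x + y *+ j.+1) - f (x + y *+ j))); last first.
      move=> j _; rewrite -[LHS]/(f (x + y *+ j + y) + -1 * f (x + y *+ j)).
      by rewrite mulN1r mulrSr addrA.
    by rewrite telescope_sumr// mulr0n addr0.
  by have := fB (x + y *+ n); have := fB x; rewrite !ler_norml; lra.
exists M; split => // f y bf; apply/eqP; rewrite eq_le shift_le//=.
have := @shift_le (fun x => f (x + y)) (- y) (bounded_real_comp _ bf).
by under eq_fun do rewrite subrK.
Qed.

Variable M : (G -> R) -> R.
Hypothesis meanM : invariant_mean M.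

Lemma mean_le f g : bounded_real f -> bounded_real g -> (forall x, f x <= g x) ->
  M f <= M g.
Proof.
move=> bf bg fg; case: meanM => MD MZ Mle _.
have bNg : bounded_real (-1 *: g) by exact: bounded_real_scale.
rewrite -subr_le0 -mulN1r -MZ// -MD//; apply: Mle; first exact: bounded_real_add.
by move=> x; rewrite -[X in X <= _]/(f x + -1 * g x) mulN1r subr_le0.
Qed.

Lemma mean_cst a : M (fun=> a) = a.
Proof.
case: meanM => MD MZ Mle _; have bc : bounded_real (fun _ : G => a : R).
  exact: bounded_real_cst.
apply/eqP; rewrite eq_le Mle//= -lerN2 -mulN1r -MZ//; apply: Mle.
  exact: bounded_real_scale.
by move=> x; rewrite -[leLHS]/(-1 * a) mulN1r.
Qed.

End invariant_mean.

(** * Periodic functions of time and space *)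

(** Heine-Cantor, with the second point [z + w] allowed outside of [K]: the
    time variable will leave the unit interval. *)
Lemma continuous_near_compact (R : realType) (V : normedModType R) (K : set V)
    (f : V -> R) (e : R) : compact K -> continuous f -> 0 < e ->
  \forall r \near 0^'+, forall z, K z -> forall w, `|w| < r -> `|f (z + w) - f z| <= e.
Proof.
move=> /compact_near_coveringP cK cf e0.
suff near_r : \forall r \near 0^'+, K `<=`
    [set z | forall w, `|w| < r -> `|f (z + w) - f z| <= e] by exact: near_r.
apply: cK => z _.
have /cvgrPdist_lt/(_ (e / 2)) := cf z.
rewrite divr_gt0// => /(_ isT) /nbhs_ballP[s /= s0 fs].
near=> z' r => /= w wr.
have zz' : `|z - z'| < s / 2.
  near: z'; apply/nbhs_ballP; exists (s / 2) => /=; first by rewrite divr_gt0.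
  by move=> y; rewrite -ball_normE.
have rs : r < s / 2 by near: r; apply: nbhs_right_lt; rewrite divr_gt0.
have f1 : `|f z - f z'| < e / 2.
  by apply: fs; rewrite -ball_normE /= (lt_trans zz')// gtr_pMr// invf_lt1 ?ltr1n.
have f2 : `|f z - f (z' + w)| < e / 2.
  apply: fs; rewrite -ball_normE /= opprD addrA (le_lt_trans (ler_normB _ _))//.
  by rewrite [ltRHS]splitr ltrD// (lt_trans wr).
have -> : f (z' + w) - f z' = f z - f z' - (f z - f (z' + w)) by ring.
by rewrite (le_trans (ler_normB _ _))// [leRHS]splitr lerD ?ltW.
Unshelve. all: by end_near.
Qed.

Section periodic_functions.
Context {R : realType} {d : nat}.
Local Notation E := (R * 'rV[R]_d)%type.
Variable P : R.
Hypothesis P0 : 0 < P.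
Implicit Types (f g : E -> R) (z v w : E).

Lemma norm_components_lt w (e : R) : 0 < e -> `|w.1| < e ->
  (forall i, `|w.2 0 i| < e) -> `|w| < e.
Proof.
move=> e0 w1 w2; rewrite prod_normE gt_max w1/=.
rewrite [ltLHS](mx_normrE w.2); apply/bigmax_ltP; split => // -[i j] _ /=.
by rewrite ord1.
Qed.

Definition period v := v.1 / P \is a Num.int /\ forall i, v.2 0 i \is a Num.int.

Definition periodic f := forall z v, period v -> f (z + v) = f z.

Lemma period_reduction z : exists2 v, period v & period_box P (z + v).
Proof.
exists (- (P * (Num.floor (z.1 / P))%:~R), fracpart z.2 - z.2); first split => /=.
- by rewrite mulNr rpredN mulrAC divff ?gt_eqF// mul1r intr_int.
- move=> i; have := iffLR (lattice_relE _ _) (fracpart_lattice z.2) i.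
  by rewrite !mxE.
- split => /=; last first.
    by move=> i; rewrite addrC subrK in_itv/= fracpart_itv.
  have z1 : z.1 = P * (z.1 / P) by rewrite mulrCA divff ?gt_eqF// mulr1.
  rewrite in_itv/= {1 3}z1 -mulrBr; apply/andP; split.
    by rewrite pmulr_rge0// subr_ge0 floor_le_tmp.
  by rewrite ger_pMr// lerBlDr addrC -intrD1 ltW// floorD1_gt.
Qed.

Lemma periodic_bounded f : continuous f -> periodic f -> bounded_real f.
Proof.
move=> cf pf; have cnf : continuous (fun z => `|f z|).
  by move=> x; apply: cvg_norm; exact: cf.
have box0 : @period_box R d P !=set0.
  exists 0; split => /= [|i]; rewrite ?mxE in_itv/= lexx ?ltW//.
have [|c _ fc] := @compact_EVT_max _ _ (fun x => `|f x|) _ box0 (@compact_period_box R d P).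
  exact: continuous_subspaceT.
exists `|f c| => z; have [v pv zv] := period_reduction z.
by rewrite -(pf z v pv); apply: fc; rewrite inE.
Qed.

Definition uniformly_continuous f :=
  forall e, 0 < e -> exists2 r, 0 < r & forall z w, `|w| < r -> `|f (z + w) - f z| <= e.

Lemma periodic_uniformly_continuous f :
  continuous f -> periodic f -> uniformly_continuous f.
Proof.
move=> cf pf e e0.
have near_r := continuous_near_compact (@compact_period_box R d P) cf e0.
have [r [r0 fr]] := filter_ex (filterI (nbhs_right_gt 0) near_r).
exists r => // z w wr; have [v pv zv] := period_reduction z.
by rewrite -(pf z v pv) -(pf (z + w) v pv) addrAC; apply: fr.
Qed.

End periodic_functions.

(** * A cosine kernel *)

Section kernel.
Context {R : realType} {d : nat}.
Local Notation E := (R * 'rV[R]_d)%type.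
Variable P : R.
Hypothesis P0 : 0 < P.
Implicit Types (f g : E -> R) (z v w : E).

Definition kernel_defect z : R :=
  (1 - cos2pi (z.1 / P)) + \sum_i (1 - cos2pi (z.2 0 i)).

(** The average of the functions [(1 + cos) / 2] of the [d.+1] coordinates: it is
    [1] exactly at the periods, and its powers are trigonometric polynomials that
    concentrate there. *)
Definition kernel z : R := 1 - kernel_defect z / (2 * d.+1%:R).

Let D0 : 0 < 2 * d.+1%:R :> R.
Proof. by rewrite mulr_gt0// ltr0n. Qed.

Let one_sub_cos_ge0 (u : R) : 0 <= 1 - cos2pi u.
Proof. by rewrite subr_ge0 cos2pi_le1. Qed.

Let one_sub_cos_le2 (u : R) : 1 - cos2pi u <= 2.
Proof. by have := cos_geN1 (2 * pi * u); rewrite /cos2pi; lra. Qed.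

Lemma kernel_defect_ge0 z : 0 <= kernel_defect z.
Proof. by rewrite addr_ge0// sumr_ge0. Qed.

Lemma kernel_le1 z : kernel z <= 1.
Proof. by rewrite lerBlDr lerDl divr_ge0 ?kernel_defect_ge0// ltW. Qed.

Lemma kernel_ge0 z : 0 <= kernel z.
Proof.
rewrite subr_ge0 ler_pdivrMr// mul1r -[d.+1%:R]natr1 mulrDr mulr1 [leRHS]addrC lerD//.
apply: (@le_trans _ _ (\sum_(i < d) 2)); first exact: ler_sum.
by rewrite sumr_const card_ord mulr_natr.
Qed.

Lemma kernel0 : kernel 0 = 1.
Proof.
rewrite /kernel /kernel_defect mul0r big1 => [|i _]; last first.
  by rewrite mxE /cos2pi mulr0 cos0 subrr.
by rewrite /cos2pi mulr0 cos0 subrr add0r mul0r subr0.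
Qed.

Lemma continuous_kernel : continuous kernel.
Proof.
have c1 : continuous (fun z : E => 1 - cos2pi (z.1 / P)).
  move=> z; apply: cvgB; first exact: cvg_cst.
  apply: (@continuous_comp _ _ _ (fun z : E => z.1 / P)); last exact: continuous_cos2pi.
  by apply: cvgM; [exact: cvg_fst|exact: cvg_cst].
have c2 i : continuous (fun z : E => 1 - cos2pi (z.2 0 i)).
  move=> z; apply: cvgB; first exact: cvg_cst.
  apply: (@continuous_comp _ _ _ (fun z : E => z.2 0 i)); last exact: continuous_cos2pi.
  apply: (@continuous_comp _ _ _ snd (fun x : 'rV[R]_d => x 0 i)); first exact: cvg_snd.
  exact: coord_continuous.
move=> z; apply: cvgB; first exact: cvg_cst.
apply: cvgM; last exact: cvg_cst.
apply: cvgD; first exact: c1.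
suff cs : continuous (fun z : E => \sum_i (1 - cos2pi (z.2 0 i))) by exact: cs.
have -> : (fun z : E => \sum_i (1 - cos2pi (z.2 0 i))) =
    \sum_i (fun z : E => 1 - cos2pi (z.2 0 i)).
  by apply/funext => y; rewrite fct_sumE.
elim/big_ind : _ => [|f g|i _]; [exact: continuous_const|exact: continuous_add|].
exact: c2.
Qed.

Lemma kernel_periodic : periodic P kernel.
Proof.
move=> z v [v1 v2]; rewrite /kernel /kernel_defect.
have -> : (z + v).1 / P = z.1 / P + v.1 / P by rewrite -mulrDl.
rewrite (trig2pi_int _ v1).1; congr (1 - (_ + _) / _).
by apply: eq_bigr => i _; rewrite mxE (trig2pi_int _ (v2 i)).1.
Qed.

Lemma kernel_near1 (r : R) : 0 < r -> exists2 h, 0 < h < 1 &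
  forall z, 1 - h < kernel z -> exists2 v, period P v & `|z - v| < r.
Proof.
move=> r0; have e0 : 0 < Num.min r (r / P) by rewrite lt_min r0 divr_gt0.
have [h h0 hP] := cos2pi_near1 e0.
pose h' := Num.min (h / (2 * d.+1%:R)) 2^-1.
have h'0 : 0 < h' by rewrite lt_min divr_gt0//= invr_gt0.
exists h'; first by rewrite h'0/= gt_min [X in _ || X]invf_lt1 ?ltr1n ?orbT.
move=> z kz; have dz : kernel_defect z < h.
  have : kernel_defect z / (2 * d.+1%:R) < h / (2 * d.+1%:R).
    have h'h : h' <= h / (2 * d.+1%:R) by rewrite ge_min lexx.
    by move: kz; rewrite /kernel ltrD2l ltrN2 => /lt_le_trans; apply.
  by rewrite ltr_pM2r// invr_gt0.
have [v1 v1int v1r] : exists2 u, u \is a Num.int & `|z.1 / P - u| < Num.min r (r / P).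
  apply: hP; suff : 1 - cos2pi (z.1 / P) <= kernel_defect z by lra.
  by rewrite lerDl sumr_ge0.
have /choice[v2 v2P] : forall i : 'I_d, exists u, u \is a Num.int /\
    `|z.2 0 i - u| < Num.min r (r / P).
  move=> i; have [|u uint ur] := hP (z.2 0 i); last by exists u.
  suff : 1 - cos2pi (z.2 0 i) <= kernel_defect z by lra.
  by rewrite /kernel_defect (bigD1 i)//= addrCA lerDl addr_ge0// sumr_ge0.
exists (P * v1, \row_i v2 i); first split => /=.
- by rewrite mulrAC divff ?gt_eqF// mul1r.
- by move=> i; rewrite mxE; exact: (v2P i).1.
- apply: norm_components_lt => //= [|i].
    have -> : z.1 - P * v1 = P * (z.1 / P - v1).
      by rewrite mulrBr mulrCA divff ?gt_eqF// mulr1.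
    rewrite normrM gtr0_norm// mulrC -ltr_pdivlMr//.
    by move: v1r; rewrite lt_min => /andP[].
  by rewrite !mxE; have [_] := v2P i; rewrite lt_min => /andP[].
Qed.

(** By compactness of a period box, finitely many translates of the peaks cover
    everything; hence the peaks are not negligible for an invariant mean. *)
Lemma kernel_cover (h : R) : 0 < h ->
  exists s : seq E, forall z, exists2 c, c \in s & 1 - h < kernel (z + c).
Proof.
move=> h0; pose U c := [set z | 1 - h < kernel (z + c)].
have oU c : open (U c).
  have cc : continuous (fun z => kernel (z + c)).
    move=> z; apply: (@continuous_comp _ _ _ (fun z => z + c)); last exact: continuous_kernel.
    by apply: (@cvgD _ _ _ (nbhs z) _ id (fun=> c) z c); [exact: cvg_id|exact: cvg_cst].
  have -> : U c = (fun z => kernel (z + c)) @^-1` `]1 - h, +oo[%classic.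
    by apply/seteqP; split => z; rewrite /U/= in_itv/= andbT.
  by move/continuousP: cc; apply; exact: interval_open.
(* Finite lists ordered by inclusion: compactness yields one list that works for
   the whole box. *)
pose F : set_system (seq E) :=
  filter_from setT (fun s : seq E => [set t : seq E | {subset s <= t}]).
have FF : Filter F.
  apply: filter_from_filter; first by exists [::].
  move=> s t _ _; exists (s ++ t) => // u sub.
  by split => x xs; apply: sub; rewrite mem_cat xs ?orbT.
have : \forall s \near F, period_box P `<=`
    [set z | exists2 c, c \in s & 1 - h < kernel (z + c)].
  have /compact_near_coveringP := @compact_period_box R d P; apply => // z _.
  have Uz : nbhs z (U (- z)).
    apply: open_nbhs_nbhs; split; first exact: oU.
    by rewrite /U/= subrr kernel0 ltrBlDr ltrDl.
  exists (U (- z), [set t : seq E | - z \in t]); first split => //=.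
    by exists [:: - z] => // t; apply; rewrite mem_head.
  by move=> [z' t] [/= Uz' zt]; exists (- z).
move=> [s _ /(_ s) sU']; have sU := sU' (fun x xs => xs).
exists s => z; have [v pv /sU [c cs]] := period_reduction P0 z.
by rewrite addrAC kernel_periodic//; exists c.
Qed.

Section mean_of_kernel.
Variable M : (E -> R) -> R.
Hypothesis meanM : invariant_mean M.

Lemma bounded_kernel n : bounded_real (fun z => kernel z ^+ n).
Proof.
exists 1 => z; rewrite normrX ger0_norm ?kernel_ge0//.
by rewrite exprn_ile1 ?kernel_ge0 ?kernel_le1.
Qed.

(** The peak [1 - h < kernel] has positive mean because finitely many of its
    translates cover the whole group. *)
Lemma mean_kernel_lower (h : R) : 0 < h < 1 -> exists2 b, 0 < b &
  forall n, (1 - h) ^+ n * b <= M (fun z => kernel z ^+ n).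
Proof.
move=> /andP[h0 h1]; have [MD MZ Mle MS] := meanM.
pose a z : R := if 1 - h < kernel z then 1 else 0.
have a0 z : 0 <= a z by rewrite /a; case: ifP.
have a1 z : a z <= 1 by rewrite /a; case: ifP.
have ba : bounded_real a by exists 1 => z; rewrite ger0_norm.
have [s sP] := kernel_cover h0.
have bsum (t : seq E) : bounded_real (\sum_(c <- t) (fun z => a (z + c))).
  elim/big_ind : _ => [|f g|c _]; first exact: bounded_real_cst.
    exact: bounded_real_add.
  exact: bounded_real_comp.
have Msum (t : seq E) : M (\sum_(c <- t) (fun z => a (z + c))) = M a * (size t)%:R.
  elim: t => [|c t IH]; first by rewrite big_nil mulr0 (mean_cst meanM).
  rewrite big_cons MD//; last exact: bounded_real_comp.
  by rewrite IH MS// /= -natr1 mulrDr mulr1 addrC.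
have Ma : 0 < M a.
  have Ma0 : 0 <= M a.
    rewrite -(mean_cst meanM 0); apply: (mean_le meanM) => //.
    exact: bounded_real_cst.
  rewrite lt_neqAle Ma0 andbT eq_sym; apply/negP => /eqP Ma0'.
  have : M (fun=> 1) <= M (\sum_(c <- s) (fun z => a (z + c))).
    apply: (mean_le meanM) => //; first exact: bounded_real_cst.
    move=> z; have [c cs kc] := sP z; rewrite fct_sumE (big_rem c)//=.
    by rewrite {1}/a kc lerDl sumr_ge0.
  by rewrite Msum (mean_cst meanM) Ma0' mul0r ler10.
exists (M a) => // n; rewrite -MZ//; apply: (mean_le meanM).
- exact: bounded_real_scale.
- exact: bounded_kernel.
- move=> z; rewrite -[leLHS]/((1 - h) ^+ n * a z) /a.
  case: ifPn => kz; last by rewrite mulr0 exprn_ge0// kernel_ge0.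
  by rewrite mulr1 lerXn2r ?nnegrE ?kernel_ge0 ?subr_ge0 ?ltW.
Qed.

Lemma mean_kernel_gt0 n : 0 < M (fun z => kernel z ^+ n).
Proof.
have h2 : 0 < (2^-1 : R) < 1 by rewrite invr_gt0 ltr0n invf_lt1 ?ltr1n.
have [b b0 bP] := mean_kernel_lower h2; apply: lt_le_trans (bP n).
by rewrite mulr_gt0// exprn_gt0//; lra.
Qed.

End mean_of_kernel.
End kernel.

(** * Convolution with the kernel *)

Section convolution.
Context {R : realType} {d : nat}.
Local Notation E := (R * 'rV[R]_d)%type.
Variable P : R.
Hypothesis P0 : 0 < P.
Variable M : (E -> R) -> R.
Hypothesis meanM : invariant_mean M.
Implicit Types (f g : E -> R) (z v w : E).

Local Notation kernel := (kernel P).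
Local Notation mass n := (M (fun y => kernel y ^+ n)).

Definition conv n f z : R := M (fun y => f (z - y) * kernel y ^+ n) / mass n.

Let mass_gt0 n : 0 < mass n. Proof. exact: mean_kernel_gt0. Qed.

Lemma bounded_conv_integrand n f z :
  bounded_real f -> bounded_real (fun y => f (z - y) * kernel y ^+ n).
Proof.
move=> bf; apply: bounded_real_mul; last exact: bounded_kernel.
exact: (bounded_real_comp (fun y => z - y) bf).
Qed.

Lemma convD n f g z : bounded_real f -> bounded_real g ->
  conv n (f + g) z = conv n f z + conv n g z.
Proof.
move=> bf bg; have [MD _ _ _] := meanM; rewrite /conv -mulrDl -MD.
- by congr (M _ / _); apply/funext => y; rewrite -mulrDl.
- exact: bounded_conv_integrand.
- exact: bounded_conv_integrand.
Qed.

Lemma convZ n a f z : bounded_real f -> conv n (a *: f) z = a * conv n f z.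
Proof.
move=> bf; have [_ MZ _ _] := meanM; rewrite /conv mulrA -MZ.
- by congr (M _ / _); apply/funext => y; rewrite -[RHS]/(a * (_ * _)) mulrA.
- exact: bounded_conv_integrand.
Qed.

Lemma conv_le n f z B : bounded_real f -> (forall w, f w <= B) -> conv n f z <= B.
Proof.
move=> bf fB; have [_ MZ _ _] := meanM; rewrite /conv ler_pdivrMr// -MZ.
  apply: (mean_le meanM); first exact: bounded_conv_integrand.
    exact/bounded_real_scale/bounded_kernel.
  by move=> y; rewrite -[leRHS]/(B * _) ler_wpM2r// exprn_ge0// kernel_ge0.
exact: bounded_kernel.
Qed.

Lemma conv_normr_le n f z B : bounded_real f -> (forall w, `|f w| <= B) ->
  `|conv n f z| <= B.
Proof.
move=> bf fB; rewrite ler_norml lerNl -mulN1r -convZ//.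
apply/andP; split; apply: conv_le => //.
- exact: bounded_real_scale.
- by move=> w; rewrite -[leLHS]/(-1 * f w) mulN1r lerNl; have := fB w; rewrite ler_norml => /andP[].
- by move=> w; rewrite (le_trans (ler_norm _)).
Qed.

(** Where [1 - h < kernel y], [y] is close to a period and [f (z - y)] to [f z].
    Elsewhere [kernel y ^+ n <= (1 - h) ^+ n], which is negligible with respect to
    the mass, of order at least [(1 - h / 2) ^+ n]. *)
Lemma conv_approx_le f : bounded_real f -> periodic P f -> uniformly_continuous f ->
  forall e, 0 < e -> \forall n \near \oo, forall z, conv n f z <= f z + e.
Proof.
move=> bf pf uf e e0; have [MD MZ _ _] := meanM; have [B fB] := bf.
have e20 : 0 < e / 2 by rewrite divr_gt0.
have B0 : 0 <= B by rewrite (le_trans _ (fB 0)).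
have [r r0 fr] := uf _ e20.
have [h h01 hP] := @kernel_near1 R d P P0 r r0.
have /andP[h0 h1] := h01.
have h201 : 0 < h / 2 < 1 by apply/andP; split; lra.
have [b b0 bP] := mean_kernel_lower P0 meanM h201.
pose q := (1 - h) / (1 - h / 2).
have q0 : 0 <= q by rewrite divr_ge0; lra.
have q1 : q < 1 by rewrite ltr_pdivrMr; lra.
have : (fun n => (2 * B / b) * q ^+ n) @ \oo --> 0.
  have -> : 0 = (2 * B / b) * 0 :> R by rewrite mulr0.
  by apply: cvgM; [exact: cvg_cst|apply: cvg_expr; rewrite ger0_norm].
move=> /cvgr0_norm_le /(_ _ e20) near_q.
near=> n => z.
have qn : 2 * B / b * q ^+ n <= e / 2.
  rewrite (le_trans (ler_norm _))//; near: n; exact: near_q.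
rewrite /conv ler_pdivrMr//.
apply: (@le_trans _ _ (M ((f z + e / 2) *: (fun y => kernel y ^+ n) +
    (fun=> 2 * B * (1 - h) ^+ n)))).
  apply: (mean_le meanM); first exact: bounded_conv_integrand.
    apply: bounded_real_add; last exact: bounded_real_cst.
    exact/bounded_real_scale/bounded_kernel.
  move=> y; rewrite -[leRHS]/((f z + e / 2) * kernel y ^+ n + 2 * B * (1 - h) ^+ n).
  have kn0 : 0 <= kernel y ^+ n by rewrite exprn_ge0// kernel_ge0.
  have hn0 : 0 <= (1 - h) ^+ n by rewrite exprn_ge0// subr_ge0 ltW.
  have [ky|ky] := ltP (1 - h) (kernel y).
    have [v pv yv] := hP _ ky.
    rewrite ler_wpDr ?mulr_ge0// ler_wpM2r//.
    have -> : f (z - y) = f (z + (v - y)).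
      by rewrite -(pf (z - y) v pv) addrA [z + v - y]addrAC.
    by have := fr z (v - y); rewrite distrC => /(_ yv); rewrite ler_norml; lra.
  have kh : kernel y ^+ n <= (1 - h) ^+ n.
    by apply: lerXn2r; rewrite ?nnegrE ?kernel_ge0// subr_ge0 ltW.
  have fzy : f (z - y) - f z <= 2 * B.
    by have := fB z; have := fB (z - y); rewrite !ler_norml; lra.
  have : (f (z - y) - f z) * kernel y ^+ n <= 2 * B * (1 - h) ^+ n.
    apply: (@le_trans _ _ (2 * B * kernel y ^+ n)); first by rewrite ler_wpM2r.
    by rewrite ler_wpM2l// mulr_ge0.
  have : 0 <= e / 2 * kernel y ^+ n by rewrite mulr_ge0// ltW.
  by rewrite !mulrDl mulNr; lra.
rewrite MD; [|exact/bounded_real_scale/bounded_kernel|exact: bounded_real_cst].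
rewrite MZ; last exact: bounded_kernel.
rewrite (mean_cst meanM).
have -> : (f z + e) * mass n = (f z + e / 2) * mass n + e / 2 * mass n.
  by rewrite -mulrDl -addrA -splitr.
rewrite lerD2l; apply: (@le_trans _ _ (e / 2 * ((1 - h / 2) ^+ n * b))); last first.
  by rewrite ler_wpM2l ?bP// ltW.
have h2n : 0 < (1 - h / 2) ^+ n by rewrite exprn_gt0//; lra.
rewrite -ler_pdivrMr ?mulr_gt0//; apply: le_trans qn.
rewrite /q expr_div_n le_eqVlt; apply/orP; left; apply/eqP; field.
by rewrite !gt_eqF.
Unshelve. all: by end_near.
Qed.

Lemma conv_approx f : bounded_real f -> periodic P f -> uniformly_continuous f ->
  forall e, 0 < e -> \forall n \near \oo, forall z, `|conv n f z - f z| <= e.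
Proof.
move=> bf pf uf e e0.
have up := conv_approx_le bf pf uf e0.
have down : \forall n \near \oo, forall z, conv n (-1 *: f) z <= (-1 *: f) z + e.
  apply: conv_approx_le => //; first exact: bounded_real_scale.
  - by move=> z v pv; rewrite -[LHS]/(-1 * f (z + v)) pf.
  - move=> s s0; have [r r0 fr] := uf s s0; exists r => // z w wr.
    by rewrite -[X in `|X|]/(-1 * f (z + w) - -1 * f z) -mulrBr mulN1r normrN fr.
near=> n.
have fup : forall z, conv n f z <= f z + e by near: n.
have fdown : forall z, conv n (-1 *: f) z <= (-1 *: f) z + e by near: n.
move=> z; have := fup z; have := fdown z.
by rewrite convZ// -[(_ *: f) z]/(-1 * f z) ler_norml !mulN1r; lra.
Unshelve. all: by end_near.
Qed.

Lemma mean_value_along f g v : (forall w, derivable f w v) ->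
  (forall w, 'D_v f w = g w) -> forall w (h : R),
  exists2 s, `|s| <= `|h| & f (h *: v + w) - f w = h * g (s *: v + w).
Proof.
move=> df Dg w h; pose p (s : R) := f (s *: v + w).
have dp (s : R) : is_derive s (1 : R) p (g (s *: v + w)).
  have quotE : (fun h : R => h^-1 *: ((p \o shift s) (h *: 1) - p s)) =
      (fun h : R => h^-1 *: ((f \o shift (s *: v + w)) (h *: v) - f (s *: v + w))).
    by apply/funext => k; rewrite /p /= [k *: 1]mulr1 scalerDl addrA.
  apply: DeriveDef; first by rewrite /derivable quotE; exact: df.
  by rewrite -Dg /derive quotE.
have cp (a b : R) : {within `[a, b], continuous p}.
  apply: continuous_subspaceT => s; apply/differentiable_continuous.
  by apply/derivable1_diffP; case: (dp s).
have p0 : p 0 = f w by rewrite /p scale0r add0r.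
have [h0|h0] := leP 0 h.
  have [c] := MVT_segment h0 (fun s _ => dp s) (cp 0 h).
  rewrite in_itv/= p0 subr0 mulrC => /andP[c0 ch] fE; exists c => //.
  by rewrite !ger0_norm// (le_trans c0).
have [c] := MVT_segment (ltW h0) (fun s _ => dp s) (cp h 0).
rewrite in_itv/= p0 sub0r => /andP[ch c0] fE; exists c.
  by rewrite ler0_norm// ltr0_norm// lerN2.
by rewrite -opprB fE; ring.
Qed.

(** By the mean value theorem the difference quotients of [f] converge uniformly to
    [g], and convolution is a contraction for the uniform norm. *)
Lemma derive_conv n f g v : bounded_real f -> bounded_real g ->
  (forall w, derivable f w v) -> (forall w, 'D_v f w = g w) ->
  uniformly_continuous g -> forall z,
  derivable (conv n f) z v /\ 'D_v (conv n f) z = conv n g z.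
Proof.
move=> bf bg df Dg ug z.
suff cvq : (fun h => h^-1 *: ((conv n f \o shift z) (h *: v) - conv n f z)) @ 0^'
    --> conv n g z.
  by split; [apply/cvg_ex; exists (conv n g z)|apply: cvg_lim].
apply/cvgrPdist_le => e e0; have [r r0 gr] := ug e e0.
near=> h.
have h0 : h != 0 by near: h; exact: nbhs_dnbhs_neq.
have v0 : 0 < `|v| + 1 by rewrite ltr_wpDl.
have hr : `|h| < r / (`|v| + 1) by near: h; apply: dnbhs0_lt; rewrite divr_gt0.
pose fh : E -> R := fun w => f (h *: v + w).
have bfh : bounded_real fh by exact: (bounded_real_comp (fun w => h *: v + w) bf).
have convfh : conv n fh z = conv n f (h *: v + z).
  by rewrite /conv; congr (M _ / _); apply/funext => y; rewrite /fh addrA.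
have bN : bounded_real (-1 *: f) by exact: bounded_real_scale.
have bfhf : bounded_real (fh + -1 *: f) by exact: bounded_real_add.
have bq : bounded_real (- h^-1 *: (fh + -1 *: f)) by exact: bounded_real_scale.
have -> : conv n g z - h^-1 *: ((conv n f \o shift z) (h *: v) - conv n f z) =
    conv n (g + - h^-1 *: (fh + -1 *: f)) z.
  rewrite convD// convZ// convD// convZ// convfh mulN1r mulNr.
  by [].
apply: conv_normr_le; first exact: bounded_real_add.
move=> w; have [s sh fE] := mean_value_along df Dg w h.
rewrite -[X in `|X|]/(g w + - h^-1 * (f (h *: v + w) + -1 * f w)) mulN1r fE.
rewrite mulNr mulKf// distrC [s *: v + w]addrC; apply: gr.
rewrite normrZ (@le_lt_trans _ _ (`|h| * (`|v| + 1)))//.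
  by rewrite ler_pM// lerDl.
by rewrite -ltr_pdivlMr.
Unshelve. all: by end_near.
Qed.

Lemma mean_sum (I : Type) (s : seq I) (F : I -> E -> R) :
  (forall i, bounded_real (F i)) ->
  bounded_real (fun y => \sum_(i <- s) F i y) /\
  M (fun y => \sum_(i <- s) F i y) = \sum_(i <- s) M (F i).
Proof.
move=> bF; have [MD _ _ _] := meanM; elim: s => [|i s [IHb IH]].
  rewrite big_nil (_ : (fun y => _) = fun=> 0); last first.
    by apply/funext => y; rewrite big_nil.
  by split; [exact: bounded_real_cst|exact: mean_cst].
rewrite big_cons -IH -MD// (_ : (fun y => _) = F i + fun y => \sum_(i <- s) F i y).
  by split => //; exact: bounded_real_add.
by apply/funext => y; rewrite big_cons.
Qed.

(** The addition formulas write [kernel (y + z)] as a finite sum of products of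
    a bounded function of [y] and a smooth function of [z]. By induction on [n]
    the first factor is absorbed into [Q] and the second one leaves the mean. *)
Lemma smooth_torus_mean_kernel n (Q : E -> R) : bounded_real Q ->
  smooth_torus (fun z => M (fun y => Q y * kernel (y + z) ^+ n)).
Proof.
have [MD MZ _ _] := meanM.
elim: n Q => [|n IH] Q bQ.
  rewrite (_ : (fun z => _) = fun=> M Q); first exact: smooth_torus_cst.
  by apply/funext => z; congr M; apply/funext => y; rewrite expr0 mulr1.
pose D : R := 2 * d.+1%:R.
pose K n z y := kernel (y + z) ^+ n.
have bK z : bounded_real (K n z).
  exact: (bounded_real_comp (fun y => y + z) (bounded_kernel P n)).
have bc (u : E -> R) : bounded_real (fun y => cos2pi (u y)).
  by exists 1 => y; exact: cos_max.
have bs (u : E -> R) : bounded_real (fun y => sin2pi (u y)).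
  by exists 1 => y; exact: sin_max.
pose H (q : E -> R) z := M (fun y => (Q y * q y) * K n z y).
have bH q z : bounded_real q -> bounded_real (fun y => (Q y * q y) * K n z y).
  by move=> bq; apply: bounded_real_mul => //; exact: bounded_real_mul.
have sH q : bounded_real q -> smooth_torus (H q).
  by move=> bq; apply: IH; exact: bounded_real_mul.
pose c1 (y : E) := cos2pi (y.1 / P); pose s1 (y : E) := sin2pi (y.1 / P).
pose c2 i (y : E) := cos2pi (y.2 0 i); pose s2 i (y : E) := sin2pi (y.2 0 i).
have -> : (fun z => M (fun y => Q y * kernel (y + z) ^+ n.+1)) =
  (fun z => (1 - d.+1%:R / D) * H (fun=> 1) z +
    (D^-1 * (c1 z * H c1 z + -1 * (s1 z * H s1 z)) +
     D^-1 * \sum_i (c2 i z * H (c2 i) z + -1 * (s2 i z * H (s2 i) z)))).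
  apply/funext => z.
  pose F q : E -> R := fun y => (Q y * q y) * K n z y.
  have bF q : bounded_real q -> bounded_real (F q) by move=> bq; exact: bH.
  have b1 : bounded_real (fun _ : E => 1 : R) by exact: bounded_real_cst.
  pose G (cs : R * R) (q q' : E -> R) : E -> R := cs.1 *: F q + -1 *: (cs.2 *: F q').
  have bG cs q q' : bounded_real q -> bounded_real q' -> bounded_real (G cs q q').
    move=> bq bq'; apply: bounded_real_add; first exact/bounded_real_scale/bF.
    exact/bounded_real_scale/bounded_real_scale/bF.
  have MG cs q q' : bounded_real q -> bounded_real q' ->
      M (G cs q q') = cs.1 * H q z + -1 * (cs.2 * H q' z).
    move=> bq bq'; rewrite MD.
    - rewrite MZ; last exact: bF.
      rewrite MZ; last exact/bounded_real_scale/bF.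
      by rewrite MZ; last exact: bF.
    - exact/bounded_real_scale/bF.
    - exact/bounded_real_scale/bounded_real_scale/bF.
  have bG2 i : bounded_real (G (c2 i z, s2 i z) (c2 i) (s2 i)).
    by apply: bG; [exact: bc|exact: bs].
  have [bS MS] := mean_sum (index_enum 'I_d) bG2.
  have bG1 : bounded_real (G (c1 z, s1 z) c1 s1) by apply: bG; [exact: bc|exact: bs].
  transitivity (M ((1 - d.+1%:R / D) *: F (fun=> 1) +
      (D^-1 *: G (c1 z, s1 z) c1 s1 +
       D^-1 *: (fun y => \sum_i G (c2 i z, s2 i z) (c2 i) (s2 i) y)))).
    congr M; apply/funext => y; rewrite exprSr mulrA -[kernel (y + z) ^+ n]/(K n z y).
    have -> : kernel (y + z) = (1 - d.+1%:R / D) +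
        (D^-1 * (c1 y * c1 z - s1 y * s1 z) +
         D^-1 * \sum_i (c2 i y * c2 i z - s2 i y * s2 i z)).
      rewrite /kernel /kernel_defect -/D.
      have -> : (y + z).1 / P = y.1 / P + z.1 / P by rewrite -mulrDl.
      rewrite cos2piD -/(c1 y) -/(c1 z) -/(s1 y) -/(s1 z).
      have -> : \sum_i (1 - cos2pi ((y + z).2 0 i)) =
          d%:R - \sum_i (c2 i y * c2 i z - s2 i y * s2 i z).
        rewrite sumrB sumr_const card_ord; congr (_ - _).
        by apply: eq_bigr => i _; rewrite mxE cos2piD.
      by rewrite -(natr1 d); ring.
    rewrite -[RHS]/((1 - d.+1%:R / D) * (Q y * 1 * K n z y) +
      (D^-1 * (c1 z * (Q y * c1 y * K n z y) + -1 * (s1 z * (Q y * s1 y * K n z y))) +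
       D^-1 * (\sum_i (c2 i z * (Q y * c2 i y * K n z y) +
          -1 * (s2 i z * (Q y * s2 i y * K n z y)))))).
    have -> : \sum_i (c2 i z * (Q y * c2 i y * K n z y) +
          -1 * (s2 i z * (Q y * s2 i y * K n z y))) =
        Q y * K n z y * \sum_i (c2 i y * c2 i z - s2 i y * s2 i z).
      by rewrite mulr_sumr; apply: eq_bigr => i _; ring.
    ring.
  rewrite MD; [|exact/bounded_real_scale/bF|]; last first.
    by apply: bounded_real_add; exact: bounded_real_scale.
  rewrite MZ; last exact: bF.
  rewrite MD; [|exact: bounded_real_scale|exact: bounded_real_scale].
  rewrite MZ// MZ// MS MG; [|exact: bc|exact: bs].
  congr (_ + (_ + _ * _)); apply: eq_bigr => i _.
  by rewrite MG; [|exact: bc|exact: bs].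
have sP (g : R -> R) : smooth_torus (fun z : E => g (2 * pi / P * z.1)) ->
    smooth_torus (fun z : E => g (2 * pi * (z.1 / P))).
  by move=> + k => /(_ k); under eq_fun do rewrite mulrAC -mulrA.
have sc1 : smooth_torus c1 by apply: sP; exact: smooth_torus_cos_time.
have ss1 : smooth_torus s1 by apply: sP; exact: smooth_torus_sin_time.
have sc2 i : smooth_torus (c2 i) by exact: smooth_torus_cos2pi.
have ss2 i : smooth_torus (s2 i) by exact: smooth_torus_sin2pi.
have sterm (u u' q q' : E -> R) : smooth_torus u -> smooth_torus u' ->
    bounded_real q -> bounded_real q' ->
    smooth_torus (fun z => u z * H q z + -1 * (u' z * H q' z)).
  move=> su su' bq bq'; apply: smooth_torus_add.
    by apply: smooth_torus_mul => //; exact: sH.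
  by apply: smooth_torus_scale; apply: smooth_torus_mul => //; exact: sH.
apply: smooth_torus_add.
  by apply: smooth_torus_scale; apply: sH; exact: bounded_real_cst.
apply: smooth_torus_add; apply: smooth_torus_scale.
  by apply: sterm => //; [exact: bc|exact: bs].
apply: smooth_torus_sum => i.
by apply: sterm => //; [exact: bc|exact: bs].
Qed.

(** Invariance of the mean moves the variable from [f] to the kernel. *)
Lemma smooth_torus_conv n f : bounded_real f -> smooth_torus (conv n f).
Proof.
move=> bf; have [_ _ _ MS] := meanM.
have -> : conv n f = fun z =>
    (mass n)^-1 * M (fun y => f (- y) * kernel (y + z) ^+ n).
  apply/funext => z; rewrite /conv mulrC; congr (_ * _).
  rewrite -(MS _ z); last exact: bounded_conv_integrand.
  by congr M; apply/funext => y; rewrite opprD addrA addrAC subrr add0r.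
apply: smooth_torus_scale; apply: smooth_torus_mean_kernel.
exact: (bounded_real_comp (fun y => - y) bf).
Qed.

End convolution.

(** * Density of smooth functions in C^2 *)

(** The difference quotients along the two lines are the same function of the
    step; this identifies the partial derivatives of a function with the
    derivatives of its slices. *)
Lemma same_derive (R : realType) (V W : normedModType R) (f : V -> R) (g : W -> R)
    z y v u : (forall h : R, f (h *: v + z) = g (h *: u + y)) ->
  (derivable g y u -> derivable f z v) /\ 'D_v f z = 'D_u g y.
Proof.
move=> fg; have fg0 : f z = g y by have := fg 0; rewrite !scale0r !add0r.
have quotE : (fun h : R => h^-1 *: ((f \o shift z) (h *: v) - f z)) =
    (fun h : R => h^-1 *: ((g \o shift y) (h *: u) - g y)).
  by apply/funext => h; rewrite /= fg fg0.
by split; rewrite ?/derivable /derive quotE.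
Qed.

Section density.
Context {R : realType} {d : nat}.
Local Notation E := (R * 'rV[R]_d)%type.
Implicit Types (f g : E -> R) (z v w : E).

Lemma near_unit_time f (e : R) : continuous f -> periodic_space f -> 0 < e ->
  \forall r \near 0^'+, forall z (s : R), 0 <= z.1 <= 1 -> `|s - z.1| < r ->
    `|f (s, z.2) - f z| <= e.
Proof.
move=> cf pf e0.
have := continuous_near_compact (@compact_period_box R d 1) cf e0.
apply: filter_app; near=> r => near_f [t x] s /= t01 sr.
have fx : lattice_rel (fracpart x) x := fracpart_lattice x.
have wE : (s, fracpart x) = (t, fracpart x) + (s - t, 0).
  by congr pair; rewrite ?addr0// addrC subrK.
rewrite -(pf s _ _ fx) -(pf t _ _ fx) wE; apply: near_f.
  split => /=; first by rewrite in_itv/= t01.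
  by move=> i; rewrite in_itv/= fracpart_itv.
by rewrite prod_normE/= normr0 gt_max sr (le_lt_trans _ sr).
Unshelve. all: by end_near.
Qed.

Lemma bounded_on_unit_time f : continuous f -> periodic_space f ->
  exists2 B, 0 < B & forall z, 0 <= z.1 <= 1 -> `|f z| <= B.
Proof.
move=> cf pf; have cnf : continuous (fun z => `|f z|).
  by move=> x; apply: cvg_norm; exact: cf.
have box0 : @period_box R d 1 !=set0.
  by exists 0; split => /= [|i]; rewrite ?mxE in_itv/= lexx ler01.
have [|c _ fc] := @compact_EVT_max _ _ (fun x => `|f x|) _ box0 (@compact_period_box R d 1).
  exact: continuous_subspaceT.
exists (`|f c| + 1) => [|[t x] /= t01]; first by rewrite ltr_wpDl.
rewrite -(pf t _ _ (fracpart_lattice x)) (le_trans (fc _ _)) ?lerDl// inE.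
split => /=; first by rewrite in_itv/= t01.
by move=> i; rewrite in_itv/= fracpart_itv.
Qed.

Section time_wrapping.
Variable P : R.
Hypothesis P0 : 0 < P.

(** A function of class C^2 on the cylinder is periodic in space only, whereas
    smoothing by an invariant mean asks for periodicity in time as well. Time is
    therefore replaced by the sine wave [wrap] of period [P], which is close to
    the identity in C^1 on the unit interval when [P] is large. *)
Definition wrap (t : R) : R := (2 * pi / P)^-1 * sin (2 * pi / P * t).

Definition pull f : E -> R := fun z => f (wrap z.1, z.2).

Let c0 : 0 < 2 * pi / P.
Proof. by rewrite divr_gt0// mulr_gt0// pi_gt0. Qed.

Let phaseE (t : R) : 2 * pi / P * t = 2 * pi * (t / P).
Proof. by rewrite mulrAC -mulrA. Qed.

Lemma derive_wrap z v :
  differentiable (fun z : E => wrap z.1) z /\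
  'D_v (fun z : E => wrap z.1) z = cos2pi (z.1 / P) * v.1.
Proof.
have [ds Ds] := @derive_comp_real _ _ sin cos (fun z : E => 2 * pi / P * z.1) z v
  (is_derive_sin _) (differentiable_time _ _).
split.
  exact: (@differentiableZ _ _ _ (sin \o (fun z : E => 2 * pi / P * z.1))).
have -> : 'D_v (fun z : E => wrap z.1) z =
    (2 * pi / P)^-1 * 'D_v (sin \o (fun z : E => 2 * pi / P * z.1)) z.
  by apply: deriveZ; exact: diff_derivable.
by rewrite Ds derive_time (phaseE z.1) mulrCA mulKf// gt_eqF.
Qed.

Lemma continuous_wrap : continuous (fun z : E => wrap z.1).
Proof.
by move=> z; apply: differentiable_continuous; exact: (derive_wrap z 0).1.
Qed.

Lemma continuous_pull f : continuous f -> continuous (pull f).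
Proof.
move=> cf z; apply: (@continuous_comp _ _ _ (fun z : E => (wrap z.1, z.2))).
  apply: (@cvg_pair _ _ _ _ (nbhs (wrap z.1)) (nbhs z.2)); last exact: cvg_snd.
  exact: continuous_wrap.
exact: cf.
Qed.

Lemma periodic_pull f : periodic_space f -> periodic P (pull f).
Proof.
move=> pf z v [v1 v2]; have wv : wrap (z + v).1 = wrap z.1.
  rewrite /wrap !phaseE; congr (_ * _).
  have -> : (z + v).1 / P = z.1 / P + v.1 / P by rewrite -mulrDl.
  exact: (trig2pi_int _ v1).2.
rewrite /pull wv; apply: pf; apply/lattice_relE => i; rewrite !mxE addrAC subrr add0r.
exact: v2.
Qed.

Lemma derive_pull_space f z i : (forall w, differentiable f w) ->
  derivable (pull f) z ((0, delta_mx 0 i) : E) /\ dx i (pull f) z = pull (dx i f) z.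
Proof.
move=> df; have fE (h : R) : pull f (h *: ((0, delta_mx 0 i) : E) + z) =
    f (h *: ((0, delta_mx 0 i) : E) + (wrap z.1, z.2)).
  rewrite -[LHS]/(f (wrap (h * 0 + z.1), h *: delta_mx 0 i + z.2)).
  by rewrite -[RHS]/(f (h * 0 + wrap z.1, h *: delta_mx 0 i + z.2)) mulr0 !add0r.
have [dE DE] := same_derive fE.
by split; [apply: dE; exact: diff_derivable|rewrite /dx DE].
Qed.

Lemma derive_pull_time f z : (forall w, differentiable f w) ->
  derivable (pull f) z ((1, 0) : E) /\
  dt (pull f) z = cos2pi (z.1 / P) * pull (dt f) z.
Proof.
move=> df; pose g s := f (s, z.2).
have dg s : is_derive s (1 : R) g (dt f (s, z.2)).
  have gE (h : R) : g (h *: (1 : R) + s) = f (h *: ((1, 0) : E) + (s, z.2)).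
    by rewrite -[RHS]/(f (h *: 1 + s, h *: 0 + z.2)) scaler0 add0r.
  have [dE DE] := same_derive gE.
  by apply: DeriveDef; [apply: dE; exact: diff_derivable|exact: DE].
have [dw Dw] := derive_wrap z ((1, 0) : E).
have [dF DF] := @derive_comp_real _ _ g (fun s => dt f (s, z.2))
  (fun w : E => wrap w.1) z ((1, 0) : E) (dg _) dw.
have pE (h : R) : pull f (h *: ((1, 0) : E) + z) =
    (g \o (fun w : E => wrap w.1)) (h *: ((1, 0) : E) + z).
  rewrite -[LHS]/(f (wrap (h * 1 + z.1), h *: 0 + z.2)) scaler0 add0r.
  by [].
have [dE DE] := same_derive pE.
split; first by apply: dE; exact: diff_derivable.
by rewrite /dt DE DF Dw /= mulr1 mulrC.
Qed.

End time_wrapping.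

Lemma wrap_close (r : R) : 0 < r -> exists2 P, 0 < P & forall t, 0 <= t <= 1 ->
  `|wrap P t - t| < r /\ `|cos2pi (t / P) - 1| < r.
Proof.
move=> r0; have r20 : 0 < r / 2 by rewrite divr_gt0.
have /cvgrPdist_lt/(_ _ r20)/nbhs_ballP[s /= s0 cs] := @continuous_cos2pi R 0.
pose P := 2 / s; have P0 : 0 < P by rewrite divr_gt0.
have cosP t : 0 <= t <= 1 -> `|cos2pi (t / P) - 1| < r / 2.
  move=> /andP[t0 t1].
  have -> : `|cos2pi (t / P) - 1| = `|cos2pi 0 - cos2pi (t / P)|.
    by rewrite {2}/cos2pi mulr0 cos0 distrC.
  have tP0 : 0 <= t / P by apply: divr_ge0 => //; exact: ltW.
  apply: cs; rewrite -ball_normE/= sub0r normrN ger0_norm//.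
  rewrite ltr_pdivrMr// /P mulrCA divff ?gt_eqF// mulr1 (le_lt_trans t1)//.
  by rewrite ltr1n.
have r2r : r / 2 < r by lra.
exists P; first exact: P0.
move=> t t01; split; last exact: lt_trans (cosP t t01) r2r.
have /andP[t0 t1] := t01.
have dw (q : R) : is_derive q (1 : R) (wrap P) (cos2pi (q / P)).
  have wE (h : R) : wrap P (h *: (1 : R) + q) =
      (fun z : E => wrap P z.1) (h *: ((1, 0) : E) + (q, 0)) by [].
  have [dE DE] := same_derive wE.
  have [dz Dz] := derive_wrap P0 (q, 0) ((1, 0) : E).
  apply: DeriveDef; first exact: dE (diff_derivable dz).
  by rewrite DE; apply: etrans Dz _; rewrite /= mulr1.
have [|c] := MVT_segment t0 (fun q _ => dw q).
  apply: continuous_subspaceT => x; apply/differentiable_continuous.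
  by apply/derivable1_diffP; case: (dw x).
have -> : wrap P 0 = 0 by rewrite /wrap mulr0 sin0 mulr0.
rewrite in_itv/= !subr0 => /andP[c0 ct] ->.
have -> : cos2pi (c / P) * t - t = (cos2pi (c / P) - 1) * t.
  by rewrite mulrBl mul1r.
have cr : `|cos2pi (c / P) - 1| < r / 2 by apply: cosP; rewrite c0 (le_trans ct).
rewrite normrM (ger0_norm t0) (@le_lt_trans _ _ (r / 2))//.
by rewrite -[leRHS]mulr1 ler_pM// ltW.
Qed.

(** The function [phi (wrap t, x)] is periodic in time and space, and its
    derivatives are close to those of [phi] on the unit time interval. Convolution
    makes it smooth and commutes with the derivatives, so these are approximated
    uniformly. *)
Lemma smooth_torus_dense phi (e : R) : Ck_torus 2 phi -> 0 < e ->
  exists2 psi, smooth_torus psi & forall z, 0 <= z.1 <= 1 ->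
    [/\ `|psi z - phi z| <= e, `|dt psi z - dt phi z| <= e,
        forall i, `|dx i psi z - dx i phi z| <= e &
        forall i, `|dx i (dx i psi) z - dx i (dx i phi) z| <= e].
Proof.
move=> Cphi e0; have e40 : 0 < e / 4 by rewrite divr_gt0.
have Cdt : Ck_torus 1 (dt phi) by exact: Ck_torus_derive.
have Cdx i : Ck_torus 1 (dx i phi) by exact: Ck_torus_derive.
have Cdxx i : Ck_torus 0 (dx i (dx i phi)) by exact: Ck_torus_derive.
pose close_at (r : R) (g : E -> R) := forall z (s : R),
  0 <= z.1 <= 1 -> `|s - z.1| < r -> `|g (s, z.2) - g z| <= e / 4.
have nearC k g : Ck_torus k g -> \forall r \near 0^'+, close_at r g.
  by move=> Cg; apply: near_unit_time => //; [exact: Ck_torus_continuous Cg|case: Cg].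
have [B B0 dtB] : exists2 B, 0 < B & forall z, 0 <= z.1 <= 1 -> `|dt phi z| <= B.
  by apply: bounded_on_unit_time; [exact: Ck_torus_continuous Cdt|case: Cdt].
have near_x : \forall r \near 0^'+, forall i, close_at r (dx i phi).
  by apply: filter_forall => i; exact: nearC _ _ (Cdx i).
have near_xx : \forall r \near 0^'+, forall i, close_at r (dx i (dx i phi)).
  by apply: filter_forall => i; exact: nearC _ _ (Cdxx i).
have [r [r0 r_phi r_t [r_x r_xx]]] : exists r, [/\ 0 < r, close_at r phi,
    close_at r (dt phi) & (forall i, close_at r (dx i phi)) /\
    forall i, close_at r (dx i (dx i phi))].
  apply: (@filter_ex _ (0^'+)); near=> r.
  split; [near: r; exact: nbhs_right_gt|near: r; exact: nearC _ _ Cphi| |split].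
  - near: r; exact: nearC _ _ Cdt.
  - near: r; exact: near_x.
  - near: r; exact: near_xx.
have Be0 : 0 < B + e by rewrite addr_gt0.
have s0 : 0 < Num.min r (e / 4 / (B + e)) by rewrite lt_min r0 divr_gt0.
have [P P0 wP] := wrap_close s0.
have wr z : 0 <= z.1 <= 1 -> `|wrap P z.1 - z.1| < r.
  by move=> /wP[+ _]; rewrite lt_min => /andP[].
have cr z : 0 <= z.1 <= 1 -> `|cos2pi (z.1 / P) - 1| < e / 4 / (B + e).
  by move=> /wP[_]; rewrite lt_min => /andP[].
have [M meanM] := @invariant_mean_exists R E.
pose ft z := cos2pi (z.1 / P) * pull P (dt phi) z.
have pcp g k : Ck_torus k g -> continuous (pull P g) /\ periodic P (pull P g).
  move=> Cg; split; first by apply: (continuous_pull P0); exact: Ck_torus_continuous Cg.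
  by apply: periodic_pull; case: Cg.
have cft : continuous ft.
  move=> z; apply: cvgM; last exact: (pcp _ _ Cdt).1.
  apply: (@continuous_comp _ _ _ (fun z : E => z.1 / P)); last exact: continuous_cos2pi.
  by apply: cvgM; [exact: cvg_fst|exact: cvg_cst].
have pft : periodic P ft.
  move=> z v pv; rewrite /ft ((pcp _ _ Cdt).2 z v pv); congr (_ * _).
  have -> : (z + v).1 / P = z.1 / P + v.1 / P by rewrite -mulrDl.
  exact: (trig2pi_int _ pv.1).1.
have bounded g : continuous g /\ periodic P g -> bounded_real g.
  by move=> [cg pg]; exact: (periodic_bounded P0 cg pg).
have ucont g : continuous g /\ periodic P g -> uniformly_continuous g.
  by move=> [cg pg]; exact: (periodic_uniformly_continuous P0 cg pg).
have e20 : 0 < e / 2 by rewrite divr_gt0.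
pose conv_close n (g : E -> R) := forall z, `|conv P M n g z - g z| <= e / 2.
have near_conv g : continuous g /\ periodic P g ->
    \forall n \near \oo, conv_close n g.
  by move=> cpg; apply: conv_approx => //; [exact: bounded|exact: cpg.2|exact: ucont].
have conv_x : \forall n \near \oo, forall i, conv_close n (pull P (dx i phi)).
  by apply: filter_forall => i; exact: near_conv _ (pcp _ _ (Cdx i)).
have conv_xx : \forall n \near \oo, forall i, conv_close n (pull P (dx i (dx i phi))).
  by apply: filter_forall => i; exact: near_conv _ (pcp _ _ (Cdxx i)).
have [n [n_phi n_t n_x n_xx]] : exists n, [/\ conv_close n (pull P phi),
    conv_close n ft, forall i, conv_close n (pull P (dx i phi)) &
    forall i, conv_close n (pull P (dx i (dx i phi)))].
  apply: (@filter_ex _ \oo); near=> n.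
  split; near: n; [exact: near_conv _ (pcp _ _ Cphi)| |exact: conv_x|exact: conv_xx].
  exact: near_conv _ (conj cft pft).
exists (conv P M n (pull P phi)).
  by apply: smooth_torus_conv => //; apply: bounded; exact: pcp _ _ Cphi.
have dphi w : differentiable phi w by exact: CkS_differentiable Cphi.1.
have ddx i w : differentiable (dx i phi) w by exact: CkS_differentiable (Cdx i).1.
have dt_conv z : dt (conv P M n (pull P phi)) z = conv P M n ft z.
  exact: (@derive_conv _ _ _ P0 _ meanM n (pull P phi) ft ((1, 0) : E)
    (bounded _ (pcp _ _ Cphi)) (bounded _ (conj cft pft))
    (fun w => (derive_pull_time P0 w dphi).1)
    (fun w => (derive_pull_time P0 w dphi).2) (ucont _ (conj cft pft)) z).2.
have dx_conv i g z : (forall w, differentiable g w) -> continuous g /\ periodic_space g ->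
    continuous (dx i g) /\ periodic_space (dx i g) ->
    dx i (conv P M n (pull P g)) z = conv P M n (pull P (dx i g)) z.
  move=> dg [cg pg] [cdg pdg]; have pcg : continuous (pull P (dx i g)) /\ periodic P (pull P (dx i g)).
    by split; [exact: (continuous_pull P0)|exact: periodic_pull].
  have pcg0 : continuous (pull P g) /\ periodic P (pull P g).
    by split; [exact: (continuous_pull P0)|exact: periodic_pull].
  exact: (@derive_conv _ _ _ P0 _ meanM n (pull P g) (pull P (dx i g)) ((0, delta_mx 0 i) : E)
    (bounded _ pcg0) (bounded _ pcg)
    (fun w => (derive_pull_space P w i dg).1)
    (fun w => (derive_pull_space P w i dg).2) (ucont _ pcg) z).2.
have cps k g : Ck_torus k g -> continuous g /\ periodic_space g.
  by move=> Cg; split; [exact: Ck_torus_continuous Cg|case: Cg].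
have dxE i : dx i (conv P M n (pull P phi)) = conv P M n (pull P (dx i phi)).
  by apply/funext => z; exact: (dx_conv i phi z dphi (cps _ _ Cphi) (cps _ _ (Cdx i))).
have close (a b c : R) : `|a - b| <= e / 2 -> `|b - c| <= e / 2 -> `|a - c| <= e.
  by move=> ab bc; rewrite -(subrKA b) [leRHS]splitr (le_trans (ler_normD _ _))// lerD.
have e42 : e / 4 <= e / 2 by lra.
move=> z z01; split.
- apply: close _ _ _ (n_phi z) _; apply: le_trans e42.
  by apply: r_phi => //; exact: wr.
- rewrite dt_conv; apply: close _ _ _ (n_t z) _.
  have t1 : `|pull P (dt phi) z - dt phi z| <= e / 4 by apply: r_t => //; exact: wr.
  have t2 := dtB z z01.
  have t3 : `|pull P (dt phi) z| <= B + e.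
    rewrite -(subrK (dt phi z) (pull P (dt phi) z)) (le_trans (ler_normD _ _))//.
    by rewrite addrC lerD// (le_trans t1)//; lra.
  have -> : ft z - dt phi z = (cos2pi (z.1 / P) - 1) * pull P (dt phi) z +
      (pull P (dt phi) z - dt phi z) by rewrite /ft; ring.
  rewrite (le_trans (ler_normD _ _))//.
  have : `|(cos2pi (z.1 / P) - 1) * pull P (dt phi) z| <= e / 4 / (B + e) * (B + e).
    by rewrite normrM ler_pM// ltW// cr.
  by rewrite divfK ?gt_eqF//; lra.
- move=> i; rewrite dxE; apply: close _ _ _ (n_x i z) _; apply: le_trans e42.
  by apply: r_x => //; exact: wr.
- move=> i; rewrite dxE (dx_conv i (dx i phi) z (ddx i) (cps _ _ (Cdx i)) (cps _ _ (Cdxx i))).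
  apply: close _ _ _ (n_xx i z) _; apply: le_trans e42.
  by apply: r_xx => //; exact: wr.
Unshelve. all: by end_near.
Qed.

End density.

(** * The convex constraint *)

Section constraint.
Context {R : realType}.
Variable Psi : R -> \bar R.
Hypothesis Psi_ge0 : forall r, (0 <= Psi r)%E.

(** With the supremum of the Legendre transform unfolded, the constraint becomes a
    family of affine inequalities in [(u, s)]. *)
Definition below_legendre (u s : R) :=
  forall r, (Psi r < +oo)%E -> u + r * s <= fine (Psi r).

Lemma below_legendreP u s :
  (u%:E + legendre Psi s <= 0)%E <-> below_legendre u s.
Proof.
have -> : (u%:E + legendre Psi s <= 0)%E = (legendre Psi s <= (- u)%:E)%E.
  case: (legendre Psi s) => [x| |]; rewrite ?leNye ?addeNy ?leNye//.
  by rewrite -EFinD !lee_fin -lerBrDl sub0r.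
split=> [le r Pr|le].
  have : ((r * s)%:E - Psi r <= (- u)%:E)%E.
    by apply: le_trans le; apply: ereal_sup_ubound; exists r.
  have Pfin : Psi r \is a fin_num by rewrite ge0_fin_numE.
  by rewrite -{1}(fineK Pfin) -EFinB lee_fin; lra.
apply: ge_ereal_sup => _ [r _ <-].
have [Pr|] := ltP (Psi r) +oo%E; last first.
  by rewrite leye_eq => /eqP ->; rewrite addeNy leNye.
have Pfin : Psi r \is a fin_num by rewrite ge0_fin_numE.
rewrite -(fineK Pfin) -EFinB lee_fin; have := le r Pr; lra.
Qed.

Lemma sqnorm_ge0 {d} (b : 'rV[R]_d) : 0 <= sqnorm b.
Proof. by apply: sumr_ge0 => i _; exact: sqr_ge0. Qed.

Lemma sqnorm_convex {d} (t : R) (b b' : 'rV[R]_d) : 0 <= t <= 1 ->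
  sqnorm (t *: b + (1 - t) *: b') <= t * sqnorm b + (1 - t) * sqnorm b'.
Proof.
move=> /andP[t0 t1]; rewrite /sqnorm !mulr_sumr -big_split/=.
apply: ler_sum => i _; rewrite !mxE -subr_ge0.
have -> : t * b 0 i ^+ 2 + (1 - t) * b' 0 i ^+ 2 -
    (t * b 0 i + (1 - t) * b' 0 i) ^+ 2 = t * (1 - t) * (b 0 i - b' 0 i) ^+ 2 by ring.
by apply: mulr_ge0; [apply: mulr_ge0; rewrite ?subr_ge0|exact: sqr_ge0].
Qed.

Section triples.
Context {X : topologicalType} {d : nat}.

Definition triple := ((X -> R) * ((X -> 'rV[R]_d) * (X -> R)))%type.

Definition continuous_triple (v : triple) :=
  [/\ continuous v.1, continuous v.2.1 & continuous v.2.2].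

Definition admissible (v : triple) := continuous_triple v /\
  forall p, below_legendre (v.1 p + sqnorm (v.2.1 p) / 2) (v.2.2 p).

Lemma continuous_tripleD u v : continuous_triple u -> continuous_triple v ->
  continuous_triple (u + v).
Proof.
move=> [u1 u2 u3] [v1 v2 v3]; split => p; apply: cvgD.
all: [> exact: u1|exact: v1|exact: u2|exact: v2|exact: u3|exact: v3].
Qed.

Lemma continuous_tripleZ t u : continuous_triple u -> continuous_triple (t *: u).
Proof.
move=> [u1 u2 u3]; split => p; apply: cvgZl_tmp.
all: [> exact: u1|exact: u2|exact: u3].
Qed.

(** Convexity in homogeneous form, which makes the multiples of admissible triples
    a convex cone. *)
Lemma admissible_cone (u v : triple) (s t : R) : admissible u -> admissible v ->
  0 <= s -> 0 <= t ->
  exists2 w, admissible w & s *: u + t *: v = (s + t) *: w.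
Proof.
move=> [cu Ku] [cv Kv] s0 t0.
have [st0|st0] := eqVneq (s + t) 0.
  exists u; first by split.
  have /andP[/eqP -> /eqP ->] : (s == 0) && (t == 0) by rewrite -paddr_eq0// st0.
  by rewrite addr0 !scale0r addr0.
have st : 0 < s + t by rewrite lt_neqAle eq_sym st0 addr_ge0.
pose q := s / (s + t).
have tq : t / (s + t) = 1 - q by rewrite -[X in X - _](divff st0) -mulrBl addrAC subrr add0r.
have q01 : 0 <= q <= 1.
  by rewrite divr_ge0 ?addr_ge0//= ler_pdivrMr// mul1r lerDl.
exists (q *: u + (1 - q) *: v); last first.
  by rewrite scalerDr !scalerA -tq ![(s + t) * _]mulrC !divfK.
split; first by apply: continuous_tripleD; exact: continuous_tripleZ.
move=> p r Pr.
rewrite -[X in sqnorm X]/(q *: u.2.1 p + (1 - q) *: v.2.1 p).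
rewrite -[X in X + _ / 2]/(q * u.1 p + (1 - q) * v.1 p).
rewrite -[X in r * X]/(q * u.2.2 p + (1 - q) * v.2.2 p).
have sq := sqnorm_convex (u.2.1 p) (v.2.1 p) q01.
have /andP[q0 q1] := q01.
have : q * (u.1 p + sqnorm (u.2.1 p) / 2 + r * u.2.2 p) <= q * fine (Psi r).
  by rewrite ler_wpM2l//; exact: Ku.
have : (1 - q) * (v.1 p + sqnorm (v.2.1 p) / 2 + r * v.2.2 p) <= (1 - q) * fine (Psi r).
  by rewrite ler_wpM2l ?subr_ge0//; exact: Kv.
move: sq; set A1 := sqnorm (_ + _); set A2 := sqnorm _; set A3 := sqnorm _.
nra.
Qed.

End triples.
End constraint.

(** * The operator dual to the continuity equation *)

Lemma continuous_row (R : realType) (d : nat) (X : topologicalType) (b : X -> 'rV[R]_d) :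
  (forall i, continuous (fun x => b x 0 i)) -> continuous b.
Proof.
move=> cb x; apply/cvgrPdist_lt => e e0.
have : \forall y \near x, forall i, `|b x 0 i - b y 0 i| < e.
  apply: filter_forall => i; have /cvgrPdist_lt := cb i x; exact.
apply: filterS => y by_; rewrite [ltLHS](mx_normrE _).
by apply/bigmax_ltP; split => // -[i j] _ /=; rewrite !mxE ord1; exact: by_.
Qed.

Section continuity_equation.
Context {R : realType} {d : nat}.
Local Notation E := (R * 'rV[R]_d)%type.
Local Notation X := (cylinder R d).
Local Notation cyl_charge := ({charge set (borel X) -> \bar R})%R.
Local Notation torus_measure := ({finite_measure set (borel (torus R d)) -> \bar R})%R.
Implicit Types (f g phi psi : E -> R).
Variable nu : R.

Definition continuity_operator phi : @triple R X d :=
  (fun p => dt phi (cyl_lift p) + nu / 2 * laplacian phi (cyl_lift p),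
   (fun p => grad phi (cyl_lift p), fun p => phi (cyl_lift p))).

Definition pairing (rho : cyl_charge) (m : 'I_d -> cyl_charge) (zeta : cyl_charge)
    (v : @triple R X d) : R :=
  charge_integral rho v.1 + \sum_i charge_integral (m i) (fun p => v.2.1 p 0 i) +
  charge_integral zeta v.2.2.

Lemma continuous_lift k f : Ck_torus k f -> continuous (fun p : X => f (cyl_lift p)).
Proof.
by move=> Cf; apply: continuous_descend; [exact: Ck_torus_continuous Cf|case: Cf].
Qed.

Lemma Ck_torus_laplacian phi : Ck_torus 2 phi -> Ck_torus 0 (laplacian phi).
Proof.
move=> Cphi; have Cxx i : Ck_torus 0 (dx i (dx i phi)).
  by apply: Ck_torus_derive; exact: Ck_torus_derive.
split; first by apply: (@Ck_sum _ _ _ _ 0) => i; case: (Cxx i).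
move=> t x y xy; apply: eq_bigr => i _; have [_ pxx] := Cxx i.
exact: (pxx t x y xy).
Qed.

Lemma continuous_operator phi : Ck_torus 2 phi ->
  continuous_triple (continuity_operator phi).
Proof.
move=> Cphi; split => /=.
- apply: (@continuous_lift 0 (fun z => dt phi z + nu / 2 * laplacian phi z)).
  apply: Ck_torus_add; first by apply: Ck_torusW; exact: Ck_torus_derive.
  by apply: Ck_torus_scale; exact: Ck_torus_laplacian.
- apply: continuous_row => i.
  have -> : (fun p : X => grad phi (cyl_lift p) 0 i) = fun p => dx i phi (cyl_lift p).
    by apply/funext => p; rewrite mxE.
  by apply: (@continuous_lift 1); exact: Ck_torus_derive.
- exact: continuous_lift Cphi.
Qed.

Lemma continuity_operatorD phi psi : Ck_torus 2 phi -> Ck_torus 2 psi ->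
  continuity_operator (fun z => phi z + psi z) =
  continuity_operator phi + continuity_operator psi.
Proof.
move=> [Cphi _] [Cpsi _]; congr pair; last congr pair; apply/funext => p.
- rewrite -[RHS]/(dt phi (cyl_lift p) + nu / 2 * laplacian phi (cyl_lift p) +
    (dt psi (cyl_lift p) + nu / 2 * laplacian psi (cyl_lift p))).
  have dtD : dt (fun z => phi z + psi z) (cyl_lift p) =
      dt phi (cyl_lift p) + dt psi (cyl_lift p) by exact: deriveD_Ck Cphi Cpsi.
  by rewrite dtD (laplacianD _ Cphi Cpsi) mulrDr addrACA.
- by apply/rowP => i; rewrite !mxE /dx (@deriveD_Ck _ _ 1).
Qed.

Lemma continuity_operatorZ a phi : Ck_torus 2 phi ->
  continuity_operator (fun z => a * phi z) = a *: continuity_operator phi.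
Proof.
move=> [Cphi _]; congr pair; last congr pair; apply/funext => p.
- rewrite -[RHS]/(a * (dt phi (cyl_lift p) + nu / 2 * laplacian phi (cyl_lift p))).
  by rewrite laplacianZ// /dt (@deriveZ_Ck _ _ 1)//; ring.
- by apply/rowP => i; rewrite !mxE /dx (@deriveZ_Ck _ _ 1).
Qed.

Lemma subsolution_admissible (Psi : R -> \bar R) phi :
  (forall r, (0 <= Psi r)%E) -> Ck_torus 2 phi ->
  subsolution nu Psi phi <-> admissible Psi (continuity_operator phi).
Proof.
move=> Psi0 Cphi; split=> [sub|[_ adm] p].
  split; first exact: continuous_operator.
  move=> p; apply/below_legendreP => //=; have := sub p.
  by rewrite /= addrAC.
by rewrite /= addrAC; apply/below_legendreP => //; exact: adm.
Qed.

Lemma energy_pairing (Psi : R -> \bar R) rho m zeta v :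
  (forall r, (0 <= Psi r)%E) -> admissible Psi v ->
  ((pairing rho m zeta v)%:E <= energy Psi rho m zeta)%E.
Proof.
move=> Psi0 [[v1 v2 v3] adm]; apply: ereal_sup_ubound.
exists v.1, v.2.1, v.2.2; split => //; split => // p.
by apply/below_legendreP => //; exact: adm.
Qed.

Lemma energy_le (Psi : R -> \bar R) rho m zeta (D : R) :
  (forall r, (0 <= Psi r)%E) ->
  (forall v, admissible Psi v -> pairing rho m zeta v <= D) ->
  (energy Psi rho m zeta <= D%:E)%E.
Proof.
move=> Psi0 le; apply: ge_ereal_sup => _ [a [b [c [[ca cb cc adm] ->]]]].
rewrite lee_fin; apply: (le (a, (b, c))); split => // p.
by apply/below_legendreP => //; exact: adm.
Qed.

Section boundary.
Variables rho0 rho1 : torus_measure.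

Lemma continuous_slice k phi t : Ck_torus k phi ->
  continuous (fun x : torus R d => phi (t, repr x)).
Proof.
move=> Cphi; apply: (@continuous_torus_descend _ _ _ (fun x => phi (t, x))); last first.
  by case: Cphi => _ pphi x y; exact: pphi.
move=> x; apply: (@continuous_comp _ _ _ (fun x => (t, x)) phi).
  apply: (@cvg_pair _ _ _ (nbhs x) (nbhs t) (nbhs x) _ _ _ (fun=> t) id).
    exact: cvg_cst.
  exact: cvg_id.
exact: (Ck_torus_continuous Cphi).
Qed.

Lemma boundary_termD k phi psi : Ck_torus k phi -> Ck_torus k psi ->
  boundary_term rho0 rho1 (fun z => phi z + psi z) =
  boundary_term rho0 rho1 phi + boundary_term rho0 rho1 psi.
Proof.
move=> Cphi Cpsi; rewrite /boundary_term.
have c t f : Ck_torus k f -> continuous (fun x : torus R d => f (t, repr x)).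
  exact: continuous_slice.
rewrite (Rintegral_add compact_torus rho1 (c 1 _ Cphi) (c 1 _ Cpsi)).
rewrite (Rintegral_add compact_torus rho0 (c 0 _ Cphi) (c 0 _ Cpsi)).
by rewrite opprD addrACA.
Qed.

Lemma boundary_termZ k a phi : Ck_torus k phi ->
  boundary_term rho0 rho1 (fun z => a * phi z) = a * boundary_term rho0 rho1 phi.
Proof.
move=> Cphi; rewrite /boundary_term.
have c t : continuous (fun x : torus R d => phi (t, repr x)) by exact: continuous_slice Cphi.
rewrite (Rintegral_scale compact_torus rho1 a (c 1)).
by rewrite (Rintegral_scale compact_torus rho0 a (c 0)) mulrBr.
Qed.

Lemma boundary_term_bounded : exists2 C, 0 < C & forall k phi B, Ck_torus k phi ->
  (forall z, 0 <= z.1 <= 1 -> `|phi z| <= B) -> `|boundary_term rho0 rho1 phi| <= B * C.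
Proof.
pose C0 := fine (rho0 setT); pose C1 := fine (rho1 setT).
have C00 : 0 <= C0 by exact: fine_ge0.
have C10 : 0 <= C1 by exact: fine_ge0.
exists (C1 + C0 + 1); first by rewrite ltr_wpDl// addr_ge0.
move=> k phi B Cphi phiB.
have B0 : 0 <= B by rewrite (le_trans _ (phiB (0, 0) _))//= lexx ler01.
rewrite (le_trans (ler_normB _ _))// !mulrDr mulr1 ler_wpDr// lerD//.
  by apply: (normr_Rintegral_le compact_torus) => [|x]; [exact: continuous_slice Cphi|apply: phiB; rewrite /= ler01 lexx].
by apply: (normr_Rintegral_le compact_torus) => [|x]; [exact: continuous_slice Cphi|apply: phiB; rewrite /= lexx ler01].
Qed.

End boundary.
End continuity_equation.

(** * Weak duality *)

Section duality.
Context {R : realType} {d : nat}.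
Local Notation E := (R * 'rV[R]_d)%type.
Local Notation X := (cylinder R d).
Local Notation triple := (@triple R X d).
Local Notation cyl_charge := ({charge set (borel X) -> \bar R})%R.
Local Notation torus_measure := ({finite_measure set (borel (torus R d)) -> \bar R})%R.
Implicit Types (f g phi psi : E -> R) (u v : triple).
Variable nu : R.
Variables rho0 rho1 : torus_measure.

Local Notation L := (continuity_operator nu).
Local Notation B := (boundary_term rho0 rho1).

Definition triple_le (v : triple) (C : R) := forall p,
  [/\ `|v.1 p| <= C, forall i, `|v.2.1 p 0 i| <= C & `|v.2.2 p| <= C].

Lemma continuous_component (b : X -> 'rV[R]_d) i :
  continuous b -> continuous (fun p => b p 0 i).
Proof.
move=> cb p; apply: (@continuous_comp _ _ _ b (fun x : 'rV[R]_d => x 0 i)).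
  exact: cb.
exact: coord_continuous.
Qed.

Section pairing.
Variables (rho : cyl_charge) (m : 'I_d -> cyl_charge) (zeta : cyl_charge).
Local Notation pairing := (pairing rho m zeta).

Lemma pairingD u v : continuous_triple u -> continuous_triple v ->
  pairing (u + v) = pairing u + pairing v.
Proof.
move=> [u1 u2 u3] [v1 v2 v3]; rewrite /pairing.
rewrite (charge_integralD compact_cylinder rho u1 v1).
rewrite (charge_integralD compact_cylinder zeta u3 v3).
have -> : \sum_i charge_integral (m i) (fun p => (u + v).2.1 p 0 i) =
    \sum_i charge_integral (m i) (fun p => u.2.1 p 0 i) +
    \sum_i charge_integral (m i) (fun p => v.2.1 p 0 i).
  rewrite -big_split; apply: eq_bigr => i _ /=.
  rewrite -(charge_integralD compact_cylinder (m i)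
    (continuous_component (i := i) u2) (continuous_component (i := i) v2)).
  by congr (charge_integral _ _); apply/funext => p; rewrite /= mxE.
by ring.
Qed.

Lemma pairingZ a v : continuous_triple v -> pairing (a *: v) = a * pairing v.
Proof.
move=> [v1 v2 v3]; rewrite /pairing.
rewrite (charge_integralZ compact_cylinder rho a v1).
rewrite (charge_integralZ compact_cylinder zeta a v3) !mulrDr mulr_sumr.
congr (_ + _ + _); apply: eq_bigr => i _ /=.
rewrite -(charge_integralZ compact_cylinder (m i) a (continuous_component (i := i) v2)).
by congr (charge_integral _ _); apply/funext => p; rewrite /= mxE.
Qed.

Lemma pairing_bounded : exists2 C, 0 < C & forall v b, continuous_triple v ->
  triple_le v b -> `|pairing v| <= b * C.
Proof.
have [Ca Ca0 CaP] := charge_integral_bounded compact_cylinder rho.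
have [Cc Cc0 CcP] := charge_integral_bounded compact_cylinder zeta.
have /choice[Cb CbP] : forall i, exists C : R, 0 < C /\ forall (h : X -> R) (b : R),
    continuous h -> (forall x, `|h x| <= b) -> `|charge_integral (m i) h| <= b * C.
  by move=> i; have [C] := charge_integral_bounded compact_cylinder (m i); exists C.
have sCb0 : 0 <= \sum_i Cb i by apply: sumr_ge0 => i _; rewrite ltW// (CbP i).1.
exists (Ca + \sum_i Cb i + Cc).
  by rewrite addr_gt0// ltr_wpDr.
move=> v b [v1 v2 v3] vb; rewrite /pairing !mulrDr.
rewrite (le_trans (ler_normD _ _))// lerD//; last first.
  by apply: CcP => // p; case: (vb p).
rewrite (le_trans (ler_normD _ _))// lerD//; first by apply: CaP => // p; case: (vb p).
rewrite (le_trans (ler_norm_sum _ _ _))// mulr_sumr ler_sum// => i _.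
apply: (CbP i).2; first exact: continuous_component.
by move=> p; case: (vb p).
Qed.

(** Both sides are continuous in [phi] for the seminorms in which smooth functions
    are dense: besides [phi] and its gradient, only the time derivative and the pure
    second derivatives in space occur in [L]. *)
Lemma continuity_equation_C2 phi : continuity_equation nu rho0 rho1 rho m zeta ->
  Ck_torus 2 phi -> pairing (L phi) = B phi.
Proof.
move=> ce Cphi; have [C C0 CP] := pairing_bounded.
have [C' C'0 C'P] := @boundary_term_bounded R d rho0 rho1.
pose K := (1 + `|nu / 2| * d%:R) * C + C'.
have K0 : 0 < K.
  by rewrite addr_gt0// mulr_gt0// ltr_pwDl// mulr_ge0.
apply/eqP; rewrite -subr_eq0 -normr_le0; apply/ler_addgt0Pr => e e0; rewrite add0r.
have eK : 0 < e / K by rewrite divr_gt0.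
have [psi spsi psiP] := smooth_torus_dense Cphi eK.
have Cpsi := spsi 2%N.
have cepsi : pairing (L psi) = B psi by exact: ce.
have CNphi : Ck_torus 2 (fun z => -1 * phi z) by exact: Ck_torus_scale.
pose chi z := psi z + -1 * phi z.
have Cchi : Ck_torus 2 chi by exact: Ck_torus_add.
have pairchi : pairing (L chi) = pairing (L psi) - pairing (L phi).
  rewrite continuity_operatorD// continuity_operatorZ// pairingD; last 2 first.
  - exact: continuous_operator.
  - by apply: continuous_tripleZ; exact: continuous_operator.
  by rewrite pairingZ ?mulN1r//; exact: continuous_operator.
have Bchi : B chi = B psi - B phi.
  by rewrite (boundary_termD _ _ Cpsi CNphi) (boundary_termZ _ _ _ Cphi) mulN1r.
have -> : pairing (L phi) - B phi = B chi - pairing (L chi).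
  by rewrite pairchi Bchi cepsi; ring.
have -> : e = e / K * C' + e / K * (1 + `|nu / 2| * d%:R) * C.
  have -> : e / K * C' + e / K * (1 + `|nu / 2| * d%:R) * C = e / K * K.
    by rewrite /K; ring.
  by rewrite divfK ?gt_eqF.
rewrite (le_trans (ler_normB _ _))// lerD//.
  apply: (C'P _ _ _ Cchi) => z z01; have [+ _ _ _] := psiP z z01.
  by rewrite /chi mulN1r.
apply: CP; first exact: continuous_operator.
move=> p; pose z : E := cyl_lift p.
have [p_psi p_t p_x p_xx] := psiP z (unit_interval_itv _).
have [Cphi2 _] := Cphi; have [Cpsi2 _] := Cpsi; have [CNphi2 _] := CNphi.
have e1 : e / K <= e / K * (1 + `|nu / 2| * d%:R).
  by apply: ler_peMr; [exact: ltW|rewrite lerDl mulr_ge0].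
split => /= [|i|]; rewrite -/z.
- have -> : dt chi z + nu / 2 * laplacian chi z =
      (dt psi z - dt phi z) + nu / 2 * (laplacian psi z - laplacian phi z).
    have -> : dt chi z = dt psi z - dt phi z.
      rewrite -[dt phi z]mul1r -mulNr.
      by rewrite -[-1 * _](deriveZ_Ck (-1) z _ Cphi2); exact: deriveD_Ck Cpsi2 CNphi2.
    have -> // : laplacian chi z = laplacian psi z - laplacian phi z.
    by rewrite /chi (laplacianD _ Cpsi2 CNphi2) (laplacianZ _ _ Cphi2) mulN1r.
  apply: (le_trans (ler_normD _ _)); rewrite [leRHS]mulrDr mulr1; apply: lerD => //.
  rewrite normrM mulrCA; apply: ler_wpM2l => //.
  rewrite /laplacian -sumrB (le_trans (ler_norm_sum _ _ _))//.
  apply: (@le_trans _ _ (\sum_(i < d) (e / K))); first by apply: ler_sum => i _; exact: p_xx.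
  by rewrite sumr_const card_ord mulr_natr.
- rewrite mxE /chi /dx (@deriveD_Ck _ _ 1)// (@deriveZ_Ck _ _ 1)// mulN1r.
  exact: le_trans (p_x i) e1.
- by rewrite /chi mulN1r (le_trans p_psi).
Qed.

End pairing.

Variable Psi : R -> \bar R.
Hypothesis Psi_ge0 : forall r, (0 <= Psi r)%E.

Lemma weak_duality rho m zeta phi : continuity_equation nu rho0 rho1 rho m zeta ->
  Ck_torus 2 phi -> subsolution nu Psi phi ->
  ((B phi)%:E <= energy Psi rho m zeta)%E.
Proof.
move=> ce Cphi sub; rewrite -(continuity_equation_C2 ce Cphi).
by apply: energy_pairing => //; apply/subsolution_admissible.
Qed.

End duality.

(** * Strong duality *)

Section strong_duality.
Context {R : realType} {d : nat}.
Local Notation E := (R * 'rV[R]_d)%type.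
Local Notation X := (cylinder R d).
Local Notation triple := (@triple R X d).
Local Notation cyl_charge := ({charge set (borel X) -> \bar R})%R.
Local Notation torus_measure := ({finite_measure set (borel (torus R d)) -> \bar R})%R.
Implicit Types (f g phi psi : E -> R) (u v : triple).
Variable nu : R.
Variables rho0 rho1 : torus_measure.

Local Notation L := (continuity_operator nu).
Local Notation B := (boundary_term rho0 rho1).

Variable Psi : R -> \bar R.
Hypothesis Psi_ge0 : forall r, (0 <= Psi r)%E.
Variable s0 : R.
Hypothesis s0_gt0 : 0 < s0.
Hypothesis legendre_fin : legendre Psi (- s0) \is a fin_num.

(** A Slater point, [phi = - k * expR (l * t)]: a ball around [L phi] consists of
    admissible triples. Indeed [phi] stays in [[- s0, 0]], where by convexity
    [legendre Psi c] is at most [M / s0 * - c]; for [l] large this is beaten by the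
    time derivative [l * phi], with a margin proportional to [k]. *)
Lemma slater : exists2 phi : E -> R, smooth_torus phi &
  exists2 e, 0 < e & forall v, continuous_triple v -> triple_le v 1 ->
    admissible Psi (L phi + e *: v).
Proof.
pose M : R := `|fine (legendre Psi (- s0))|.
have M0 : 0 <= M by exact: normr_ge0.
have MP r : (Psi r < +oo)%E -> - s0 * r - fine (Psi r) <= M.
  move=> Pr; apply: le_trans (ler_norm _).
  have Pfin : Psi r \is a fin_num by rewrite ge0_fin_numE.
  rewrite -lee_fin fineK// EFinB fineK//.
  by apply: ereal_sup_ubound; exists r => //; rewrite mulrC.
have Mline r c : (Psi r < +oo)%E -> - s0 <= c <= 0 ->
    r * c - fine (Psi r) <= M / s0 * - c.
  move=> Pr /andP[sc c0]; pose t := - c / s0.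
  have t0 : 0 <= t by rewrite divr_ge0 ?oppr_ge0// ltW.
  have t1 : t <= 1 by rewrite ler_pdivrMr// mul1r lerNl.
  have cE : c = - (t * s0) by rewrite /t divfK ?gt_eqF// opprK.
  have -> : M / s0 * - c = t * M by rewrite /t; field; rewrite gt_eqF.
  have P0 : 0 <= fine (Psi r) by exact: fine_ge0.
  have : t * (- s0 * r - fine (Psi r)) <= t * M by rewrite ler_wpM2l// MP.
  have : 0 <= (1 - t) * fine (Psi r) by rewrite mulr_ge0// subr_ge0.
  by rewrite cE; nra.
(* One unit above the slope [M / s0] leaves the margin [k] for the perturbation. *)
pose l : R := M / s0 + 1.
have Ms0 : 0 <= M / s0 by rewrite divr_ge0// ltW.
have l0 : 0 < l by rewrite ltr_wpDl.
(* Half of [s0], so that the perturbed values of [phi] still lie above [- s0]. *)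
pose k : R := s0 / 2 / expR l.
have k0 : 0 < k by rewrite !divr_gt0// expR_gt0.
pose phi (z : E) : R := - k * expR (l * z.1).
have sphi : smooth_torus phi.
  by apply: smooth_torus_scale; exact: smooth_torus_exp_time.
have Cexp : Ck_torus 2 (fun z : E => expR (l * z.1)) by exact: smooth_torus_exp_time.
have Dphi (z h : E) : 'D_h phi z = l * h.1 * phi z.
  rewrite /phi (@deriveZ_Ck _ _ 1); last exact: Cexp.1.
  have := (derive_comp_real h (is_derive_expR (l * z.1)) (differentiable_time l z)).2.
  by rewrite /comp => ->; rewrite derive_time; ring.
have dxphi i : dx i phi = fun=> 0.
  by apply/funext => y; rewrite /dx Dphi/= mulr0 mul0r.
have lapphi z : laplacian phi z = 0.
  rewrite /laplacian big1// => i _; rewrite dxphi.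
  exact: derive_cst.
pose e : R := k / (k + 1 + d%:R + M / s0).
have den0 : 0 < k + 1 + d%:R + M / s0.
  by rewrite ltr_pwDl// ltr_pwDl// ltr_wpDr.
have e0 : 0 < e by rewrite divr_gt0.
have eden : e * (k + 1 + d%:R + M / s0) = k by rewrite divfK ?gt_eqF.
have e1 : e <= 1.
  rewrite ler_pdivrMr// mul1r -!addrA lerDl.
  by rewrite !addr_ge0.
have d0 : 0 <= d%:R :> R by [].
have ek : e <= k by nra.
have ebound : e * (1 + d%:R / 2 + M / s0) <= k by nra.
exists phi => //; exists e => // v cv v1; split.
  apply: continuous_tripleD; last exact: continuous_tripleZ.
  exact: continuous_operator.
move=> p r Pr; have [va vb vc] := v1 p.
pose z : E := cyl_lift p; pose w : R := k * expR (l * z.1).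
have /andP[z0 z1] : 0 <= z.1 <= 1 by exact: unit_interval_itv.
have kw : k <= w.
  apply: ler_peMr; first exact: ltW.
  by rewrite -expR0 ler_expR mulr_ge0// ltW.
have ws : w <= s0 / 2.
  rewrite /w /k mulrAC ler_pdivrMr ?expR_gt0//; apply: ler_wpM2l.
    by rewrite divr_ge0// ltW.
  by rewrite ler_expR; apply: ler_piMr => //; exact: ltW.
rewrite -[X in X + _ / 2]/(dt phi z + nu / 2 * laplacian phi z + e * v.1 p).
rewrite -[X in r * X]/(phi z + e * v.2.2 p).
have -> : sqnorm ((L phi + e *: v).2.1 p) = e ^+ 2 * sqnorm (v.2.1 p).
  rewrite /sqnorm mulr_sumr; apply: eq_bigr => i _.
  have -> : (L phi + e *: v).2.1 p 0 i = e * v.2.1 p 0 i.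
    rewrite -[LHS]/((grad phi z + e *: v.2.1 p) 0 i) !mxE dxphi.
    by rewrite add0r.
  by rewrite exprMn.
have sqv : sqnorm (v.2.1 p) <= d%:R.
  apply: (@le_trans _ _ (\sum_(i < d) 1)); last by rewrite sumr_const card_ord.
  apply: ler_sum => i _; rewrite -[_ ^+ 2]ger0_norm ?sqr_ge0// normrX.
  by rewrite exprn_ile1.
have sqv0 := sqnorm_ge0 (v.2.1 p).
have dtphi : dt phi z = - (l * w).
  by rewrite /dt Dphi /phi /w/=; ring.
rewrite dtphi lapphi mulr0 addr0.
move: va vc; rewrite !ler_norml => /andP[va1 va2] /andP[vc1 vc2].
have phiE : phi z = - w by rewrite /phi mulNr.
have c_itv : - s0 <= phi z + e * v.2.2 p <= 0.
  by rewrite phiE; apply/andP; split; nra.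
have := Mline r _ Pr c_itv; rewrite phiE.
have e2 : e ^+ 2 * sqnorm (v.2.1 p) <= e * d%:R.
  rewrite expr2 -mulrA; apply: ler_wpM2l; first exact: ltW.
  by rewrite (le_trans _ sqv)// ler_piMl.
have lw : l * w = M / s0 * w + w by rewrite /l mulrDl mul1r.
have mvc : M / s0 * (- (- w + e * v.2.2 p)) <= M / s0 * (w + e).
  rewrite ler_wpM2l//; nra.
have eva : e * v.1 p <= e by apply: ler_piMr => //; exact: ltW.
move: ebound; rewrite lw; move: mvc; rewrite !mulrDr; lra.
Qed.


Lemma triple_riesz (l : triple -> R) (C : R) :
  (forall u v, continuous_triple u -> continuous_triple v -> l (u + v) = l u + l v) ->
  (forall t v, continuous_triple v -> l (t *: v) = t * l v) ->
  (forall v, continuous_triple v -> triple_le v 1 -> l v <= C) ->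
  exists (rho : cyl_charge) (m : 'I_d -> cyl_charge) (zeta : cyl_charge),
    forall v, continuous_triple v -> pairing rho m zeta v = l v.
Proof.
move=> lD lZ lC.
have c0 : continuous (0 : X -> R) by exact: continuous_const.
have cb0 : continuous (0 : X -> 'rV[R]_d) by move=> p; exact: cvg_cst.
pose ia (h : X -> R) : triple := (h, (0, 0)).
pose ib i (h : X -> R) : triple := (0, (fun p => h p *: delta_mx 0 i, 0)).
pose ic (h : X -> R) : triple := (0, (0, h)).
have cia h : continuous h -> continuous_triple (ia h) by [].
have cib i h : continuous h -> continuous_triple (ib i h).
  by move=> ch; split => //= p; apply: cvgZr_tmp; exact: ch.
have cic h : continuous h -> continuous_triple (ic h) by [].
have [rho rhoP] : exists rho : cyl_charge, forall h : X -> R, continuous h ->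
    charge_integral rho h = l (ia h).
  apply: (@riesz_signed R X compact_cylinder cylinder_cozero _ C) => [h h' ch ch'|a h ch|h ch h1].
  - rewrite -lD; [|exact: cia|exact: cia].
    by congr l; rewrite /ia; congr (_, (_, _)); rewrite addr0.
  - rewrite -lZ; last exact: cia.
    by congr l; rewrite /ia; congr (_, (_, _)); rewrite scaler0.
  - apply: lC; first exact: cia.
    by move=> p; split => [|i|] /=; rewrite ?mxE ?normr0.
have [zeta zetaP] : exists zeta : cyl_charge, forall h : X -> R, continuous h ->
    charge_integral zeta h = l (ic h).
  apply: (@riesz_signed R X compact_cylinder cylinder_cozero _ C) => [h h' ch ch'|a h ch|h ch h1].
  - rewrite -lD; [|exact: cic|exact: cic].
    by congr l; rewrite /ic; congr (_, (_, _)); rewrite addr0.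
  - rewrite -lZ; last exact: cic.
    by congr l; rewrite /ic; congr (_, (_, _)); rewrite scaler0.
  - apply: lC; first exact: cic.
    by move=> p; split => [|i|] /=; rewrite ?mxE ?normr0.
have /choice[m mP] : forall i, exists m : cyl_charge, forall h : X -> R, continuous h ->
    charge_integral m h = l (ib i h).
  move=> i.
  apply: (@riesz_signed R X compact_cylinder cylinder_cozero _ C) => [h h' ch ch'|a h ch|h ch h1].
  - rewrite -lD; [|exact: cib|exact: cib].
    congr l; rewrite /ib; congr (_, (_, _)); rewrite ?addr0//.
    by apply/funext => p; exact: scalerDl.
  - rewrite -lZ; last exact: cib.
    congr l; rewrite /ib; congr (_, (_, _)); rewrite ?scaler0//.
    by apply/funext => p; rewrite /= -scalerA.
  - apply: lC; first exact: cib.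
    move=> p; split => [|j|] /=; rewrite ?normr0//.
    rewrite !mxE eqxx/=; case: eqP => _; rewrite ?mulr1 ?mulr0 ?normr0//.
exists rho, m, zeta => v [v1 v2 v3].
have cv2 i : continuous (fun p => v.2.1 p 0 i) by exact: continuous_component.
rewrite /pairing rhoP// zetaP//.
under eq_bigr do rewrite mP//.
have lsum (s : seq 'I_d) :
    continuous_triple (\sum_(i <- s) ib i (fun p => v.2.1 p 0 i)) /\
    l (\sum_(i <- s) ib i (fun p => v.2.1 p 0 i)) =
    \sum_(i <- s) l (ib i (fun p => v.2.1 p 0 i)).
  elim: s => [|i s [IHc IHl]].
    rewrite !big_nil; split; first by split.
    by rewrite -(scale0r (0 : triple)) lZ ?mul0r.
  rewrite !big_cons; split; first by apply: continuous_tripleD => //; exact: cib.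
  by rewrite lD ?IHl//; exact: cib.
have [csum <-] := lsum (index_enum 'I_d).
rewrite -lD; [|exact: cia|by []].
rewrite -lD; [|by apply: continuous_tripleD => //; exact: cia|exact: cic].
congr l.
have -> : \sum_i ib i (fun p => v.2.1 p 0 i) = (0, (v.2.1, 0)).
  transitivity ((0, (fun p => \sum_i v.2.1 p 0 i *: delta_mx 0 i, 0)) : triple).
    elim: (index_enum 'I_d) => [|i s IHs].
      by rewrite big_nil; congr (_, (_, _)); apply/funext => p; rewrite big_nil.
    rewrite big_cons IHs; congr (_, (_, _)); rewrite ?addr0//.
    by apply/funext => p; rewrite big_cons.
  by congr (_, (_, _)); apply/funext => p; rewrite -row_sum_delta.
case: v {v1 v2 v3 cv2 lsum csum} => [a [b c]].
by congr (_, (_, _)); rewrite /= ?addr0 ?add0r.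
Qed.

Lemma boundary_term_lift0 phi : (forall p : X, phi (cyl_lift p) = 0) -> B phi = 0.
Proof.
move=> phi0; have slice0 (t : R) : 0 <= t <= 1 -> forall x : torus R d, phi (t, repr x) = 0.
  move=> t01 x; rewrite -(phi0 (SigSub (mem_set t01 : t \in `[0, 1]%classic), x)).
  by [].
rewrite /boundary_term.
have -> : (fun x : torus R d => phi (1, repr x)) = cst 0.
  by apply/funext => x; apply: slice0; rewrite ler01 lexx.
have -> : (fun x : torus R d => phi (0, repr x)) = cst 0.
  by apply/funext => x; apply: slice0; rewrite ler01 lexx.
by rewrite !Rintegral_cst//= !mul0r subrr.
Qed.

Lemma admissible0 : admissible Psi (0 : triple).
Proof.
split; first by split => // p; exact: cvg_cst.
move=> p r Pr; rewrite /= mulr0 addr0 add0r /sqnorm big1 ?mul0r ?fine_ge0//.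
by move=> i _; rewrite mxE expr0n.
Qed.

(** Separation of the cone generated by the admissible triples at height [D] from
    the space of the triples [L phi] at height [B phi]. That they do not cross is
    the bound [B phi <= D] on subsolutions; the Slater point lets the sum of the two
    sets cover every continuous triple, and bounds the separating functional. *)
Lemma strong_duality (D : R) :
  (forall phi, Ck_torus 2 phi -> subsolution nu Psi phi -> B phi <= D) ->
  exists rho m zeta, continuity_equation nu rho0 rho1 rho m zeta /\
    (energy Psi rho m zeta <= D%:E)%E.
Proof.
move=> dual_le; have [phi0 sphi0 [e e0 phi0P]] := slater.
have BD phi psi : smooth_torus phi -> smooth_torus psi ->
    B (fun z => phi z + psi z) = B phi + B psi.
  by move=> sphi spsi; exact: (boundary_termD _ _ (sphi 0%N) (spsi 0%N)).
have BZ a phi : smooth_torus phi -> B (fun z => a * phi z) = a * B phi.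
  by move=> sphi; exact: (boundary_termZ _ _ _ (sphi 0%N)).
have LD phi psi : smooth_torus phi -> smooth_torus psi ->
    L (fun z => phi z + psi z) = L phi + L psi.
  by move=> sphi spsi; exact: continuity_operatorD.
have LZ a phi : smooth_torus phi -> L (fun z => a * phi z) = a *: L phi.
  by move=> sphi; exact: continuity_operatorZ.
pose zero : E -> R := fun=> 0.
have szero : smooth_torus zero by exact: smooth_torus_cst.
have zeroE : zero = fun z => 0 * zero z by apply/funext => z; rewrite mul0r.
have L0 : L zero = 0 by rewrite zeroE LZ// scale0r.
have B0 : B zero = 0 by rewrite zeroE BZ// mul0r.
pose Q (vr : triple * R) := exists lam k phi, [/\ 0 <= lam, admissible Psi k,
  smooth_torus phi & vr.1 = lam *: k + L phi /\ lam * D + B phi <= vr.2].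
have [] := @cone_separation R triple continuous_triple Q.
- exact: continuous_tripleD.
- exact: continuous_tripleZ.
- move=> w1 w2 c1 c2 [lam1 [k1 [phi1 [l1 ak1 sphi1 [/= -> le1]]]]].
  move=> [lam2 [k2 [phi2 [l2 ak2 sphi2 [/= -> le2]]]]].
  have [k ak kE] := admissible_cone ak1 ak2 l1 l2.
  exists (lam1 + lam2), k, (fun z => phi1 z + phi2 z); split => //=.
  + exact: addr_ge0.
  + exact: smooth_torus_add.
  + by rewrite LD// BD// -kE addrACA; split => //; rewrite mulrDl addrACA lerD.
- move=> t w c t0 [lam [k [phi [l0 ak sphi [/= -> le]]]]].
  exists (t * lam), k, (fun z => t * phi z); split => //=.
  + exact: mulr_ge0.
  + exact: smooth_torus_scale.
  + split; first by rewrite (LZ t phi sphi) [LHS]scalerDr [in LHS]scalerA.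
    by rewrite (BZ t phi sphi) -[t * lam * D]mulrA -[leLHS]mulrDr; apply: ler_wpM2l.
- move=> c [lam [k [phi [+ ak sphi [/= kE le]]]]].
  rewrite le_eqVlt => /predU1P[lam0|lam0].
    move: kE le; rewrite -lam0 scale0r add0r mul0r add0r => Lphi.
    rewrite (@boundary_term_lift0 phi)// => p.
    by have := congr1 (fun v : triple => v.2.2 p) Lphi.
  have sk : smooth_torus (fun z => - lam^-1 * phi z) by exact: smooth_torus_scale.
  (* [lam *: k + L phi = 0] says that [- phi / lam] is a subsolution. *)
  have kL : k = L (fun z => - lam^-1 * phi z).
    rewrite LZ//; apply: (@scalerI _ _ lam); first by rewrite gt_eqF.
    rewrite scalerA mulrN divff ?gt_eqF// scaleN1r.
    by apply/eqP; rewrite -subr_eq0 opprK -kE.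
  have : B (fun z => - lam^-1 * phi z) <= D.
    by apply: dual_le => //; apply/subsolution_admissible => //; rewrite -kL.
  rewrite BZ// mulNr -(ler_pM2l lam0) mulrN mulVKf ?gt_eqF// => h.
  by apply: le_trans le; rewrite -lerBlDr sub0r.
- move=> v cv; have [v1 v2 v3] := cv.
  have [ba ba0 baP] := continuous_bounded compact_cylinder v1.
  have [bc bc0 bcP] := continuous_bounded compact_cylinder v3.
  have /choice[bb bbP] : forall i, exists b : R, forall p, `|v.2.1 p 0 i| <= b.
    move=> i; have [b _ bP] := continuous_bounded compact_cylinder
      (continuous_component (i := i) v2).
    by exists b.
  have bb0 i : 0 <= bb i by exact: le_trans (bbP i point).
  pose b : R := ba + bc + \sum_i bb i.
  have sbb0 : 0 <= \sum_i bb i by apply: sumr_ge0 => i _.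
  have b0 : 0 < b by rewrite ltr_wpDr// addr_gt0.
  have bv : triple_le (b^-1 *: v) 1.
    move=> p; have sc (x : R) : `|x| <= b -> `|b^-1 * x| <= 1.
      by rewrite normrM gtr0_norm ?invr_gt0// ler_pdivrMl// mulr1.
    split => [|i|].
    + apply: (sc (v.1 p)); apply: le_trans (baP p) _; rewrite /b -[leRHS]addrA lerDl.
      by apply: addr_ge0 => //; exact: ltW.
    + rewrite mxE; apply: sc; rewrite (le_trans (bbP i p))//.
      rewrite /b (bigD1 i)//= addrCA lerDl.
      by apply: addr_ge0; [apply: addr_ge0; exact: ltW|apply: sumr_ge0 => j _].
    + rewrite -[X in `|X|]/(b^-1 * v.2.2 p); apply: sc; apply: le_trans (bcP p) _.
      by apply: ler_wpDr => //; apply: ler_wpDl => //; exact: ltW.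
  have ak := phi0P _ (continuous_tripleZ b^-1 cv) bv.
  exists (b / e * D + B (fun z => - (b / e) * phi0 z)).
  exists (b / e), (L phi0 + e *: (b^-1 *: v)), (fun z => - (b / e) * phi0 z).
  split => //=; [by rewrite divr_ge0// ltW|exact: smooth_torus_scale|split => //].
  rewrite LZ// scalerDr !scalerA divfK ?gt_eqF// divff ?gt_eqF// scale1r.
  by rewrite scaleNr addrAC subrr add0r.
move=> l [lD lZ lQ].
have cL phi : smooth_torus phi -> continuous_triple (L phi).
  by move=> sphi; exact: continuous_operator.
have lL_le phi : smooth_torus phi -> l (L phi) <= B phi.
  move=> sphi; apply: lQ; first exact: cL.
  exists 0, 0, phi; split => //; first exact: admissible0.
  by rewrite scale0r add0r mul0r add0r.
have lL phi : smooth_torus phi -> l (L phi) = B phi.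
  move=> sphi; apply/eqP; rewrite eq_le lL_le//=.
  have := lL_le (fun z => -1 * phi z) (smooth_torus_scale (-1) sphi).
  by rewrite LZ// BZ// lZ ?mulN1r ?lerN2//; exact: cL.
have l_le v : admissible Psi v -> l v <= D.
  move=> av; apply: lQ; first by case: av.
  exists 1, v, zero; split => //.
  by rewrite L0 B0 !addr0 scale1r mul1r.
have [|||rho [m [zeta rmzP]]] := @triple_riesz l ((D - B phi0) / e) => //.
  move=> v cv v1; have := l_le _ (phi0P v cv v1).
  rewrite lD ?lZ ?lL//; [|exact: cL|exact: continuous_tripleZ].
  by rewrite ler_pdivlMr// lerBrDl mulrC.
exists rho, m, zeta; split.
  by move=> phi sphi; rewrite -(lL phi sphi) -rmzP//; exact: cL.
by apply: energy_le => // v av; rewrite rmzP ?l_le//; case: av.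
Qed.

End strong_duality.

Unset Implicit Arguments.

Theorem theorem2p13 (R : realType) (d : nat) (nu : R) (Psi : R -> \bar R)
    (Psi_ge0 : forall r, (0 <= Psi r)%E)
    (Psi_proper : exists r, (Psi r < +oo)%E)
    (Psi_lsc : lower_semicontinuous Psi)
    (Psi_convex : econvex Psi)
    (legendre0 : legendre Psi 0 = 0%E)
    (s0 : R) (s0_gt0 : 0 < s0)
    (legendre_fin :
      forall s, s \in `[- s0, 0] -> legendre Psi s \is a fin_num)
    (rho0 rho1 : {finite_measure set (borel (torus R d)) -> \bar R}) :
  Ruot nu Psi rho0 rho1 =
    ereal_sup [set (boundary_term rho0 rho1 phi)%:E | phi in
      [set phi : R * 'rV[R]_d -> R | Ck_torus 2 phi /\ subsolution nu Psi phi]]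
  /\
  ((exists rho m zeta, competitor nu Psi rho0 rho1 rho m zeta) ->
   exists rho m zeta, continuity_equation nu rho0 rho1 rho m zeta /\
     energy Psi rho m zeta = Ruot nu Psi rho0 rho1).
Proof.
have s0_fin : legendre Psi (- s0) \is a fin_num.
  by apply: legendre_fin; rewrite in_itv/= lexx oppr_le0 ltW.
set dual := ereal_sup _.
have dual_le rho m zeta : continuity_equation nu rho0 rho1 rho m zeta ->
    (dual <= energy Psi rho m zeta)%E.
  move=> ce; apply: ge_ereal_sup => _ [phi [Cphi sub] <-].
  exact: (weak_duality Psi_ge0 ce Cphi sub).
have dual_le_Ruot : (dual <= Ruot nu Psi rho0 rho1)%E.
  by apply: le_ereal_inf_tmp => _ [rho [m [zeta [ce ->]]]]; exact: dual_le.
have dual_gtNy : (-oo < dual)%E.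
  have [phi sphi [e e0 phiP]] := @slater R d nu _ Psi_ge0 _ s0_gt0 s0_fin.
  have adm : admissible Psi (continuity_operator nu phi).
    rewrite -[continuity_operator nu phi]addr0 -(scaler0 _ e); apply: phiP.
      by split => // p; exact: cvg_cst.
    by move=> p; split => [|i|] /=; rewrite ?mxE normr0.
  apply: (@lt_le_trans _ _ (boundary_term rho0 rho1 phi)%:E); first exact: ltNyr.
  apply: ereal_sup_ubound; exists phi => //; split; first exact: sphi.
  by apply/subsolution_admissible.
have attained : (dual < +oo)%E -> exists rho m zeta,
    continuity_equation nu rho0 rho1 rho m zeta /\ energy Psi rho m zeta = dual.
  move=> dual_lty; have dual_fin : dual \is a fin_num by rewrite fin_numE gt_eqF// lt_eqF.
  have [|rho [m [zeta [ce le]]]] := @strong_duality R d nu rho0 rho1 _ Psi_ge0 _ s0_gt0 s0_fin (fine dual).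
    move=> phi Cphi sub; rewrite -lee_fin fineK//.
    by apply: ereal_sup_ubound; exists phi.
  exists rho, m, zeta; split => //; apply/eqP; rewrite eq_le dual_le// andbT.
  by rewrite -(fineK dual_fin).
have RuotE : Ruot nu Psi rho0 rho1 = dual.
  apply/eqP; rewrite eq_le dual_le_Ruot andbT.
  have [->|] := eqVneq dual +oo%E; first exact: leey.
  rewrite -ltey => /attained[rho [m [zeta [ce <-]]]].
  by apply: ereal_inf_lbound; exists rho, m, zeta.
split => // -[rho [m [zeta [ce fin]]]]; rewrite RuotE; apply: attained.
exact: le_lt_trans (dual_le _ _ _ ce) fin.
Qed.
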